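(* There is a constant $L$ such that $\pi(\mathcal{C}_\ell^-) = 1/4$ for every integer $\ell > L$ not divisible by $3$.
   Context: A $3$-graph is a $3$-uniform hypergraph. For $\ell\ge 4$, the tight cycle $\mathcal{C}_\ell$ is the $3$-graph on vertex set $\{0,1,\ldots,\ell-1\}$ with hyperedges $\{i,i+1,i+2\}$ (indices mod $\ell$), $0\le i\le \ell-1$; $\mathcal{C}_\ell^-$ is obtained from $\mathcal{C}_\ell$ by removing the hyperedge $\{\ell-1,0,1\}$. For a family $\mathbf{F}$ of $3$-graphs, $\mathrm{ex}(n,\mathbf{F})$ is the maximum number of hyperedges in an $n$-vertex $3$-graph containing no member of $\mathbf{F}$ as a (not necessarily induced) subhypergraph, and the Turán density is $\pi(\mathbf{F})=\lim_{n\to\infty}\mathrm{ex}(n,\mathbf{F})/\binom{n}{3}$; for a single $3$-graph $\mathcal{F}$, $\pi(\mathcal{F})=\pi(\{\mathcal{F}\})$. *)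

(* Defs.v *)
From HB Require Import structures.
From mathcomp Require Import all_boot all_order all_algebra.
From mathcomp Require Import all_classical all_reals all_analysis.
From mathcomp Require Import zify.

Set Implicit Arguments.
Unset Strict Implicit.
Unset Printing Implicit Defensive.

Import Order.TTheory GRing.Theory Num.Theory.
Import numFieldNormedType.Exports.

Local Open Scope ring_scope.

Definition uniform3 (V : finType) (E : {set {set V}}) : bool :=
  [forall e in E, #|e| == 3].

Definition graph3 (V : finType) : Type := {E : {set {set V}} | uniform3 E}.

Definition edges (V : finType) (G : graph3 V) : {set {set V}} := sval G.

(* Not necessarily induced: only the edges of [F] have to be preserved. *)
Definition contains (V W : finType) (H : graph3 V) (F : graph3 W) : Prop :=
  exists f : W -> V,
    injective f /\ forall e, e \in edges F -> f @: e \in edges H.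

Definition family3 : Type := {V : finType & graph3 V} -> Prop.

Definition family_free (V : finType) (Fs : family3) (H : graph3 V) : Prop :=
  forall F, Fs F -> ~ contains H (projT2 F).

Definition ex (n : nat) (Fs : family3) : nat :=
  \max_(H : graph3 'I_n | `[< family_free Fs H >]) #|edges H|.

Definition turan_ratio (R : realType) (Fs : family3) (n : nat) : R :=
  (ex n Fs)%:R / 'C(n, 3)%:R.

(* The limit always exists, see [is_cvg_turan_ratio] below. *)
Definition family_turan_density (R : realType) (Fs : family3) : R :=
  lim (turan_ratio R Fs @ \oo)%classic.

Definition turan_density (R : realType) (V : finType) (F : graph3 V) : R :=
  family_turan_density R (fun G => G = existT graph3 V F).

(* [ordS] is the successor modulo [l]. *)
Definition tight_cycle_edges (l : nat) : {set {set 'I_l}} :=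
  [set [set i; ordS i; ordS (ordS i)] | i : 'I_l].

Definition tight_cycle_minus_edges (l : nat) : {set {set 'I_l}} :=
  tight_cycle_edges l :\ [set x : 'I_l | val x \in [:: l.-1; 0; 1]%N].

Lemma tight_cycle_uniform3 (l : nat) :
  (4 <= l)%N -> uniform3 (tight_cycle_edges l).
Proof.
move=> hl; apply/forall_inP => e /imsetP[i _ ->].
have modS (k : nat) : (k < l)%N -> (k.+1 %% l = if k.+1 == l then 0 else k.+1)%N.
  by move=> kl; case: eqP => [->|/eqP ne]; rewrite ?modnn // modn_small // ltn_neqAle ne.
have h1 := modS i (ltn_ord i); have h2 := modS (ordS i) (ltn_ord (ordS i)).
have hi := ltn_ord i.
have [n01 n02 n12] : [/\ i != ordS i, i != ordS (ordS i) & ordS i != ordS (ordS i)].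
  move: h2; rewrite -!val_eqE /= h1 => ->.
  by split; case: (eqVneq i.+1 l) => ?; try case: (eqVneq _ l) => ?; lia.
by rewrite -finset.setUA !cardsU1 cards1 !inE negb_or n01 n02 n12.
Qed.

Lemma tight_cycle_minus_uniform3 (l : nat) :
  (4 <= l)%N -> uniform3 (tight_cycle_minus_edges l).
Proof.
move=> hl; apply/forall_inP => e; rewrite !inE => /andP[_ he].
by move/forall_inP: (tight_cycle_uniform3 hl) => ->.
Qed.

Definition tight_cycle (l : nat) (hl : (4 <= l)%N) : graph3 'I_l :=
  exist _ (tight_cycle_edges l) (tight_cycle_uniform3 hl).

Definition tight_cycle_minus (l : nat) (hl : (4 <= l)%N) : graph3 'I_l :=
  exist _ (tight_cycle_minus_edges l) (tight_cycle_minus_uniform3 hl).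

Lemma removed_edge_in_tight_cycle (l : nat) : (4 <= l)%N ->
  [set x : 'I_l | val x \in [:: l.-1; 0; 1]%N] \in tight_cycle_edges l.
Proof.
case: l => // l hl; apply/imsetP; exists ord_max => //.
apply/setP => x; rewrite !inE -!val_eqE /= modnn modn_small ?orbA //.
exact: leq_trans hl.
Qed.

Lemma ex_averaging (n : nat) (Fs : family3) :
  (ex n.+1 Fs * (n.+1 - 3) <= n.+1 * ex n Fs)%N.
Proof.
rewrite /ex; apply: (big_ind (fun m => (m * (n.+1 - 3) <= n.+1 * ex n Fs)%N)).
- by rewrite mul0n.
- by move=> a b ha hb; rewrite maxnMl geq_max ha hb.
move=> [H Hu] /asboolP Hfree; rewrite /edges /=.
have Hu3 e : e \in H -> #|e| = 3 by move=> eH; apply/eqP; have /forall_inP := Hu; apply.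
pose D (v : 'I_n.+1) : {set {set 'I_n}} := [set e : {set 'I_n} | lift v @: e \in H].
have Du v : uniform3 (D v).
  apply/forall_inP => e; rewrite inE => /Hu3 <-.
  by rewrite card_imset //; exact: lift_inj.
have Dex v : (#|D v| <= ex n Fs)%N.
  apply: (@leq_bigmax_cond _ _ (fun K : graph3 'I_n => #|edges K|) (exist _ (D v) (Du v))).
  apply/asboolP => F FF [f [finj fE]]; apply: (Hfree F FF).
  exists (lift v \o f); split; first by move=> x y /= /lift_inj /finj.
  by move=> e /fE; rewrite /edges /= inE (imset_comp (lift v) f).
have Dcard v : #|D v| = (\sum_(e in H) (v \notin e))%N.
  rewrite -sum1_card [RHS](eq_bigr (fun e : {set 'I_n.+1} => if v \notin e then 1%N else 0%N)); last first.
    by move=> e _; case: (v \notin e).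
  rewrite -big_mkcondr sum1_card sum1_card.
  rewrite -(card_imset (mem (D v)) (imset_inj (@lift_inj _ v))).
  apply: eq_card => e; apply/imsetP/andP => [[e' ]|[eH ve]].
    rewrite inE => e'H ->; split=> //; apply/imsetP => -[x _ /eqP].
    by rewrite (negbTE (neq_lift _ _)).
  have Ee : lift v @: [set x | lift v x \in e] = e.
    apply/setP => y; apply/imsetP/idP => [[x]|ye]; first by rewrite inE => ? ->.
    have [x Ex|Ey] := unliftP v y; first by exists x => //; rewrite inE -Ex.
    by rewrite -Ey ye in ve.
  by exists [set x | lift v x \in e]; rewrite ?inE Ee.
have -> : (#|H| * (n.+1 - 3) = \sum_(v < n.+1) #|D v|)%N.
  under eq_bigr do rewrite Dcard.
  rewrite exchange_big /= -sum_nat_const; apply: eq_bigr => e /Hu3 e3.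
  have -> : (n.+1 - 3 = #|~: e|)%N.
    by have := cardsC e; rewrite card_ord e3 => E; lia.
  rewrite -sum1_card big_mkcond /=.
  by apply: eq_bigr => v _; rewrite inE; case: (v \in e).
rewrite -[X in (_ <= X * _)%N]card_ord -sum_nat_const.
by apply: leq_sum => v _.
Qed.

Lemma is_cvg_turan_ratio (R : realType) (Fs : family3) :
  cvgn (turan_ratio R Fs).
Proof.
suff /cvg_ex[a ha] : cvgn (fun n => turan_ratio R Fs (n + 3)).
  by apply/cvg_ex; exists a; rewrite -(cvg_shiftn 3).
apply: nonincreasing_is_cvgn; last first.
  by exists 0 => _ [n _ <-]; rewrite /turan_ratio divr_ge0.
apply/nonincreasing_seqP => n; rewrite /turan_ratio /= addSn.
set m := (n + 3)%N.
have c0 : (0 < 'C(m, 3))%N by rewrite bin_gt0 leq_addl.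
have c1 : (0 < 'C(m.+1, 3))%N by rewrite bin_gt0 ltnW // ltnS leq_addl.
rewrite ler_pdivrMr ?ltr0n // mulrAC ler_pdivlMr ?ltr0n // -!natrM ler_nat.
have key := ex_averaging m Fs.
have k0 : (0 < m.+1 - 3)%N by rewrite subn_gt0 ltnS leq_addl.
rewrite -(leq_pmul2r k0) mulnAC.
have E : ('C(m.+1, 3) * (m.+1 - 3) = m.+1 * 'C(m, 3))%N.
  by rewrite mulnC -mul_bin_down.
by rewrite -[X in (_ <= X)%N]mulnA E mulnCA mulnA leq_mul2r key orbT.
Qed.

(* Main.v *)
Require Import Defs.
From mathcomp Require Import all_boot all_order all_algebra.
From mathcomp Require Import all_classical all_reals all_analysis.
From mathcomp Require Import ring lra zify.
Set Implicit Arguments.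
Unset Strict Implicit.
Unset Printing Implicit Defensive.
Import Order.TTheory GRing.Theory Num.Theory.
Local Open Scope ring_scope.

(** Call a closed tight walk bad if its length is not divisible by 3; [C_l^-] maps
    homomorphically to every 3-graph with a short bad closed walk (both residues occur,
    since every step of a tight walk can be undone by two steps). In a 3-graph without short
    bad closed walks, after deleting the edges on pairs of small codegree, the tight
    components have bounded diameter, hence each is tripartite and they colour the pairs
    disjointly. Counting monochromatic corners of triples bounds the number of monochromatic
    triangles by [n^3/24], and near-equality forces one component that is almost complete
    tripartite with parts of size about [n/3]. When all degrees are at least [n^2/8], every
    vertex has a well-defined class, and edges violating the tripartition are outnumbered by
    missing crossing triples; so [e(H) <= abc + e(H[A]) + e(H[B]) + e(H[C])] and induction
    gives [e(H) <= n^3/24 + O(n^2)]. Sampling and Erdős' box theorem transfer the bound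
    from homomorphism-free to [C_l^-]-free 3-graphs. The lower bound is the iterated
    complete tripartite construction. *)

(** The absence of bad closed walks is available only up to a length fixed in advance, so a
    component can be labelled modulo 3 only if its pairs are joined by walks of length bounded
    independently of the number of vertices. This is why low codegrees must go, and it fixes the
    order of the constants: an accuracy [rho], then a diameter parameter [D], then a walk length
    [K], finally [L]. The triple wrapping around both ends is absent from [C_l^-], so a closed walk
    need not satisfy it; already three triples on four points carry a bad closed walk, and therefore
    all links are triangle-free. The exact bound is proved by induction over induced subgraphs of
    every size, which requires a hypothesis without a threshold on the number of vertices. Excluding
    homomorphic images is such a hypothesis; excluding [C_l^-] itself is not, since a complete
    3-graph on fewer than [l] vertices is allowed. The quadratic error term is what lets the
    deletion of a vertex of small degree go through. *)

(** * Normalised averages and densities on a finite set *)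

Section Avg.
Variables (R : realFieldType) (V : finType).
Implicit Types (f g : V -> R) (P Q : pred V).

(** Counts of pairs and triples become iterated averages. On an empty [V] every average is 0, since
    the inverse of 0 is 0. *)
Definition avg f : R := (\sum_x f x) / #|V|%:R.
Definition mu P : R := avg (fun x => (P x)%:R).

Lemma eq_avg f g : f =1 g -> avg f = avg g.
Proof. by move=> fg; rewrite /avg; under eq_bigr do rewrite fg. Qed.

Lemma avgD f g : avg (fun x => f x + g x) = avg f + avg g.
Proof. by rewrite /avg big_split mulrDl. Qed.

Lemma avgZ a f : avg (fun x => a * f x) = a * avg f.
Proof. by rewrite /avg -mulr_sumr mulrA. Qed.

Lemma avgZr a f : avg (fun x => f x * a) = avg f * a.
Proof. by rewrite /avg -mulr_suml mulrAC. Qed.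

Lemma avgB f g : avg (fun x => f x - g x) = avg f - avg g.
Proof. by rewrite /avg big_split mulrDl sumrN mulNr. Qed.

Lemma le_avg f g : (forall x, f x <= g x) -> avg f <= avg g.
Proof. by move=> fg; rewrite ler_wpM2r ?invr_ge0 ?ler0n// ler_sum. Qed.

Lemma avg_ge0 f : (forall x, 0 <= f x) -> 0 <= avg f.
Proof. by move=> f0; rewrite mulr_ge0 ?invr_ge0 ?ler0n// sumr_ge0. Qed.

Lemma avg_cst a : (0 < #|V|)%N -> avg (fun=> a) = a.
Proof.
move=> n0; rewrite /avg sumr_const -[a *+ _]mulr_natr -mulrA divff ?mulr1//.
by rewrite pnatr_eq0 -lt0n.
Qed.

Lemma avg_le_cst a f : 0 <= a -> (forall x, f x <= a) -> avg f <= a.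
Proof.
move=> a0 fa; case: (posnP #|V|) => [V0|n0]; last by rewrite -(avg_cst a n0) le_avg.
by rewrite /avg V0 invr0 mulr0.
Qed.

Lemma avg_swap (F : V -> V -> R) :
  avg (fun x => avg (fun y => F x y)) = avg (fun y => avg (fun x => F x y)).
Proof. by rewrite /avg -!mulr_suml exchange_big. Qed.

Lemma avg_sum (J : finType) (F : J -> V -> R) :
  avg (fun x => \sum_j F j x) = \sum_j avg (F j).
Proof. by rewrite /avg exchange_big mulr_suml. Qed.

Lemma mu_ge0 P : 0 <= mu P.
Proof. by apply: avg_ge0 => x; rewrite ler0n. Qed.

Lemma mu_le1 P : mu P <= 1.
Proof. by apply: avg_le_cst => // x; rewrite lern1 leq_b1. Qed.

Lemma le_ind (b c : bool) : (b -> c) -> b%:R <= c%:R :> R.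
Proof. by case: b => // ->. Qed.

Lemma le_ind2 (a b c : bool) : (a -> b || c) -> a%:R <= b%:R + c%:R :> R.
Proof. case: a b c => -[] [] => [_|_|_|/(_ isT)//|_|_|_|_]; rewrite /= ?mulr1n ?mulr0n; lra. Qed.

Lemma ind_ge0 (b : bool) : 0 <= b%:R :> R.
Proof. exact: ler0n. Qed.

Lemma ind_le1 (b : bool) : b%:R <= 1 :> R.
Proof. by rewrite lern1 leq_b1. Qed.

Lemma indM (a b : bool) : (a && b)%:R = a%:R * b%:R :> R.
Proof. by case: a b => -[]; rewrite ?mul0r ?mulr0 ?mul1r. Qed.

Lemma le_mu P Q : (forall x, P x -> Q x) -> mu P <= mu Q.
Proof. by move=> PQ; apply: le_avg => x; apply: le_ind; apply: PQ. Qed.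

Lemma eq_mu P Q : P =1 Q -> mu P = mu Q.
Proof. by move=> PQ; apply: eq_avg => x; rewrite PQ. Qed.

Lemma le_mu2 (P Q S : pred V) :
  (forall x, P x -> Q x || S x) -> mu P <= mu Q + mu S.
Proof. by move=> PQS; rewrite -avgD; apply: le_avg => x; apply: le_ind2; apply: PQS. Qed.

Lemma mu_disjointU P Q :
  (forall x, P x -> ~~ Q x) -> mu (fun x => P x || Q x) = mu P + mu Q.
Proof.
move=> PQ; rewrite -avgD; apply: eq_avg => x.
by move: (PQ x); case: (P x); case: (Q x) => //=; rewrite ?addr0 ?add0r // => /(_ isT).
Qed.

Lemma mu_gt0 P : 0 < mu P -> exists x, P x.
Proof.
move=> m0; apply/existsP; apply: contraLR m0 => /existsPn E.
rewrite -leNgt /mu (@eq_avg _ (fun=> 0)) ?avg_le_cst// => x.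
by rewrite (negbTE (E x)).
Qed.

Lemma markov f a c : (forall x, 0 <= f x) -> 0 < a -> avg f <= c ->
  mu (fun x => a < f x) <= c / a.
Proof.
move=> f0 a0 fc; rewrite ler_pdivlMr// -avgZr; apply: le_trans fc.
apply: le_avg => x; case: ltP => [/ltW|_]; rewrite ?mul1r ?mul0r//.
Qed.

(** A minimiser of [f] on [P] does at least as well as the average over [P]; the factor [mu P] stays
    on the left to avoid a quotient. *)
Lemma pick_le P f c : avg (fun x => (P x)%:R * f x) <= c -> 0 < mu P ->
  exists2 x, P x & f x * mu P <= c.
Proof.
move=> fg /[dup] m0 /mu_gt0[x0 Px0].
have [x Px xmin] := arg_minP f Px0.
exists x => //; apply: le_trans fg; rewrite mulrC -avgZr.
apply: le_avg => y; case Py: (P y); rewrite ?mul1r ?mul0r//.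
exact: xmin.
Qed.

Lemma avg_gt f c : c < avg f -> 0 <= c -> exists x, c < f x.
Proof.
move=> fc c0; apply/existsP; apply: contraLR fc => /existsPn E.
by rewrite -leNgt avg_le_cst// => x; rewrite leNgt; apply/negP; apply/negP/E.
Qed.

Lemma avg2_split P Q : avg (fun x => avg (fun y => (P x && Q y)%:R)) = mu P * mu Q.
Proof.
rewrite -avgZr; apply: eq_avg => x; rewrite -avgZ; apply: eq_avg => y.
by rewrite indM.
Qed.

End Avg.

(** * Residues modulo 3 *)

Lemma Z3_ind (P : 'Z_3 -> Prop) : P 0 -> P 1 -> P (1 + 1) -> forall i, P i.
Proof.
move=> P0 P1 P2 [[|[|[|//]]] hi].
- by rewrite (_ : Ordinal hi = 0)//; apply: val_inj.
- by rewrite (_ : Ordinal hi = 1)//; apply: val_inj.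
- by rewrite (_ : Ordinal hi = 1 + 1)//; apply: val_inj.
Qed.

Lemma Z3_sides (a b c : 'Z_3) : a != c -> b != c ->
  (a == b) = ((a == c + 1) == (b == c + 1)).
Proof. by elim/Z3_ind: a; elim/Z3_ind: b; elim/Z3_ind: c. Qed.

Lemma Z3_neqE (a c : 'Z_3) : a != c -> (a != c + 1) = (a == c + 1 + 1).
Proof. by elim/Z3_ind: a; elim/Z3_ind: c. Qed.

(** * Colourings of pairs with tripartite colour classes: counting and stability *)

Section Colouring.
Variables (R : realFieldType) (V J : finType).
Variable kap : V -> V -> option J.
Variable tau : J -> V -> 'Z_3.
Hypothesis kapC : forall x y, kap x y = kap y x.
Hypothesis tauP : forall j x y, kap x y = Some j -> tau j x != tau j y.

Local Notation avg := (@avg R V).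
Local Notation mu := (@mu R V).

(** Uncoloured pairs agree with nothing, not even with each other. *)
Definition eqc (a b : option J) := (a == b) && (a != None).
Definition corner v x y := eqc (kap v x) (kap v y).
Definition same v x y :=
  if kap v x is Some j then (kap v y == Some j) && (tau j x == tau j y) else false.
Definition opp v x y :=
  if kap v x is Some j then (kap v y == Some j) && (tau j x != tau j y) else false.
Definition mono v x y := corner v x y && eqc (kap v x) (kap x y).
Definition rainbow v x y := [&& ~~ corner v x y, ~~ corner x v y & ~~ corner y v x].
Definition unfilled v x y := opp v x y && ~~ mono v x y.
Definition bad v x y :=
  [|| rainbow v x y, unfilled v x y, unfilled x v y | unfilled y v x].

Lemma eqcC a b : eqc a b = eqc b a.
Proof. by case: a b => [a|] [b|]; rewrite /eqc //= ?andbT eq_sym. Qed.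

Lemma cornerC v x y : corner v x y = corner v y x.
Proof. exact: eqcC. Qed.

Lemma oppC v x y : opp v x y = opp v y x.
Proof.
rewrite /opp; case Ex: (kap v x) => [j|]; case Ey: (kap v y) => [k|] //=.
rewrite !(inj_eq Some_inj); by have [->|] := eqVneq k j; rewrite //= eq_sym.
Qed.

Lemma eqc_trans a b c : eqc a b -> eqc a c -> eqc b c.
Proof. by move=> /andP[/eqP-> ?] /andP[/eqP-> ?]; rewrite /eqc eqxx. Qed.

Lemma monoP v x y : mono v x y = [&& corner v x y, corner x v y & corner y v x].
Proof.
rewrite /mono /corner (kapC x v) (kapC y v) (kapC y x).
apply/andP/and3P => [[h1 h2]|[h1 h2 h3]]; split => //; exact: eqc_trans h1 h2.
Qed.

Lemma monoC2 v x y : mono v x y = mono v y x.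
Proof. by rewrite !monoP (cornerC v x y) (cornerC x v y) (cornerC y v x) [corner x _ _ && _]andbC. Qed.

(** By transitivity a triple has 0, 1 or 3 monochromatic corners: 0 means rainbow and 3 means a
    monochromatic triangle. *)
Lemma corner_count v x y :
  (corner v x y + corner x v y + corner y v x + rainbow v x y <= 1 + (mono v x y + mono v x y))%N.
Proof.
rewrite monoP /rainbow.
have h1 : corner v x y -> corner x v y -> corner y v x.
  by rewrite /corner (kapC x v) (kapC y v) (kapC y x); apply: eqc_trans.
have h2 : corner v x y -> corner y v x -> corner x v y.
  by rewrite /corner (kapC x v) (kapC y v) (kapC y x) eqcC; apply: eqc_trans.
have h3 : corner x v y -> corner y v x -> corner v x y.
  rewrite /corner (kapC x v) (kapC y v) (kapC y x) eqcC (eqcC (kap v y)).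
  exact: eqc_trans.
by move: h1 h2 h3; case: corner; case: corner; case: corner => //= h1 h2 h3; auto.
Qed.

Lemma cornerE v x y : (corner v x y = same v x y + opp v x y :> nat)%N.
Proof.
rewrite /corner /same /opp /eqc; case: (kap v x) => [j|]; last by rewrite andbF.
by rewrite andbT eq_sym; case: eqP => //= _; case: eqP.
Qed.

Lemma mono_opp v x y : mono v x y -> opp v x y.
Proof.
rewrite /mono /corner /opp /eqc; case Ex: (kap v x) => [j|]; rewrite ?andbF//=.
by rewrite !andbT => /andP[/eqP<- /eqP/esym/tauP->]; rewrite eqxx.
Qed.

Lemma rainbowC v x y : rainbow v x y = rainbow x v y.
Proof. by rewrite /rainbow (cornerC y v x) andbCA. Qed.

Lemma rainbowC2 v x y : rainbow v x y = rainbow v y x.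
Proof.
by rewrite /rainbow (cornerC v x y) (cornerC x v y) (cornerC y v x)
  [~~ corner x _ _ && _]andbC.
Qed.

Lemma unfilledC v x y : unfilled v x y = unfilled v y x.
Proof. by rewrite /unfilled oppC monoC2. Qed.

Lemma badC v x y : bad v x y = bad x v y.
Proof.
rewrite /bad (rainbowC v x y) (unfilledC y v x).
by case: (rainbow x v y) => //=; rewrite orbCA.
Qed.

Lemma badC2 v x y : bad v x y = bad v y x.
Proof.
by rewrite /bad rainbowC2 (unfilledC v x y) [unfilled x v y || _]orbC.
Qed.

(* [x] sees [d] and [y] on two different sides of the colour class [T]. *)
Lemma bad_apex T d x y : kap x d = Some T -> kap x y = Some T ->
  kap d y != Some T -> tau T d != tau T y -> bad d x y.
Proof.
move=> xd xy dy tt; suff u : unfilled x d y by rewrite /bad u !orbT.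
rewrite /unfilled /opp xd xy eqxx tt /= /mono /corner xd xy.
by rewrite /eqc eqxx /= (eq_sym (Some T)) (negbTE dy).
Qed.

Lemma bad_base T d x y : kap x y = Some T -> kap d x != Some T ->
  kap d y != Some T -> ~~ same d x y -> bad d x y.
Proof.
move=> xy dx dy ns; rewrite /bad /rainbow.
have [c|c] := boolP (corner d x y).
  have o : opp d x y.
    by move: (cornerE d x y); rewrite c (negbTE ns); case: (opp d x y).
  rewrite /unfilled o /mono c /= xy.
  have -> : eqc (kap d x) (Some T) = false by rewrite /eqc (negbTE dx).
  by rewrite /= ?orbT.
have -> : corner x d y = false.
  by rewrite /corner kapC xy /eqc (negbTE dx).
have -> // : corner y d x = false.
by rewrite /corner kapC (kapC y) xy /eqc (negbTE dy).
Qed.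

(** The neighbours of [v] in colour [j] lie on the two sides other than that of [v]; this is the
    indicator of one side minus that of the other. *)
Definition sg j v x : R :=
  if kap v x == Some j then (if tau j x == tau j v + 1 then 1 else -1) else 0.

Lemma same_sub_opp v x y :
  (same v x y)%:R - (opp v x y)%:R = \sum_j sg j v x * sg j v y.
Proof.
rewrite /same /opp; case Ex: (kap v x) => [j|]; last first.
  by rewrite subr0 big1// => j _; rewrite /sg Ex mul0r.
rewrite (bigD1 j)//= big1 ?addr0; last first.
  by move=> k kj; rewrite /sg Ex (inj_eq Some_inj) eq_sym (negbTE kj) mul0r.
rewrite /sg Ex eqxx; case: eqP => [Ey|_]; rewrite ?mulr0 ?subr0//=.
have hx := tauP Ex; have hy := tauP Ey; rewrite eq_sym in hx; rewrite eq_sym in hy.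
rewrite (Z3_sides hx hy).
by case: (_ == _ + 1); case: (_ == _ + 1) => /=;
  rewrite ?mul1r ?mulr1 ?mulrNN ?subr0 ?sub0r ?mulr1.
Qed.

Definition imb v : R := avg (fun x => avg (fun y => (same v x y)%:R - (opp v x y)%:R)).

Lemma imbE v : imb v = \sum_j (avg (sg j v)) ^+ 2.
Proof.
rewrite /imb (eq_avg (g := fun x => \sum_j sg j v x * avg (sg j v))); last first.
  move=> x; rewrite (eq_avg (same_sub_opp v x)) avg_sum.
  by apply: eq_bigr => j _; rewrite avgZ.
by rewrite avg_sum; apply: eq_bigr => j _; rewrite avgZr expr2.
Qed.

Lemma imb_ge j v : (avg (sg j v)) ^+ 2 <= imb v.
Proof.
rewrite imbE (bigD1 j)//= lerDl; apply: sumr_ge0 => k _; exact: sqr_ge0.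
Qed.

Lemma imb_ge0 v : 0 <= imb v.
Proof. by rewrite imbE; apply: sumr_ge0 => k _; apply: sqr_ge0. Qed.

Definition avg3 (F : V -> V -> V -> bool) : R :=
  avg (fun v => avg (fun x => avg (fun y => (F v x y)%:R))).

Lemma avg3C F : avg3 (fun v x y => F x v y) = avg3 F.
Proof. exact: avg_swap. Qed.

Lemma avg3C2 F : avg3 (fun v x y => F y v x) = avg3 F.
Proof.
rewrite /avg3 [RHS]avg_swap; apply: eq_avg => v; exact: avg_swap.
Qed.

Lemma avg3_ge0 F : 0 <= avg3 F.
Proof. by do 3!apply: avg_ge0 => ?; apply: ind_ge0. Qed.

Lemma avg3_opp : avg3 opp = avg3 mono + avg3 unfilled.
Proof.
rewrite /avg3 -avgD; apply: eq_avg => v; rewrite -avgD; apply: eq_avg => x.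
rewrite -avgD; apply: eq_avg => y; rewrite /unfilled.
by case: (boolP (mono v x y)) => [/mono_opp->|_]; rewrite ?andbF ?andbT ?addr0 ?add0r.
Qed.

(** Corners have total density 3 (same + opp) = 6 opp + 3 imb, and opp splits into filled (mono) and
    unfilled; [corner_count] bounds the total, together with rainbow, by 1 + 2 mono. The other terms
    are nonnegative, so mono is at most 1/4 and near-equality makes each of them small. *)
Lemma mono_count :
  4 * avg3 mono + 6 * avg3 unfilled + 3 * avg imb + avg3 rainbow <= 1.
Proof.
have I : avg imb = avg3 same - avg3 opp.
  rewrite /avg3 -avgB; apply: eq_avg => v; rewrite -avgB; apply: eq_avg => x.
  by rewrite -avgB.
have C : avg3 corner = avg3 same + avg3 opp.
  rewrite /avg3 -avgD; apply: eq_avg => v; rewrite -avgD; apply: eq_avg => x.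
  by rewrite -avgD; apply: eq_avg => y; rewrite cornerE natrD.
have: avg3 corner + avg3 (fun v x y => corner x v y)
      + avg3 (fun v x y => corner y v x) + avg3 rainbow - 2 * avg3 mono <= 1.
  rewrite /avg3 -avgZ -!avgD -avgB; apply: avg_le_cst => // v.
  rewrite -avgZ -!avgD -avgB; apply: avg_le_cst => // x.
  rewrite -avgZ -!avgD -avgB; apply: avg_le_cst => // y.
  have := corner_count v x y; rewrite -(ler_nat R) !natrD; lra.
rewrite (avg3C corner) (avg3C2 corner) C; have := avg3_opp; lra.
Qed.

(** Three scales: [eta] is the deficit of the count, [rho ^+ 2] bounds the share of exceptional
    vertices and the defects at a good vertex, [rho] is the final precision. One square root is lost
    to Markov's inequality, another to the sum of squares. *)
Variables (rho eta : R).
Hypothesis rho_gt0 : 0 < rho.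
Hypothesis rho_small : rho <= (1 / 100) ^+ 2.
Local Notation eps := (rho ^+ 2).
Hypothesis eta_small : 6 * eta <= eps ^+ 2.
Hypothesis many_mono : 1 / 4 - eta <= avg3 mono.
Hypothesis V_gt0 : (0 < #|V|)%N.

Let rhoS : rho <= 1 / 10000. Proof. by move: rho_small; rewrite !expr2; lra. Qed.

Let eps_gt0 : 0 < eps. Proof. by rewrite exprn_gt0. Qed.

Let eps_small : eps <= rho / 10000.
Proof. by rewrite expr2 ler_pM2l//; have := rhoS; lra. Qed.

Let eta_eps : 6 * eta <= eps / 10000.
Proof.
apply: le_trans eta_small _; rewrite expr2 ler_pM2l//.
by apply: le_trans eps_small _; have := rhoS; lra.
Qed.

Lemma bad_small : avg3 bad <= 4 * eta /\ avg imb <= 4 / 3 * eta.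
Proof.
have h : avg3 bad <= avg3 rainbow + (avg3 unfilled + (avg3 unfilled + avg3 unfilled)).
  rewrite -{2}(avg3C unfilled) -{2}(avg3C2 unfilled) /avg3 -!avgD.
  apply: le_avg => v; rewrite -!avgD; apply: le_avg => x; rewrite -!avgD; apply: le_avg => y.
  apply: le_trans (le_ind2 _ (fun h => h)) _; rewrite lerD2l.
  apply: le_trans (le_ind2 _ (fun h => h)) _; rewrite lerD2l.
  exact: le_ind2.
have h1 := mono_count; have h2 := avg3_ge0 unfilled; have h3 := avg3_ge0 rainbow.
have h4 : 0 <= avg imb by apply: avg_ge0 => v; apply: imb_ge0.
have h5 := many_mono.
split; lra.
Qed.

Definition bd v : R := avg (fun x => avg (fun y => (bad v x y)%:R)).
Definition good v := (bd v <= eps) && (imb v <= eps).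

Lemma bd_ge0 v : 0 <= bd v.
Proof. by do 2!apply: avg_ge0 => ?; apply: ind_ge0. Qed.

Lemma notgood_small : mu (fun v => ~~ good v) <= eps.
Proof.
have [b1 b2] := bad_small.
have h : avg (fun v => bd v + imb v) <= 6 * eta.
  rewrite avgD; have := avg3_ge0 bad.
  change (0 <= avg3 bad -> avg3 bad + avg imb <= 6 * eta); lra.
have := markov (fun x => addr_ge0 (bd_ge0 x) (imb_ge0 x)) eps_gt0 h => m.
apply: le_trans (le_trans _ m) _.
  apply: le_mu => v; rewrite /good negb_and -!ltNge.
  by have := bd_ge0 v; have := imb_ge0 v => ? ? /orP[] ?; lra.
by rewrite ler_pdivrMr// -expr2.
Qed.

Lemma good_balanced v j : good v -> `|avg (sg j v)| <= rho.
Proof.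
move=> /andP[_ gi]; rewrite -ler_sqr ?nnegrE// ?(ltW rho_gt0)// real_normK ?num_real//.
exact: le_trans (imb_ge j v) gi.
Qed.

Definition side T v i x := (kap v x == Some T) && (tau T x == i).

Lemma avg_sg T v : avg (sg T v) =
  mu (side T v (tau T v + 1)) - mu (side T v (tau T v + 1 + 1)).
Proof.
rewrite -avgB; apply: eq_avg => x; rewrite /sg /side; case: eqP => [E|_]; last by rewrite subrr.
have := tauP E; rewrite eq_sym => /Z3_neqE <- /=.
by case: eqP => _; rewrite ?subr0 ?sub0r.
Qed.

Lemma good_sides T v : good v ->
  mu (side T v (tau T v + 1)) - mu (side T v (tau T v + 1 + 1)) <= rho /\
  mu (side T v (tau T v + 1 + 1)) - mu (side T v (tau T v + 1)) <= rho.
Proof.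
move=> /good_balanced-/(_ T); rewrite avg_sg ler_norml => /andP[]; lra.
Qed.

(** These [x] form one side of one colour at [d]; the other side is disjoint from it and has almost
    the same size. *)
Lemma good_same d y : good d -> mu (fun x => same d x y) <= (1 + rho) / 2.
Proof.
move=> gd; case Ey: (kap d y) => [j|]; last first.
  rewrite /mu (@eq_avg _ _ _ (fun=> 0)) ?avg_cst//; first by have := rho_gt0; lra.
  by move=> x; rewrite /same Ey; case: kap.
have sE x : same d x y = (kap d x == Some j) && (tau j x == tau j y).
  rewrite /same; case Ex: (kap d x) => [k|//]; rewrite Ey !(inj_eq Some_inj).
  by rewrite eq_sym; case: eqP => [->|].
have := good_balanced j gd; rewrite ler_norml => /andP[lo hi].
case st: (tau j y == tau j d + 1).
  have : avg (fun x => (same d x y)%:R * 2 - 1) <= avg (sg j d).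
    apply: le_avg => x; rewrite sE /sg (eqP st).
    by case: eqP; case: eqP => ? ? /=; rewrite ?mulr1n ?mulr0n; lra.
  by rewrite avgB avgZr avg_cst// /mu; lra.
have : avg (sg j d) <= avg (fun x => 1 - (same d x y)%:R * 2).
  apply: le_avg => x; rewrite sE /sg.
  case: eqP; last by move=> ?; rewrite /= ?mulr0n; lra.
  move=> ? /=; case: (eqVneq (tau j x) (tau j y)) => [->|_]; rewrite ?st /= ?mulr1n ?mulr0n; first by lra.
  by case: eqP => _; lra.
by rewrite avgB avgZr avg_cst// /mu; lra.
Qed.

Definition nonadj T (X Y : pred V) : R :=
  avg (fun x => avg (fun y => [&& X x, Y y & kap x y != Some T]%:R)).

Lemma nonadjC T X Y : nonadj T X Y = nonadj T Y X.
Proof.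
rewrite /nonadj avg_swap; apply: eq_avg => x; apply: eq_avg => y.
by rewrite kapC andbCA.
Qed.

(** The corner density at [v] is the sum of the squares of its colour degrees, hence at most the
    largest of them. A vertex with corner density near 1/2 thus has a colour of degree near 1/2, and
    balance halves it between the two sides. *)
Lemma exists_major : exists v T,
  [/\ good v, 1 / 4 - rho <= mu (side T v (tau T v + 1)) &
      1 / 4 - rho <= mu (side T v (tau T v + 1 + 1))].
Proof.
pose N2 v := avg (fun x => avg (fun y => (opp v x y)%:R)).
have N2_ge0 v : 0 <= N2 v by do 2!apply: avg_ge0 => ?; apply: ind_ge0.
have N2_le1 v : N2 v <= 1 by do 2!apply: avg_le_cst => // ?; apply: ind_le1.
have aN2 : 1 / 4 - eta <= avg N2.
  have -> : avg N2 = avg3 opp by [].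
  by rewrite avg3_opp; have := avg3_ge0 unfilled; have := many_mono; lra.
have [v gv hv] : exists2 v, good v & 1 / 4 - 3 * eps < N2 v.
  have [v] : exists v, 1 / 4 - 3 * eps < (good v)%:R * N2 v.
    apply: avg_gt; last by have := eps_small; have := rhoS; lra.
    have : avg N2 - mu (fun v => ~~ good v) <= avg (fun v => (good v)%:R * N2 v).
      rewrite -avgB; apply: le_avg => v; case: (good v); rewrite /= ?mul1r ?mul0r ?subr0//.
      by rewrite lerBlDr add0r.
    have := notgood_small; have := eta_eps; have := eps_gt0; lra.
  case E: (good v); rewrite ?mul0r ?mul1r => h; first by exists v.
  by have := eps_small; have := rhoS; lra.
have [T hT] : exists T, 1 / 2 - 6 * eps < mu (fun x => kap v x == Some T).
  apply/existsP; apply: contraLR hv => /existsPn hT; rewrite -leNgt.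
  have : avg (fun x => avg (fun y => (corner v x y)%:R)) <= 1 / 2 - 6 * eps.
    have c0 : 0 <= 1 / 2 - 6 * eps by have := eps_small; have := rhoS; lra.
    apply: avg_le_cst => // x; case Ex: (kap v x) => [j|].
      have := hT j; rewrite -leNgt; apply: le_trans; apply: le_avg => y.
      by apply: le_ind; rewrite /corner Ex /eqc andbT eq_sym.
    rewrite (@eq_avg _ _ _ (fun=> 0)) ?avg_cst// => y.
    by rewrite /corner Ex /eqc andbF.
  have -> : avg (fun x => avg (fun y => (corner v x y)%:R)) = imb v + 2 * N2 v.
    rewrite /imb /N2 -avgZ -avgD; apply: eq_avg => x; rewrite -avgZ -avgD.
    by apply: eq_avg => y; rewrite cornerE natrD; ring.
  by have := imb_ge0 v; lra.
exists v, T; split => //.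
all: have [h1 h2] := good_sides T gv.
all: have : mu (fun x => kap v x == Some T) <=
  mu (side T v (tau T v + 1)) + mu (side T v (tau T v + 1 + 1)).
1,3: apply: le_mu2 => x /eqP E; rewrite /side E eqxx /=;
     by have := tauP E; rewrite eq_sym => /Z3_neqE <-; rewrite orbN.
all: have := eps_small; have := rhoS; have := rho_gt0; lra.
Qed.

(** [P] and [Q], the two sides seen from a good [v], are almost completely joined because opposite
    corners at [v] are mostly filled. A good [x] in [P] sees almost all of [Q], and its other side
    [S], equally large, lies on the side of [v]. Goodness of [x] joins [Q] to [S], and almost every
    [y] in [Q] serves as an apex joining [P] to [S]. *)
Lemma exists_core : exists T (Cr : 'Z_3 -> pred V),
  [/\ forall i x, Cr i x -> tau T x = i,
      forall i, 1 / 4 - 3 * rho <= mu (Cr i) &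
      forall i j, i != j -> nonadj T (Cr i) (Cr j) <= 10 * rho].
Proof.
have [v [T [gv]]] := exists_major.
set t := tau T v; set P := side T v _; set Q := side T v _ => hP hQ.
have PQ : nonadj T P Q <= eps.
  have /andP[+ _] := gv; apply: le_trans; apply: le_avg => x; apply: le_avg => y.
  apply: le_ind => /and3P[/andP[/eqP vx /eqP tx] /andP[/eqP vy /eqP ty] xy].
  rewrite badC; apply: (@bad_apex T) => //; rewrite tx ty.
  by elim/Z3_ind: (t).
have gP : 1 / 5 <= mu (fun x => P x && good x).
  have : mu P <= mu (fun x => P x && good x) + mu (fun x => ~~ good x).
    by apply: le_mu2 => x ->; case: good.
  by have := notgood_small; have := eps_small; have := rhoS; lra.
have [x /andP[Px gx] hx] : exists2 x, P x && good x &
    avg (fun y => [&& P x, Q y & kap x y != Some T]%:R) * mu (fun x => P x && good x) <= eps.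
  apply: (@pick_le _ _ (fun x => P x && good x) (fun x => avg (fun y => _))).
    apply: le_trans PQ; apply: le_avg => x.
    rewrite -[leRHS]mul1r; apply: ler_wpM2r; last exact: ind_le1.
    by apply: avg_ge0 => ?; apply: ind_ge0.
  by apply: lt_le_trans gP; lra.
have {}hx : mu (fun y => Q y && (kap x y != Some T)) <= 5 * eps.
  move: hx; rewrite Px /=; set m := avg _; have m0 : 0 <= m by apply: avg_ge0 => ?; apply: ind_ge0.
  by change (m * mu (fun x => P x && good x) <= eps -> m <= 5 * eps); nra.
have /andP[/eqP vx /eqP tx] := Px.
pose S := side T x t.
have SE : S =1 side T x (tau T x + 1 + 1).
  move=> z; rewrite /S /side tx.
  by have -> : t + 1 + 1 + 1 = t by apply/eqP; elim/Z3_ind: (t).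
have hS : 1 / 4 - 3 * rho <= mu S.
  have [h1 h2] := good_sides T gx.
  have : mu Q <= mu (side T x (tau T x + 1)) + mu (fun y => Q y && (kap x y != Some T)).
    apply: le_mu2 => y /[dup] Qy /andP[_ ty]; rewrite Qy /side tx ty andbT /=.
    by case: eqP.
  by rewrite (eq_mu _ SE); have := eps_small; have := rhoS; have := rho_gt0; lra.
have QS : nonadj T Q S <= rho + eps.
  have : nonadj T Q S <= mu (fun y => Q y && (kap x y != Some T)) + bd x.
    rewrite /nonadj /bd /mu -avgD; apply: le_avg => y.
    rewrite -[X in X + _](@avg_cst R V _ V_gt0) -avgD; apply: le_avg => z.
    apply: le_ind2 => /and3P[Qy /andP[/eqP xz /eqP tz] yz]; rewrite Qy /=.
    case: eqP => //= xy; rewrite badC; apply: (@bad_apex T) => //.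
    by have /andP[_ /eqP ->] := Qy; rewrite tz; elim/Z3_ind: (t).
  have /andP[b _] := gx; have := eps_small; have := rho_gt0; lra.
have PS : nonadj T P S <= 10 * rho.
  have : nonadj T P S * mu Q <= nonadj T P Q + nonadj T Q S + avg3 bad.
    have -> : nonadj T P S * mu Q = avg (fun p => avg (fun y => avg (fun z =>
        [&& P p, S z & kap p z != Some T]%:R * (Q y)%:R))).
      rewrite -avgZr; apply: eq_avg => p; rewrite -avgZr avg_swap; apply: eq_avg => z.
      by rewrite -avgZ.
    have -> : nonadj T Q S = avg (fun p => avg (fun y => avg (fun z =>
       [&& Q y, S z & kap y z != Some T]%:R))) by rewrite avg_cst.
    rewrite /nonadj /avg3 -!avgD; apply: le_avg => p; rewrite -!avgD; apply: le_avg => y.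
    rewrite -[X in X + _ + _](@avg_cst R V _ V_gt0) -!avgD; apply: le_avg => z.
    rewrite -indM -addrA.
    apply: le_trans (@le_ind2 _ _ [&& P p, Q y & kap p y != Some T]
      ([&& Q y, S z & kap y z != Some T] || bad p y z) _) _; last first.
      by rewrite lerD2l; apply: le_ind2.
    move=> /andP[/and3P[Pp Sz pz] Qy]; rewrite Pp Qy Sz /=.
    case: eqP => //= py; case: eqP => //= yz.
    apply: (@bad_apex T) => //; first by rewrite kapC.
    by have /andP[_ /eqP->] := Pp; have /andP[_ /eqP->] := Sz; elim/Z3_ind: (t).
  have [b _] := bad_small; have := eps_small; have := rhoS; have := rho_gt0; have := eta_eps.
  have n0 : 0 <= nonadj T P S by do 2!apply: avg_ge0 => ?; apply: ind_ge0.
  by nra.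
exists T, (fun i => if i == t then S else if i == t + 1 then P else Q); split.
- move=> i y; case: eqP => [->|/eqP it]; first by move/andP=> [_ /eqP].
  case: eqP => [->|/eqP it']; first by move/andP=> [_ /eqP].
  move/andP=> [_ /eqP->]; move: it it' => + + ; rewrite -/t => it it'; apply/eqP; move: it it'.
  by elim/Z3_ind: (t); elim/Z3_ind: (i).
- move=> i; case: ifP => _ //; case: ifP => _; have := rho_gt0; lra.
have E k : [\/ k = t, k = t + 1 | k = t + 1 + 1].
  case: (eqVneq k t) => [->|h1]; first by apply: Or31.
  case: (eqVneq k (t + 1)) => [->|h2]; first by apply: Or32.
  by apply: Or33; apply/eqP; move: h1 h2; elim/Z3_ind: (t); elim/Z3_ind: (k).
have t1 : (t + 1 == t) = false by elim/Z3_ind: (t).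
have t2 : (t + 1 + 1 == t) = false by elim/Z3_ind: (t).
have t3 : (t + 1 + 1 == t + 1) = false by elim/Z3_ind: (t).
have := rho_gt0; have := eps_small => e1 r1 i j.
by case: (E i) => ->; case: (E j) => ->; rewrite ?eqxx ?t1 ?t2 ?t3 // => _;
  try lra; rewrite nonadjC; lra.
Qed.

Section Classify.
Variables (T : J) (Cr : 'Z_3 -> pred V).
Hypothesis Cr_tau : forall i x, Cr i x -> tau T x = i.
Hypothesis Cr_big : forall i, 1 / 4 - 3 * rho <= mu (Cr i).
Hypothesis Cr_adj : forall i j, i != j -> nonadj T (Cr i) (Cr j) <= 10 * rho.

Let adj d j x := Cr j x && (kap d x == Some T).
Let nad d j x := Cr j x && (kap d x != Some T).

Let mu_adj_nad d j : mu (adj d j) + mu (nad d j) = mu (Cr j).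
Proof.
rewrite -mu_disjointU; last by move=> x; rewrite /adj /nad => /andP[-> ->].
by apply: eq_mu => x; rewrite /adj /nad; case: eqP; rewrite ?andbT ?andbF ?orbF.
Qed.

(** If [d] is joined to [x], and [x] to [y], in colour [T], then [x] sees [d] and [y] on different
    sides; so [d] and [y] not being joined makes the triple bad. *)
Let adj_nad d j k : good d -> j != k -> k != tau T d ->
  mu (adj d j) * mu (nad d k) <= 11 * rho.
Proof.
move=> /andP[gd _] jk kd; rewrite -avg2_split.
have : avg (fun x => avg (fun y => (adj d j x && nad d k y)%:R)) <=
  nonadj T (Cr j) (Cr k) + bd d.
  rewrite -avgD; apply: le_avg => x; rewrite -avgD; apply: le_avg => y.
  apply: le_ind2 => /andP[/andP[-> /eqP dx] /andP[Ky dy]]; rewrite Ky /=.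
  case: eqP => //= xy; apply: (@bad_apex T) => //; first by rewrite kapC.
  by rewrite (Cr_tau Ky) eq_sym.
by have := Cr_adj jk; have := eps_small; have := rho_gt0; lra.
Qed.

(* Otherwise [d] would see almost all of the core in one colour and on one side. *)
Let not_isolated d : good d -> ~ (forall j, mu (adj d j) <= 1 / 25).
Proof.
move=> gd hd; have big j : 1 / 5 <= mu (nad d j).
  by have := mu_adj_nad d j; have := hd j; have := Cr_big j; have := rhoS; lra.
have disj i j x : i != j -> nad d i x -> ~~ nad d j x.
  move=> ij /andP[/Cr_tau xi _]; apply/negP => /andP[/Cr_tau xj _].
  by rewrite -xi -xj eqxx in ij.
(* Two core vertices joined in [T], neither joined to [d] in [T], form a bad triple with [d] unless
   [d] sees them on one side of one colour. *)
have pairs j k : j != k ->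
    avg (fun x => avg (fun y => [&& nad d j x, nad d k y & ~~ same d x y]%:R)) <= 11 * rho.
  move=> jk; have /andP[bd_small _] := gd.
  have : avg (fun x => avg (fun y => [&& nad d j x, nad d k y & ~~ same d x y]%:R)) <=
    nonadj T (Cr j) (Cr k) + bd d.
    rewrite -avgD; apply: le_avg => x; rewrite -avgD; apply: le_avg => y.
    apply: le_ind2 => /and3P[/andP[-> dx] /andP[-> dy] ns]; rewrite /=.
    by case: eqP => //= xy; apply: (@bad_base T).
  by have := Cr_adj jk; have := eps_small; have := rho_gt0; lra.
have sameC x y : same d x y = same d y x.
  have := cornerE d x y; rewrite cornerC cornerE oppC => /eqP; rewrite eqn_add2r.
  by case: same; case: same.
have same_trans x y z : same d x y -> same d x z -> same d y z.
  rewrite /same; case: (kap d x) => [j|//] /andP[/eqP-> /eqP->] /andP[/eqP-> /eqP->].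
  by rewrite !eqxx.
pose N12 x := nad d 1 x || nad d (1 + 1) x.
have [y0 Ny0 hy0] : exists2 y, nad d 0 y &
    mu (fun x => N12 x && ~~ same d y x) * mu (nad d 0) <= 22 * rho.
  apply: (@pick_le _ _ (nad d 0) (fun y => mu (fun x => N12 x && ~~ same d y x)));
    last by apply: lt_le_trans (big 0); lra.
  have h1 := pairs 0 1 isT; have h2 := pairs 0 (1 + 1) isT.
  apply: le_trans (_ : _ <= 11 * rho + 11 * rho) _; last by lra.
  apply: le_trans (lerD h1 h2); rewrite -avgD; apply: le_avg => y.
  rewrite -avgZ -avgD; apply: le_avg => x; rewrite -indM.
  by apply: le_ind2; rewrite /N12; case: (nad d 0 y) => //=; case: (same d y x);
    rewrite ?andbF ?andbT.
pose X x := same d x y0.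
have hX12 : mu (fun x => N12 x && ~~ X x) <= 1 / 50.
  have -> : mu (fun x => N12 x && ~~ X x) = mu (fun x => N12 x && ~~ same d y0 x).
    by apply: eq_mu => x; rewrite /X sameC.
  have := mu_ge0 R (fun x => N12 x && ~~ same d y0 x).
  have := big 0; have := rhoS; move: hy0; nra.
have hX1 : 1 / 10 <= mu (fun x => nad d 1 x && X x).
  have : mu (nad d 1) <= mu (fun x => nad d 1 x && X x) + mu (fun x => N12 x && ~~ X x).
    by apply: le_mu2 => x; rewrite /N12 => ->; case: (X x).
  by have := big 1; lra.
have [x0 /andP[Nx0 Xx0] hx0] : exists2 x, nad d 1 x && X x &
    mu (fun y => nad d 0 y && ~~ same d x y) * mu (fun x => nad d 1 x && X x) <= 11 * rho.
  apply: (@pick_le _ _ (fun x => nad d 1 x && X x)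
    (fun x => mu (fun y => nad d 0 y && ~~ same d x y))); last by lra.
  apply: le_trans (pairs 1 0 isT); apply: le_avg => x.
  rewrite -avgZ; apply: le_avg => y; rewrite -indM.
  by apply: le_ind => /and3P[/andP[-> _] -> ->].
have hX0 : mu (fun y => nad d 0 y && ~~ X y) <= 1 / 50.
  have : mu (fun y => nad d 0 y && ~~ X y) <= mu (fun y => nad d 0 y && ~~ same d x0 y).
    apply: le_mu => y /andP[-> nX] /=; apply: contra nX => s.
    by apply: (same_trans x0).
  have := mu_ge0 R (fun y => nad d 0 y && ~~ same d x0 y).
  have := rhoS; move: hx0 hX1; nra.
(* The unjoined part of the core has density at least 3/5, while one side of one colour at [d] holds
   barely more than 1/2. *)
have : mu (nad d 0) + (mu (nad d 1) + mu (nad d (1 + 1))) <=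
    mu X + (mu (fun x => N12 x && ~~ X x) + mu (fun y => nad d 0 y && ~~ X y)).
  rewrite -mu_disjointU; last by move=> x; apply: disj.
  rewrite -mu_disjointU; last first.
    by move=> x n0; rewrite negb_or !(disj 0).
  rewrite -!avgD; apply: le_avg => x; rewrite -/(N12 x).
  apply: le_trans (@le_ind2 _ _ (X x) ((N12 x && ~~ X x) || (nad d 0 x && ~~ X x)) _) _.
    by case: (X x) => //=; rewrite !andbT orbC.
  by rewrite lerD2l; apply: le_ind2.
have := good_same y0 gd; rewrite -/X.
by have := big 0; have := big 1; have := big (1 + 1); have := rhoS; lra.
Qed.

(** By the product bounds, [d] sees both of the other classes almost fully or both almost not at
    all; the latter is excluded by [not_isolated]. *)
Lemma good_adj_core d j : good d -> j != tau T d ->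
  mu (fun x => Cr j x && (kap d x != Some T)) <= 1 / 25.
Proof.
move=> gd jd; set i := tau T d in jd.
have hA : mu (adj d (i + 1)) * mu (nad d (i + 1 + 1)) <= 11 * rho.
  by apply: adj_nad => //; rewrite -/i; elim/Z3_ind: (i).
have hB : mu (adj d (i + 1 + 1)) * mu (nad d (i + 1)) <= 11 * rho.
  by apply: adj_nad => //; rewrite -/i; elim/Z3_ind: (i).
have sA := mu_adj_nad d (i + 1); have sB := mu_adj_nad d (i + 1 + 1).
have bA := Cr_big (i + 1); have bB := Cr_big (i + 1 + 1).
have p1 := mu_ge0 R (adj d (i + 1)); have p2 := mu_ge0 R (nad d (i + 1)).
have p3 := mu_ge0 R (adj d (i + 1 + 1)); have p4 := mu_ge0 R (nad d (i + 1 + 1)).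
have cases3 k : [\/ k = i, k = i + 1 | k = i + 1 + 1].
  case: (eqVneq k i) => [->|h1]; first by apply: Or31.
  case: (eqVneq k (i + 1)) => [->|h2]; first by apply: Or32.
  by apply: Or33; apply/eqP; move: h1 h2; elim/Z3_ind: (i); elim/Z3_ind: (k).
case: (lerP (mu (adj d (i + 1))) (1 / 25)) => hC.
  case: (not_isolated gd) => k; case: (cases3 k) => -> //.
    rewrite (_ : mu _ = 0); first by lra.
    rewrite /mu (@eq_avg _ _ _ (fun=> 0)) ?avg_cst// => x.
    rewrite /adj; case: eqP; rewrite ?andbF// => /tauP; case E: (Cr i x) => //.
    by rewrite (Cr_tau E) eqxx.
  by have := rhoS; nra.
have hN : mu (nad d (i + 1 + 1)) <= 1 / 25 by have := rhoS; nra.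
case: (cases3 j) => E.
- by rewrite E eqxx in jd.
- by rewrite E; apply: (le_trans (_ : mu (nad d (i + 1)) <= _)) => //; have := rhoS; nra.
by rewrite E.
Qed.

End Classify.

(** The classes are the good vertices sorted by their side in [T]. A pair across two classes without
    colour [T] is bad with at least 1/6 of all vertices, taken from the third core class, which both
    ends see almost fully. The sizes agree since two classes are nearly the two sides seen from a
    vertex of the third. *)
Theorem stability : exists T (G : 'Z_3 -> pred V),
  [/\ forall i x, G i x -> tau T x = i,
      mu (fun x => ~~ G (tau T x) x) <= rho,
      forall i, `|mu (G i) - 1 / 3| <= 2 * rho &
      forall i j x, i != j -> G i x ->
        mu (fun y => G j y && (kap x y != Some T)) <= rho].
Proof.
have [T [Cr [Ct Cb Ca]]] := exists_core.
have core := good_adj_core Ct Cb Ca.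
pose G i x := good x && (tau T x == i).
have Gt i x : G i x -> tau T x = i by move=> /andP[_ /eqP].
have e6 : 6 * eps <= rho by have := eps_small; have := rho_gt0; lra.
have cross i j x : i != j -> G i x ->
    mu (fun y => G j y && (kap x y != Some T)) <= 6 * eps.
  move=> ij /andP[gx /eqP tx].
  have [k ki kj] : exists2 k : 'Z_3, k != i & k != j.
    (* The three distinct residues sum to 0. *)
    exists (- (i + j)); move: ij; by elim/Z3_ind: (i); elim/Z3_ind: (j).
  have : mu (fun y => G j y && (kap x y != Some T)) * (1 / 6) <= bd x.
    rewrite -avgZr; apply: le_avg => y; case: (boolP (G j y && _)); last first.
      by rewrite mul0r => _; apply: avg_ge0 => ?; apply: ind_ge0.
    move=> /andP[/andP[gy /eqP ty] xy]; rewrite mul1r.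
    change (1 / 6 <= avg (fun z => (bad x y z)%:R)).
    have : mu (Cr k) <= avg (fun z => (bad x y z)%:R) +
       (mu (fun z => Cr k z && (kap x z != Some T)) + mu (fun z => Cr k z && (kap y z != Some T))).
      rewrite -!avgD; apply: le_avg => z.
      apply: le_trans (@le_ind2 _ _ (bad x y z) ((Cr k z && (kap x z != Some T)) ||
        (Cr k z && (kap y z != Some T))) _) _; last by rewrite lerD2l; apply: le_ind2.
      move=> ->; case: eqP => [xz|]; rewrite ?orbT //=; case: eqP => [yz|]; rewrite ?orbT //=.
      rewrite orbF badC2; apply: (@bad_apex T) => //; rewrite ?(kapC z)// tx ty//.
    have := core x k gx; rewrite tx => /(_ ki).
    have := core y k gy; rewrite ty => /(_ kj).
    by have := Cb k; have := rhoS; lra.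
  by move: gx => /andP[gx _]; lra.
exists T, G; split => //.
- apply: le_trans (_ : mu (fun x => ~~ good x) <= _).
    by apply: le_mu => x; rewrite /G eqxx andbT.
  by apply: le_trans notgood_small _; have := eps_gt0; lra.
- have sum1 : 1 - eps <= mu (G 0) + mu (G 1) + mu (G (1 + 1)) <= 1.
    rewrite -!mu_disjointU; last 2 first.
    + by move=> x /orP[] /Gt E; apply/negP => /Gt; rewrite E.
    + by move=> x /Gt E; apply/negP => /Gt; rewrite E.
    rewrite mu_le1 andbT lerBlDr -(@avg_cst R V 1 V_gt0).
    apply: le_trans (lerD (lexx _) notgood_small); rewrite -avgD; apply: le_avg => x.
    rewrite -[1]/(true%:R); apply: le_ind2 => _; rewrite /G.
    by case: (good x) => //=; elim/Z3_ind: (tau T x).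
  have close i : mu (G (i + 1)) - mu (G (i + 1 + 1)) <= 2 * rho /\
                 mu (G (i + 1 + 1)) - mu (G (i + 1)) <= 2 * rho.
    have [x Gx] : exists x, G i x.
      apply: (@mu_gt0 R); have : mu (Cr i) <= mu (G i) + mu (fun x => ~~ good x).
        by apply: le_mu2 => x /Ct; rewrite /G => ->; rewrite eqxx; case: good.
      by have := Cb i; have := notgood_small; have := eps_small; have := rhoS; lra.
    have /andP[gx /eqP tx] := Gx.
    have [h1 h2] := good_sides T gx; rewrite tx in h1 h2.
    have lo j : i != j -> mu (G j) <= mu (side T x j) + 6 * eps.
      move=> ij; apply: le_trans (lerD (lexx _) (cross _ _ _ ij Gx)).
      by apply: le_mu2 => y /[dup] Gy /Gt ty; rewrite /side ty eqxx Gy; case: eqP.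
    have hi j : mu (side T x j) <= mu (G j) + eps.
      apply: le_trans (lerD (lexx _) notgood_small).
      by apply: le_mu2 => y /andP[_ ty]; rewrite /G ty; case: good.
    have d1 : i != i + 1 by elim/Z3_ind: (i).
    have d2 : i != i + 1 + 1 by elim/Z3_ind: (i).
    have := lo _ d1; have := lo _ d2; have := hi (i + 1); have := hi (i + 1 + 1).
    by have := eps_small; have := rho_gt0; split; lra.
  have := close 0; have := close 1; have := close (1 + 1).
  rewrite (_ : 1 + 1 + 1 = 0 :> 'Z_3); last by apply/eqP.
  rewrite (_ : 0 + 1 = 1 :> 'Z_3); last by apply/eqP.
  move: sum1 => /andP[s1 s2] [c1 c2] [a1 a2] [b1 b2] i.
  have := eps_small; have := rho_gt0 => r0 e0.
  rewrite ler_norml; apply/andP; elim/Z3_ind: (i); split; lra.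
by move=> i j x ij Gx; apply: le_trans (cross _ _ _ ij Gx) _.
Qed.

End Colouring.

(** * Tight walks, consistency modulo 3, and labels of vertices *)

Lemma Z3_natE k : (k%:R == 0 :> 'Z_3) = (3 %| k)%N.
Proof. by rewrite -val_eqE /= val_Zp_nat. Qed.

Section Walks.
Variable V : finType.
Implicit Types h : V -> V -> V -> bool.

Definition sym3 h :=
  (forall x y z, h x y z = h y x z) /\ (forall x y z, h x y z = h y z x).
Definition irr3 h := forall x z, h x x z = false.

Inductive walk h : nat -> V -> V -> V -> V -> Prop :=
| walk0 x y : walk h 0 x y x y
| walkS k x y z a b : h x y z -> walk h k y z a b -> walk h k.+1 x y a b.

Lemma walk1 h x y z : h x y z -> walk h 1 x y y z.
Proof. by move=> hx; apply: walkS hx (walk0 _ _ _). Qed.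

Lemma walk0E h x y a b : walk h 0 x y a b -> a = x /\ b = y.
Proof. by move=> w; inversion w. Qed.

Lemma walkSE h k x y a b : walk h k.+1 x y a b -> exists2 z, h x y z & walk h k y z a b.
Proof. by move=> w; inversion w; subst; exists z. Qed.

Lemma walk_cat h i j x y a b c d :
  walk h i x y a b -> walk h j a b c d -> walk h (i + j) x y c d.
Proof. by move=> w; elim: w c d => // k u v z a' b' e _ IH c d /IH; apply: walkS. Qed.

Lemma walk_rcons h k x y a b c : walk h k x y a b -> h a b c -> walk h k.+1 x y b c.
Proof. by move=> w /walk1 w1; rewrite -addn1; apply: walk_cat w w1. Qed.

Lemma walk_split h i j x y a b : walk h (i + j) x y a b ->
  exists c d, walk h i x y c d /\ walk h j c d a b.
Proof.
elim: i x y => [|i IH] x y; first by move=> w; exists x, y; split => //; apply: walk0.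
rewrite addSn => /walkSE[z hz /IH[c [d [w1 w2]]]].
by exists c, d; split => //; apply: walkS w1.
Qed.

Lemma walk_last h k x y a b : walk h k.+1 x y a b -> exists2 w, walk h k x y w a & h w a b.
Proof.
rewrite -addn1 => /walk_split[c [d [w1 /walkSE[z hz /walk0E[-> ->]]]]].
by exists c.
Qed.

Lemma walk_sub h h' k x y a b : (forall x y z, h x y z -> h' x y z) ->
  walk h k x y a b -> walk h' k x y a b.
Proof. by move=> hh; elim => [*|{}k u v z c d /hh + _]; [apply: walk0 | apply: walkS]. Qed.

Section Sym.
Variable h : V -> V -> V -> bool.
Hypotheses (hs : sym3 h) (hi : irr3 h).

Lemma h_swap x y z : h x y z = h y x z. Proof. exact: hs.1. Qed.
Lemma h_rot x y z : h x y z = h y z x. Proof. exact: hs.2. Qed.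
Lemma h_rev x y z : h x y z = h z y x. Proof. by rewrite h_rot h_swap. Qed.
Lemma h_neq x y z : h x y z -> x != y.
Proof. by apply: contraTneq => ->; rewrite hi. Qed.

Lemma walk_rev k x y a b : walk h k x y a b -> walk h k b a y x.
Proof.
elim => [u v|{}k u v z c d huvz _ IH]; first exact: walk0.
by apply: walk_rcons IH _; rewrite -h_rev.
Qed.

(** A step from (u, v) to (v, z) is undone by rotating the same triple twice: (v, z), (z, u), (u,
    v). *)
Lemma walk_back k x y a b : walk h k x y a b -> walk h (2 * k) a b x y.
Proof.
elim => [u v|{}k u v z c d huvz _ IH]; first exact: walk0.
rewrite (_ : (2 * k.+1 = (2 * k).+2)%N); last by lia.
have e1 : h v z u by rewrite -h_rot.
by apply: walk_rcons (walk_rcons IH e1) _; rewrite -h_rot.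
Qed.

(** A walk of [k] steps from (x, y) to (z, x) is a closed walk of length [k + 1]: its last vertex is
    its first. Just [k] triples are required, the one wrapping around both ends being absent as in
    [C_l^-]. *)
Definition consist K := forall k x y z, (k <= K)%N -> x != y ->
  walk h k x y z x -> k%:R + 1 = 0 :> 'Z_3.

Definition closed_walk l := exists x y z, walk h l.-1 x y z x.

(** One turn around the first triple takes three steps and returns to the same pair; a walk without
    steps offers no triple to turn around. *)
Lemma walk_spin k x y a b t : walk h k.+1 x y a b -> walk h (k.+1 + 3 * t) x y a b.
Proof.
move=> w; elim: t => [|t IH]; first by rewrite muln0 addn0.
have [z hz _] := walkSE w.
rewrite (_ : (k.+1 + 3 * t.+1 = (k.+1 + 3 * t).+3)%N); last by lia.
have e1 : h y z x by rewrite -h_rot.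
have e2 : h z x y by rewrite -h_rot.
exact: walkS hz (walkS e1 (walkS e2 IH)).
Qed.

(** A bad closed walk of length [k + 1] congruent to [l] is padded by threes. For the other residue,
    traverse it backwards in [2 * k] steps and drop the first and the last step: the closed walk
    obtained has length 2 (k - 1) + 1, congruent to 2 (k + 1). *)
Lemma consist_of_no_closed_walk l K : ~~ (3 %| l)%N -> (2 * K + 4 <= l)%N ->
  ~ closed_walk l -> consist K.
Proof.
move=> l3 lK nc k x y z kK xy w.
have k2 : (2 <= k)%N.
  case: k w {kK} => [/walk0E[_ E]|[|//]]; first by rewrite E eqxx in xy.
  move=> /walkSE[u hu /walk0E[_ E]]; move: hu.
  by rewrite -E -h_rot hi.
apply/eqP; rewrite natr1 Z3_natE; apply/negPn/negP => k3.
have [E|E] : (k.+1 = l %[mod 3] \/ 2 * k.-1 + 1 = l %[mod 3])%N by lia.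
  case: nc; exists x, y, z.
  have [t ->] : exists t, l.-1 = (k.-1.+1 + 3 * t)%N by exists ((l - k.+1) %/ 3)%N; lia.
  by apply: walk_spin; rewrite prednK// ltnW.
have := walk_back w; rewrite (_ : (2 * k = ((2 * k.-1).-1.+1).+2)%N); last by lia.
move=> /walkSE[u hu w2]; case: nc.
have [q w3 _] := walk_last w2.
exists x, u, q.
have [t ->] : exists t, l.-1 = ((2 * k.-1).-1.+1 + 3 * t)%N.
  by exists ((l - (2 * k.-1 + 1)) %/ 3)%N; lia.
by apply: walk_spin.
Qed.

Section Consist.
Variable K : nat.
Hypothesis cK : consist K.

(** Dropping the last step leaves a closed walk of length [k]; for a repeated second vertex the
    first step is dropped instead. *)
Lemma consist_first k x y z : (k <= K)%N -> x != y -> walk h k x y x z -> k%:R = 0 :> 'Z_3.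
Proof.
case: k => [//|k] kK xy /walk_last[w wk _].
by rewrite -natr1; apply: cK wk => //; apply: ltnW.
Qed.

Lemma consist_second k x y z : (k <= K)%N -> walk h k x y z y -> k%:R = 0 :> 'Z_3.
Proof.
case: k => [//|k] kK /walkSE[w hw wk].
rewrite -natr1; apply: cK wk; first exact: ltnW.
by apply: (@h_neq _ _ x); rewrite -h_rot.
Qed.

(* Bounded tight reachability from the pair [(x0, y0)]; the label [i] records the
   number of steps modulo 3 and is attached to the first vertex of the pair. *)
Definition tight_reach x0 y0 r x y (i : 'Z_3) :=
  exists2 k, (k <= r)%N & walk h k x0 y0 x y /\ i = k%:R.

Variables x0 y0 : V.
Hypothesis xy0 : x0 != y0.
Local Notation reach := (tight_reach x0 y0).

Lemma reach_le r r' x y i : (r <= r')%N -> reach r x y i -> reach r' x y i.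
Proof. by move=> rr [k kr w]; exists k => //; apply: leq_trans rr. Qed.

Lemma reach_step r x y z i : reach r x y i -> h x y z -> reach r.+1 y z (i + 1).
Proof.
by move=> [k kr [w ->]] hz; exists k.+1 => //; split; [apply: walk_rcons w hz | rewrite natr1].
Qed.

Lemma reach_neq r x y i : reach r x y i -> x != y.
Proof.
move=> [[|k] _ [w _]]; first by have [-> ->] := walk0E w.
by have [u _] := walk_last w; rewrite h_rot => /h_neq.
Qed.

(** The way back to the base pair costs twice the length, and 2k = -k modulo 3, so residues
    subtract. *)
Lemma reach_link r r' x y i u v j : reach r x y i -> reach r' u v j ->
  exists2 k, (k <= 2 * r + r')%N & walk h k x y u v /\ k%:R = j - i.
Proof.
move=> [k kr [w ->]] [k' kr' [w' ->]]; exists (2 * k + k')%N; first by lia.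
split; first exact: walk_cat (walk_back w) w'.
have E : k%:R * 3 = 0 :> 'Z_3 by rewrite (_ : 3 = 0) ?mulr0//; apply/eqP.
rewrite natrD natrM; apply/eqP; rewrite -subr_eq0 opprB -[X in _ == X]E.
apply/eqP; ring.
Qed.

(** The second vertex of a pair carries the next residue, the one it has once the walk moves on and
    it becomes first. *)
Definition lab r x i := (exists y, reach r x y i) \/ (exists y j, reach r y x j /\ i = j + 1).

Lemma lab_le r r' x i : (r <= r')%N -> lab r x i -> lab r' x i.
Proof.
move=> rr [[y hy]|[y [j [hy E]]]]; first by left; exists y; apply: reach_le hy.
by right; exists y, j; split => //; apply: reach_le hy.
Qed.

Lemma lab_first r x y i : reach r x y i -> lab r x i.
Proof. by left; exists y. Qed.

Lemma lab_second r x y i : reach r x y i -> lab r y (i + 1).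
Proof. by right; exists x, i. Qed.

(** Two occurrences of [x] are linked through the base pair by a walk of at most [2 * r + r] steps,
    to which consistency applies. *)
Lemma lab_uniq r x i j : (3 * r <= K)%N -> lab r x i -> lab r x j -> i = j.
Proof.
move=> rK.
have aux y z i' j' : reach r x y i' -> reach r z x j' -> i' = j' + 1.
  move=> h1 h2; have [k kr [w E]] := reach_link h1 h2.
  have := cK (leq_trans kr _) (reach_neq h1) w; rewrite E => /(_ _) F.
  have {}F : j' - i' + 1 = 0 by apply: F; lia.
  by apply/eqP; rewrite eq_sym -subr_eq0; apply/eqP; rewrite -F; ring.
move=> [[y hy]|[y [i' [hy Ei]]]] [[z hz]|[z [j' [hz Ej]]]].
- have [k kr [w E]] := reach_link hy hz.
  have kK : (k <= K)%N by lia.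
  have := consist_first kK (reach_neq hy) w; rewrite E => /eqP.
  by rewrite subr_eq0 => /eqP.
- by rewrite Ej; apply: aux hy hz.
- by rewrite Ei; apply/esym; apply: aux hz hy.
have [k kr [w E]] := reach_link hy hz.
have kK : (k <= K)%N by lia.
have := consist_second kK w; rewrite E => /eqP.
by rewrite subr_eq0 Ei Ej => /eqP->.
Qed.

End Consist.
End Sym.
End Walks.

Lemma walk_map (V W : finType) (g : V -> W) (h : V -> V -> V -> bool)
    (h' : W -> W -> W -> bool) k x y a b :
  (forall x y z, h x y z -> h' (g x) (g y) (g z)) ->
  walk h k x y a b -> walk h' k (g x) (g y) (g a) (g b).
Proof. by move=> hh; elim => [*|{}k u v z c d /hh + _]; [apply: walk0 | apply: walkS]. Qed.

(** * Removal of pairs of small codegree *)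

Section Cleaning.
Variables (R : realFieldType) (V : finType).
Local Notation avg := (@avg R V).
Local Notation mu := (@mu R V).
Local Notation avg3 := (@avg3 R V).
Implicit Types h : V -> V -> V -> bool.

Lemma avg3_swap23 (F : V -> V -> V -> bool) : avg3 (fun x y z => F x z y) = avg3 F.
Proof. by apply: eq_avg => x; apply: avg_swap. Qed.

Lemma le_avg3 (F G : V -> V -> V -> bool) :
  (forall x y z, F x y z -> G x y z) -> avg3 F <= avg3 G.
Proof.
by move=> FG; do 3!apply: le_avg => ?; apply: le_ind; apply: FG.
Qed.

Lemma avg_pred1 (x : V) c : avg (fun u => (u == x)%:R * c) = c / #|V|%:R.
Proof.
rewrite /avg (bigD1 x)//= eqxx mul1r big1 ?addr0// => u /negbTE->.
by rewrite mul0r.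
Qed.

(* Edges meeting a deleted pair are discarded; a maximal family of deleted pairs with
   bounded loss leaves no pair of small positive codegree. *)
Lemma cleaning h delta : sym3 h -> irr3 h -> 0 < delta -> (0 < #|V|)%N ->
  exists h', [/\ sym3 h', irr3 h', forall x y z, h' x y z -> h x y z,
    forall x y z, h' x y z -> delta <= mu (h' x y) &
    avg3 h - 6 * delta <= avg3 h'].
Proof.
move=> hs hi d0 V0; have n0 : 0 < #|V|%:R :> R by rewrite ltr0n.
pose p (b : {set V * V}) x y := ((x, y) \in b) || ((y, x) \in b).
pose hb b x y z := [&& h x y z, ~~ p b x y, ~~ p b y z & ~~ p b x z].
have pC b x y : p b x y = p b y x by rewrite /p orbC.
have sb b : sym3 (hb b).
  split=> x y z; rewrite /hb.
    by rewrite (h_swap hs) (pC b x y); congr (_ && (_ && _)); rewrite andbC.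
  rewrite (h_rot hs) (pC b z x) (pC b y x); congr (_ && _).
  by case: (p b x y); case: (p b y z); case: (p b x z).
(* Each deleted ordered pair may cost 6 delta / n^2, and there are at most n^2 of them. *)
pose Q b := avg3 h <= avg3 (hb b) + 6 * delta * (#|b|%:R / #|V|%:R ^+ 2).
have Q0 : Q finset.set0.
  rewrite /Q cards0 mul0r mulr0 addr0; apply: le_avg3 => x y z hx.
  by rewrite /hb hx /p !inE.
have [b Qb bmax] := arg_maxnP (fun b : {set V * V} => #|b|) Q0.
exists (hb b); split => //.
- by move=> x z; rewrite /hb hi.
- by move=> x y z /andP[].
- move=> x y z hxyz; rewrite leNgt; apply/negP => lt.
  have pxy : ~~ p b x y by case/and4P: hxyz.
  pose b' := (x, y) |: b.
  have cb' : #|b'| = #|b|.+1 by rewrite cardsU1; case/norP: pxy => ->.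
  suff Qb' : Q b' by have := bmax _ Qb'; rewrite cb' /= ltnn.
  pose F u v w := [&& u == x, v == y & hb b u v w].
  have FE : avg3 F = mu (hb b x y) / #|V|%:R ^+ 2.
    rewrite /avg3 (eq_avg (g := fun u => (u == x)%:R * (mu (hb b x y) / #|V|%:R))).
      by rewrite avg_pred1 expr2 invfM mulrA.
    move=> u; rewrite -(avg_pred1 y) -avgZ; apply: eq_avg => v; rewrite -!avgZ; apply: eq_avg => w.
    by rewrite /F; case: eqP => [->|_]; case: eqP => [->|_]; rewrite /= ?mul1r ?mul0r.
  (* A triple lost by deleting (x, y) contains both vertices in one of six orders, whence the factor
     6. *)
  have C1 : avg3 (fun u v w => F v u w) = avg3 F by exact: avg3C.
  have C2 : avg3 (fun u v w => F w u v) = avg3 F by exact: avg3C2.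
  have C3 : avg3 (fun u v w => F u w v) = avg3 F by exact: avg3_swap23.
  have C4 : avg3 (fun u v w => F w v u) = avg3 F.
    by rewrite (avg3C2 R (fun u v w => F u w v)).
  have C5 : avg3 (fun u v w => F v w u) = avg3 F.
    by rewrite (avg3C R (fun u v w => F u w v)).
  have : avg3 (hb b) <= avg3 (hb b') + (avg3 F + avg3 (fun u v w => F v u w)
      + avg3 (fun u v w => F w u v) + avg3 (fun u v w => F u w v)
      + avg3 (fun u v w => F w v u) + avg3 (fun u v w => F v w u)).
    rewrite /avg3 -!avgD; apply: le_avg => u; rewrite -!avgD; apply: le_avg => v.
    rewrite -!avgD; apply: le_avg => w.
    case hB: (hb b u v w); last by rewrite !addr_ge0// ind_ge0.
    case hB': (hb b' u v w); first by rewrite lerDl !addr_ge0// ind_ge0.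
    rewrite add0r.
    have : [|| F u v w, F v u w, F w u v, F u w v, F w v u | F v w u].
      move/negP: hB'; rewrite /hb.
      have /and4P[-> p1 p2 p3] := hB; rewrite /=.
      have pp s t : ~~ p b s t -> p b' s t -> ((s == x) && (t == y)) || ((t == x) && (s == y)).
        rewrite /p /b' !in_setU1 !xpair_eqE => /norP[/negbTE-> /negbTE->].
        by rewrite !orbF.
      have S1 : hb b v u w by rewrite -(h_swap (sb b)).
      have S2 : hb b w u v by rewrite (h_rot (sb b)).
      have S3 : hb b u w v by rewrite (h_swap (sb b)).
      have S4 : hb b w v u by rewrite (h_swap (sb b)) (h_rot (sb b)) (h_rot (sb b)).
      have S5 : hb b v w u by rewrite (h_swap (sb b)).
      rewrite /F hB S1 S2 S3 S4 S5 !andbT => np.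
      case: (boolP (p b' u v)) => [/(pp _ _ p1)/orP[]->|q1]; rewrite ?orbT//.
      case: (boolP (p b' v w)) => [/(pp _ _ p2)/orP[]->|q2]; rewrite ?orbT//.
      case: (boolP (p b' u w)) => [/(pp _ _ p3)/orP[]->|q3]; rewrite ?orbT//.
      by case: np; rewrite q1 q2 q3.
    move=> H.
    have nn (c : bool) : 0 <= c%:R :> R by apply: ler0n.
    move: (nn (F u v w)) (nn (F v u w)) (nn (F w u v)) (nn (F u w v)) (nn (F w v u)) (nn (F v w u)).
    by case/or4P: H => [->|->|->|/or3P[]->] *; rewrite mulr1n; lra.
  have l2 : mu (hb b x y) / #|V|%:R ^+ 2 <= delta / #|V|%:R ^+ 2.
    by rewrite ler_wpM2r ?invr_ge0 ?exprn_ge0 ?ltW.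
  rewrite C1 C2 C3 C4 C5 FE => l1.
  by move: Qb l1 l2; rewrite /Q cb' -natr1 mulrDl mul1r; set N := _ ^-1; set A := avg3 _; nra.
have : #|b|%:R / #|V|%:R ^+ 2 <= 1 :> R.
  rewrite ler_pdivrMr ?exprn_gt0// mul1r -natrX ler_nat.
  by apply: leq_trans (max_card _) _; rewrite card_prod expnS expn1.
by move: Qb; rewrite /Q; set A := avg3 _; set B := _ / _; nra.
Qed.

End Cleaning.

(** * Bounded diameter of tight components *)

Section Diameter.
Variables (R : realFieldType) (V : finType).
Local Notation avg := (@avg R V).
Local Notation mu := (@mu R V).
Variables (h : V -> V -> V -> bool) (dl : R).
Hypotheses (hs : sym3 h) (dl_gt0 : 0 < dl).
Hypothesis codeg : forall x y z, h x y z -> dl <= mu (h x y).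

Definition in_ball x y r a b := `[<exists2 k, (k <= r)%N & walk h k x y a b>].
Definition ball_size x y r : R := avg (fun a => avg (fun b => (in_ball x y r a b)%:R)).

Lemma fwd_size a b c : h a b c ->
  dl ^+ 2 <= avg (fun c => avg (fun d => (h a b c && h b c d)%:R)).
Proof.
move=> habc; apply: le_trans (_ : dl * mu (h a b) <= _).
  by rewrite expr2 ler_pM2l//; apply: codeg habc.
rewrite -avgZ; apply: le_avg => u; case E: (h a b u); rewrite ?mulr0 ?mulr1.
  by apply: le_trans (codeg (x := b) (y := u) (z := a) _) _; rewrite // -(h_rot hs).
by apply: avg_ge0 => ?; apply: ind_ge0.
Qed.

(** Take a pair at distance exactly 7 (m + 1) on a shortest walk. Its two-step forward set has
    density at least [dl ^+ 2] and misses the ball of radius 7m + 2: two steps are undone in four,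
    and 7m + 2 + 4 < 7 (m + 1). A distance above [7 * D] would make the ball outgrow density 1. *)
Lemma diameter x y z (D : nat) a b k : h x y z -> 1 < D%:R * dl ^+ 2 ->
  walk h k x y a b -> exists2 k', (k' <= 7 * D)%N & walk h k' x y a b.
Proof.
move=> hxyz D1 w; apply: contrapT => far0.
have shadow k' c d : walk h k' x y c d -> exists e, h c d e.
  case: k' => [/walk0E[-> ->]|k' /walk_last[e _ he]]; first by exists z.
  by exists e; rewrite -(h_rot hs).
have far m : (m <= D)%N -> (m.+1)%:R * dl ^+ 2 <= ball_size x y (7 * m + 2).
  elim: m => [_|m IH mD].
    rewrite mul1r; apply: le_trans (fwd_size hxyz) _.
    apply: le_avg => c; apply: le_avg => d; apply: le_ind => /andP[h1 h2].
    by apply/asboolP; exists 2 => //; apply: walk_rcons h2; apply: walk1.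
  have [c [d [w1 min1]]] : exists c d, walk h (7 * m.+1) x y c d /\
      forall k', walk h k' x y c d -> (7 * m.+1 <= k')%N.
    have ex : exists k, `[<walk h k x y a b>] by exists k; apply/asboolP.
    case: (ex_minnP ex) => k0 /asboolP wk0 mink0.
    have k0D : (7 * D < k0)%N.
      by rewrite ltnNge; apply/negP => le; apply: far0; exists k0.
    have E : k0 = (7 * m.+1 + (k0 - 7 * m.+1))%N by lia.
    rewrite E in wk0; have [c [d [w1 w2]]] := walk_split wk0.
    exists c, d; split => // k' w'.
    have := mink0 _ (introT (asboolP _) (walk_cat w' w2)); lia.
  have [e hcde] := shadow _ _ _ w1.
  rewrite -natr1 mulrDl mul1r; apply: le_trans (lerD (IH (ltnW mD)) (fwd_size hcde)) _.
  rewrite /ball_size -avgD; apply: le_avg => u; rewrite -avgD; apply: le_avg => v.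
  case: (boolP (in_ball x y (7 * m + 2) u v)) => [/asboolP[k1 k1m w2]|_]; last first.
    rewrite add0r; apply: le_ind => /andP[h1 h2]; apply/asboolP; exists (7 * m.+1).+2; first lia.
    exact: walk_rcons (walk_rcons w1 h1) h2.
  have -> : in_ball x y (7 * m.+1 + 2) u v by apply/asboolP; exists k1 => //; lia.
  case: (boolP (h c d u && _)) => [/andP[h1 h2]|_]; last by rewrite addr0.
  have w3 := walk_back hs (walk_rcons (walk1 h1) h2).
  have := min1 _ (walk_cat w2 w3); lia.
have := far D (leqnn _); rewrite -natr1 mulrDl mul1r.
have : ball_size x y (7 * D + 2) <= 1 by do 2!apply: avg_le_cst => // ?; apply: ind_le1.
have : 0 < dl ^+ 2 by rewrite exprn_gt0.
lra.
Qed.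

End Diameter.

(** * Tight components as tripartite colours *)

Section Components.
Variables (R : realFieldType) (V : finType).
Variables (h : V -> V -> V -> bool) (dl : R) (D K : nat).
Hypotheses (hs : sym3 h) (hi : irr3 h) (dl_gt0 : 0 < dl).
Hypothesis codeg : forall x y z, h x y z -> dl <= mu R (h x y).
Hypothesis D1 : 1 < D%:R * dl ^+ 2.
Hypothesis DK : (3 * (7 * D).+1 <= K)%N.
Hypothesis cK : consist h K.

Definition conn x y a b := exists k, walk h k x y a b.
Definition comp x y : {set V * V} := [set q : V * V | `[<conn x y q.1 q.2>]].
(** Uniting the components of the two orientations makes the colour of a pair independent of its
    order. *)
Definition kap x y : option {set V * V} :=
  if [exists z, h x y z] then Some (comp x y :|: comp y x) else None.

Lemma conn_sym x y a b : conn x y a b -> conn a b x y.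
Proof. by move=> [k /(walk_back hs) w]; exists (2 * k)%N. Qed.

Lemma conn_trans x y a b c d : conn x y a b -> conn a b c d -> conn x y c d.
Proof. by move=> [k w] [k' w']; exists (k + k')%N; apply: walk_cat w w'. Qed.

Lemma conn_edge x y z : h x y z -> conn x y y z.
Proof. by move=> /walk1; exists 1%N. Qed.

Lemma comp_conn x y a b : conn x y a b -> comp x y = comp a b.
Proof.
move=> c; apply/setP => q; rewrite !inE; apply/asboolP/asboolP.
  exact: conn_trans (conn_sym c).
exact: conn_trans c.
Qed.

Lemma kapC x y : kap x y = kap y x.
Proof.
rewrite /kap finset.setUC; congr (if _ then _ else _).
by apply/existsP/existsP => -[z]; rewrite (h_swap hs); exists z.
Qed.

Lemma kap_edge x y z : h x y z -> kap x y = Some (comp x y :|: comp y x).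
Proof. by move=> hz; rewrite /kap; case: existsP => // -[]; exists z. Qed.

Lemma kap_rot x y z : h x y z -> kap x y = kap y z.
Proof.
move=> hz; have hz' : h y z x by rewrite -(h_rot hs).
rewrite (kap_edge hz) (kap_edge hz') (comp_conn (conn_edge hz)).
have hz2 : h z y x by rewrite -(h_rev hs).
by rewrite (comp_conn (conn_edge hz2)).
Qed.

Lemma mono_edge x y z : h x y z -> mono kap x y z.
Proof.
move=> hz; have hz' : h y z x by rewrite -(h_rot hs).
have e1 := kap_rot hz; have e2 := kap_rot hz'.
rewrite /mono /corner /eqc (kapC x z) -e2 -e1 eqxx (kap_edge hz) //=.
Qed.

Lemma kap_conn x y a b j : kap x y = Some j -> kap a b = Some j ->
  conn x y a b \/ conn y x a b.
Proof.
rewrite /kap; case: existsP => // _ [<-]; case: existsP => // _ [] /setP/(_ (a, b)).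
rewrite !inE /= => E; have : `[<conn a b a b>] || `[<conn b a a b>].
  by apply/orP; left; apply/asboolP; exists 0%N; apply: walk0.
by rewrite E => /orP[]/asboolP; [left | right].
Qed.

(** A vertex is labelled by the residue of any walk to it from a base pair of the colour: the
    diameter bound makes these walks short, and consistency makes the residue unique. The
    alternatives record which orientation of the pair is reached. *)
Lemma exists_label j : exists f : V -> 'Z_3, (forall x y, kap x y <> Some j) \/
  exists x0 y0, x0 != y0 /\ forall x y, kap x y = Some j ->
    (tight_reach h x0 y0 (7 * D) x y (f x) /\ f y = f x + 1) \/
    (tight_reach h x0 y0 (7 * D) y x (f y) /\ f x = f y + 1).
Proof.
case: (pselect (exists x0 y0, kap x0 y0 = Some j)) => [[x0 [y0 k0]]|no]; last first.
  by exists (fun=> 0); left => x y e; apply: no; exists x, y.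
have [z0 hz0] : exists z, h x0 y0 z by apply/existsP; move: k0; rewrite /kap; case: ifP.
have xy0 := h_neq hi hz0.
have /choice[f fP] (v : V) : exists i, forall i', lab h x0 y0 (7 * D).+1 v i' -> i' = i.
  case: (pselect (exists i, lab h x0 y0 (7 * D).+1 v i)) => [[i li]|no].
    by exists i => i' li'; apply: (lab_uniq hs hi cK xy0 DK li' li).
  by exists 0 => i' li'; case: no; exists i'.
exists f; right; exists x0, y0; split => // x y kxy.
have main u v : conn x0 y0 u v ->
    tight_reach h x0 y0 (7 * D) u v (f u) /\ f v = f u + 1.
  move=> [k w]; have [k' kD w'] := diameter hs dl_gt0 codeg hz0 D1 w.
  have rr : tight_reach h x0 y0 (7 * D) u v k'%:R by exists k'.
  have fu := fP u _ (lab_le (leqnSn _) (lab_first rr)).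
  have fv := fP v _ (lab_le (leqnSn _) (lab_second rr)).
  by rewrite -fv -fu.
case: (kap_conn k0 kxy) => c; [left|right]; apply: main => //.
by case: c => k /(walk_rev hs) w; apply: conn_sym; exists k.
Qed.

End Components.

(** * Approximate structure at density 1/4 *)

Lemma consist_sub (V : finType) (h h' : V -> V -> V -> bool) K :
  (forall x y z, h' x y z -> h x y z) -> consist h K -> consist h' K.
Proof. by move=> hh c k x y z kK xy /(walk_sub hh); apply: c. Qed.

(** Cleaning at codegree rho^4 / 36 costs rho^4 / 6, which is the deficit [eta] with 6 eta =
    (rho^2)^2. Reachability in the conclusion refers to [h], not to the cleaned relation, so that it
    can be extended along every triple of [h]. *)
Theorem structure (R : realFieldType) (rho : R) (D K : nat) (V : finType)
    (h : V -> V -> V -> bool) :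
  0 < rho -> rho <= (1 / 100) ^+ 2 ->
  1 < D%:R * (rho ^+ 4 / 36) ^+ 2 -> (3 * (7 * D).+1 <= K)%N ->
  sym3 h -> irr3 h -> consist h K -> (0 < #|V|)%N -> 1 / 4 <= avg3 R h ->
  exists x0 y0 (G : 'Z_3 -> pred V),
  [/\ x0 != y0,
      (forall i j x, G i x -> G j x -> i = j) /\ mu R (fun x => ~~ [exists i, G i x]) <= rho,
      forall i, `|mu R (G i) - 1 / 3| <= 2 * rho &
      forall i x, G i x ->
        mu R (fun y => G (i + 1) y && ~~ `[<tight_reach h x0 y0 (7 * D) x y i>]) <= rho /\
        mu R (fun y => G (i + 1 + 1) y &&
              ~~ `[<tight_reach h x0 y0 (7 * D) y x (i + 1 + 1)>]) <= rho].
Proof.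
move=> r0 r1 D1 DK hs hi cK V0 h4.
have dl0 : 0 < rho ^+ 4 / 36 by rewrite divr_gt0 ?exprn_gt0.
have [h' [hs' hi' sub codeg h'4]] := cleaning hs hi dl0 V0.
have cK' := consist_sub sub cK.
have /choice[tau tauP] := exists_label hs' hi' dl0 codeg D1 DK cK'.
have neq j x y : kap h' x y = Some j -> tau j x != tau j y.
  move=> kxy; case: (tauP j) => [/(_ _ _ kxy)//|[x0 [y0 [_ /(_ _ _ kxy)]]]].
  by case=> -[_ ->]; [|rewrite eq_sym]; elim/Z3_ind: (tau j _).
have eta1 : 6 * (rho ^+ 4 / 6) <= (rho ^+ 2) ^+ 2.
  by rewrite -exprM; lra.
have mono4 : 1 / 4 - rho ^+ 4 / 6 <= avg3 R (mono (kap h')).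
  apply: le_trans (_ : avg3 R h' <= _); first by lra.
  by apply: le_avg3 => x y z; apply: mono_edge.
have [T [G [Gt cov sz adj]]] := stability (kapC hs') neq r0 r1 eta1 mono4 V0.
have Gbig i : 0 < mu R (G i).
  by have := sz i; rewrite ler_norml => /andP[]; move: r1; rewrite expr2; lra.
have [x0 [y0 [xy0 reachP]]] : exists x0 y0, x0 != y0 /\ forall x y, kap h' x y = Some T ->
    (tight_reach h' x0 y0 (7 * D) x y (tau T x) /\ tau T y = tau T x + 1) \/
    (tight_reach h' x0 y0 (7 * D) y x (tau T y) /\ tau T x = tau T y + 1).
  case: (tauP T) => // no; exfalso.
  have [x Gx] := mu_gt0 (Gbig 0).
  have := adj 0 1 x isT Gx; rewrite (_ : mu _ _ = mu R (G 1)).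
    have := sz 1; rewrite ler_norml => /andP[]; move: r1; rewrite expr2; lra.
  by apply: eq_mu => y; case: eqP => [/no//|]; rewrite andbT.
have reach_sub r x y i : tight_reach h' x0 y0 r x y i -> tight_reach h x0 y0 r x y i.
  by move=> [k kr [w E]]; exists k => //; split => //; apply: walk_sub w.
exists x0, y0, G; split => //.
- split; first by move=> i j x /Gt <- /Gt <-.
  apply: le_trans cov; apply: le_mu => x; apply: contra => Gx; apply/existsP; by exists (tau T x).
move=> i x Gx; split.
  apply: le_trans (adj i (i + 1) x _ Gx); last by elim/Z3_ind: (i).
  apply: le_mu => y /andP[Gy]; rewrite Gy /=; apply: contraNN => /eqP kxy; apply/asboolP.
  case: (reachP _ _ kxy) => -[rr E]; rewrite (Gt _ _ Gx) (Gt _ _ Gy) in rr E; first exact: reach_sub.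
  by exfalso; move: E => /eqP; elim/Z3_ind: (i).
apply: le_trans (adj i (i + 1 + 1) x _ Gx); last by elim/Z3_ind: (i).
apply: le_mu => y /andP[Gy]; rewrite Gy /=; apply: contraNN => /eqP kxy; apply/asboolP.
case: (reachP _ _ kxy) => -[rr E]; rewrite (Gt _ _ Gx) (Gt _ _ Gy) in rr E; last exact: reach_sub.
by exfalso; move: E => /eqP; elim/Z3_ind: (i).
Qed.

(** * Links of vertices under a minimum degree condition *)

Lemma sumZ3 (R : nmodType) (F : 'Z_3 -> R) i :
  \sum_j F j = F i + F (i + 1) + F (i + 1 + 1).
Proof.
rewrite 3!big_ord_recl big_ord0 addr0 addrA.
have -> : ord0 = 0 :> 'Z_3 by apply/eqP.
have -> : lift ord0 ord0 = 1 :> 'Z_3 by apply/eqP.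
have -> : lift ord0 (lift ord0 ord0) = 1 + 1 :> 'Z_3 by apply/eqP.
elim/Z3_ind: i; rewrite ?add0r.
- by [].
- rewrite (_ : 1 + 1 + 1 = 0); last by apply/eqP.
  by rewrite -addrA addrC.
- rewrite (_ : 1 + 1 + 1 = 0); last by apply/eqP.
  by rewrite add0r -[RHS]addrA [LHS]addrC.
Qed.

Lemma Z3_cases (i k : 'Z_3) : [\/ k = i, k = i + 1 | i = k + 1].
Proof.
case: (eqVneq k i) => [->|h1]; first by apply: Or31.
case: (eqVneq k (i + 1)) => [->|h2]; first by apply: Or32.
by apply: Or33; apply/eqP; move: h1 h2; elim/Z3_ind: (i); elim/Z3_ind: (k).
Qed.

Lemma Z3_add3 (i : 'Z_3) : i + 1 + 1 + 1 = i.
Proof. by apply/eqP; elim/Z3_ind: i. Qed.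

(** The neighbourhood of a vertex [x] of maximal degree is independent, so every edge meets its
    complement [Q]; this leaves at most 2 mu(Q) deg(x), where the two factors sum to [mu R W]. *)
Lemma mantel (R : realFieldType) (V : finType) (W : pred V) (g : rel V) :
  symmetric g -> (forall x y z, W x -> W y -> W z -> g x y -> g x z -> ~~ g y z) ->
  avg (fun x => avg (fun y => [&& W x, W y & g x y]%:R)) <= mu R W ^+ 2 / 2.
Proof.
move=> gC tf.
case: (pickP W) => [x0 Wx0|W0]; last first.
  rewrite (@eq_avg _ _ _ (fun=> 0)); last first.
    move=> x; rewrite (@eq_avg _ _ _ (fun=> 0)) => [|y]; last by rewrite W0.
    by rewrite /avg big1// mul0r.
  by rewrite /avg big1// mul0r divr_ge0// sqr_ge0.
pose dg x := mu R (fun y => W y && g x y).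
have [x Wx xmax] := arg_maxP dg Wx0.
pose Q u := W u && ~~ g x u.
have : avg (fun x => avg (fun y => [&& W x, W y & g x y]%:R)) <=
    mu R Q * dg x + mu R Q * dg x.
  have E : avg (fun u => avg (fun v => [&& Q u, W v & g u v]%:R)) <= mu R Q * dg x.
    rewrite -avgZr; apply: le_avg => u; case: (boolP (Q u)) => [/andP[Wu _]|_] /=.
      by rewrite mul1r; apply: xmax.
    by rewrite mul0r; apply: avg_le_cst.
  apply: le_trans (lerD E E); rewrite [X in _ <= _ + X]avg_swap -avgD; apply: le_avg => u.
  rewrite -avgD; apply: le_avg => v; apply: le_ind2 => /and3P[Wu Wv guv].
  have gvu : g v u by rewrite gC.
  rewrite /Q Wu Wv guv gvu /=; case: (boolP (g x u)) => //= xu.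
  by case: (boolP (g x v)) => //= xv; have := tf x u v Wx Wu Wv xu xv; rewrite guv.
have : mu R W = dg x + mu R Q.
  rewrite -mu_disjointU; last by move=> y; rewrite /Q => /andP[-> ->].
  by apply: eq_mu => y; rewrite /Q; case: (W y); case: (g x y).
move=> ->; have := sqr_ge0 (dg x - mu R Q); rewrite !expr2; lra.
Qed.

Lemma h_perms (V : finType) (h : V -> V -> V -> bool) x y z : sym3 h -> h x y z ->
  [/\ h x z y, h y x z, h y z x, h z x y & h z y x].
Proof.
move=> hs hz; have h1 : h y z x by rewrite -(h_rot hs).
have h2 : h z x y by rewrite -(h_rot hs).
by split => //; [rewrite (h_rev hs) | rewrite -(h_swap hs) | rewrite (h_rev hs)].
Qed.

(** Here [a] and [b] measure the parts of two classes lacking the expected pair with a given vertex.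
    With s = a + b the link density is at most 5/2 g^2 - 2 g s + 3/4 s^2 up to a small error; this
    is convex in s and falls below 1/4 for all s between 1/20 and 2 g. *)
Lemma link_arith (R : realFieldType) (rho m0 m1 m2 A0 A1 A2 B a b D : R) :
  rho <= 1 / 10000 -> 0 <= a -> 0 <= b -> 0 <= m0 ->
  m0 <= 1 / 3 + 2 * rho -> m1 <= 1 / 3 + 2 * rho -> m2 <= 1 / 3 + 2 * rho ->
  B <= (m1 - a) * (m2 - b) -> A0 <= m0 ^+ 2 / 2 -> A1 <= a ^+ 2 / 2 -> A2 <= b ^+ 2 / 2 ->
  0 <= m1 - a -> 0 <= m2 - b -> 1 / 4 <= D ->
  D <= A0 + A1 + A2 + B * 2 + 8 * rho -> a + b <= 1 / 20.
Proof.
move=> rhoS a0 b0 gg0 g0 g1 g2 hB hA0 hA1 hA2 X0 Y0 D2 D1.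
(* A rational slightly above 1/3 + 2/10000. *)
have [g g1250 gE] : exists2 g : R, g = 417 / 1250 & 1 / 3 + 2 * rho <= g.
  by exists (417 / 1250) => //; lra.
have m0g : m0 <= g by exact: le_trans g0 gE.
have m1g : m1 <= g by exact: le_trans g1 gE.
have m2g : m2 <= g by exact: le_trans g2 gE.
have hB' : B <= (g - a) * (g - b).
  by apply: le_trans hB _; apply: ler_pM => //; rewrite lerD2r.
have hA0' : A0 <= g ^+ 2 / 2.
  by apply: le_trans hA0 _; rewrite ler_pM2r ?invr_gt0// ler_sqr ?nnegrE// (le_trans gg0).
have ag : a <= g by rewrite (le_trans _ m1g)// -subr_ge0.
have bg : b <= g by rewrite (le_trans _ m2g)// -subr_ge0.
have r8 : 8 * rho <= 1 / 1250 by lra.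
clear hB hA0 X0 Y0 g0 g1 g2 gE m0g m1g m2g gg0 rhoS.
have key : 1 / 4 <= g ^+ 2 / 2 + a ^+ 2 / 2 + b ^+ 2 / 2 + ((g - a) * (g - b)) * 2 + 1 / 1250.
  apply: le_trans D2 _; apply: le_trans D1 _; apply: lerD => //.
  have hB2 : B * 2 <= (g - a) * (g - b) * 2 by rewrite ler_pM2r.
  exact: lerD (lerD (lerD hA0' hA1) hA2) hB2.
rewrite leNgt; apply/negP => lt.
(* With s = a + b, [q1] replaces a b by s^2 / 4 and [q2] encodes (s - 1/20)(2 g - s) >= 0; the rest
   is linear. *)
have q1 : 0 <= (a - b) * (a - b) by rewrite -expr2 sqr_ge0.
have q2 : 0 <= (a + b - 1 / 20) * ((g - a) + (g - b)).
  by apply: mulr_ge0; [rewrite subr_ge0 ltW | rewrite addr_ge0 ?subr_ge0].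
clear hB' hA0' hA1 hA2 D1 D2 r8 a0 b0 ag bg.
rewrite !expr2 in key; rewrite g1250 in key q2.
lra.
Qed.

Section Exact.
Variables (R : realFieldType) (V : finType) (h : V -> V -> V -> bool) (K r : nat).
Variables (rho : R) (x0 y0 : V) (G : 'Z_3 -> pred V).
Hypotheses (hs : sym3 h) (hi : irr3 h) (cK : consist h K) (xy0 : x0 != y0).
Hypothesis rK : (3 * (r + 10) <= K)%N.
Hypotheses (rho_gt0 : 0 < rho) (rhoS : rho <= 1 / 10000) (V_gt0 : (0 < #|V|)%N).
Hypothesis Gdisj : forall i j x, G i x -> G j x -> i = j.
Local Notation avg := (@avg R V).
Local Notation mu := (@mu R V).
Local Notation avg3 := (@avg3 R V).
Definition rc s x y i := `[<tight_reach h x0 y0 s x y i>].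
Definition unc x := ~~ [exists i, G i x].
Hypothesis Gcov : mu unc <= rho.
Hypothesis Gsize : forall i, `|mu (G i) - 1 / 3| <= 2 * rho.
Hypothesis Gup : forall i x, G i x ->
  mu (fun y => G (i + 1) y && ~~ rc r x y i) <= rho.
Hypothesis deg : forall d, 1 / 4 <= avg (fun x => avg (fun y => (h d x y)%:R)).

Local Notation lab := (lab h x0 y0).

Let lab_uq s x i j : (s <= r + 10)%N -> lab s x i -> lab s x j -> i = j.
Proof. by move=> sr; apply: (lab_uniq hs hi cK xy0); lia. Qed.

Let gsz i : 1 / 3 - 2 * rho <= mu (G i) <= 1 / 3 + 2 * rho.
Proof. by have := Gsize i; rewrite ler_norml => /andP[a b]; apply/andP; split; lra. Qed.

Lemma Glab i x : G i x -> lab r x i.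
Proof.
move=> Gx; have [y] : exists y, G (i + 1) y && rc r x y i.
  apply: (@mu_gt0 R).
  have : mu (G (i + 1)) <= mu (fun y => G (i + 1) y && rc r x y i) +
                        mu (fun y => G (i + 1) y && ~~ rc r x y i).
    by apply: le_mu2 => y ->; case: rc.
  have /andP[+ _] := gsz (i + 1); have := Gup Gx; have := rhoS; lra.
by move=> /andP[_ /asboolP/lab_first].
Qed.

(** The triples d x y, d x z, d y z carry the closed walk y, x, d, z of length 4. *)
Let link_tf d x y z : h d x y -> h d x z -> ~~ h d y z.
Proof.
move=> dxy dxz; apply/negP => dyz.
have [_ _ _ _ yxd] := h_perms hs dxy; have [_ xdz _ _ _] := h_perms hs dxz.
have [dzy _ _ _ _] := h_perms hs dyz.
have K3 : (3 <= K)%N by apply: leq_trans rK; rewrite leq_pmulr// addnC.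
have w : walk h 3 y x z y by exact: walkS yxd (walkS xdz (walk1 dzy)).
have /eqP := @cK 3%N y x z K3 (h_neq hi yxd) w.
by rewrite natr1 Z3_natE.
Qed.

Let Apart d i := avg (fun x => avg (fun y => [&& G i x, G i y & h d x y]%:R)).
Let Bpart d i := avg (fun x => avg (fun y => [&& G i x, G (i + 1) y, rc r x y i & h d x y]%:R)).

(** Pairs across classes occur in both orders, hence the factor 2. The error is [3 * rho] in each
    order for unreached pairs and [2 * rho] for pairs with an unclassified vertex. *)
Let link_bound d :
  avg (fun x => avg (fun y => (h d x y)%:R)) <=
  \sum_i Apart d i + (\sum_i Bpart d i) * 2 + 8 * rho.
Proof.
pose b i x y := [&& G i x, G (i + 1) y, rc r x y i & h d x y].
pose c i x y := [&& G i x, G (i + 1) y & ~~ rc r x y i].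
pose Cpart i := avg (fun x => avg (fun y => (c i x y)%:R)).
have hC i : Cpart i <= rho.
  apply: avg_le_cst => [|x]; first exact: ltW.
  rewrite /c; case: (boolP (G i x)) => [/Gup//|_] /=.
  by apply: avg_le_cst => [|?]; apply: ltW.
have : avg (fun x => avg (fun y => (h d x y)%:R)) <= \sum_i Apart d i
   + (\sum_i Bpart d i + \sum_i Cpart i) + (\sum_i Bpart d i + \sum_i Cpart i)
   + (mu unc + mu unc).
  have -> : \sum_i Apart d i = avg (fun x => avg (fun y => \sum_i [&& G i x, G i y & h d x y]%:R)).
    by rewrite -avg_sum; apply: eq_avg => x; rewrite avg_sum.
  have EBC : \sum_i Bpart d i + \sum_i Cpart i =
     avg (fun x => avg (fun y => \sum_i ((b i x y)%:R + (c i x y)%:R))).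
    rewrite -big_split /= (eq_bigr (fun i => avg (fun x => avg (fun y => (b i x y)%:R + (c i x y)%:R)))).
      by rewrite -avg_sum; apply: eq_avg => x; rewrite avg_sum.
    by move=> i _; rewrite -avgD; apply: eq_avg => x; rewrite avgD.
  have EU : mu unc + mu unc = avg (fun x => avg (fun y => (unc x)%:R + (unc y)%:R)).
    rewrite (eq_avg (g := fun x => (unc x)%:R + mu unc)); first by rewrite avgD avg_cst.
    by move=> x; rewrite avgD avg_cst.
  rewrite EU {1}EBC EBC [X in _ + _ + X + _]avg_swap -!avgD; apply: le_avg => x.
  rewrite -!avgD; apply: le_avg => y.
  have s1 : 0 <= \sum_i [&& G i x, G i y & h d x y]%:R :> R by apply: sumr_ge0 => ? _; apply: ind_ge0.
  have s2 u v : 0 <= \sum_i ((b i u v)%:R + (c i u v)%:R) :> R.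
    by apply: sumr_ge0 => ? _; rewrite addr_ge0// ind_ge0.
  have := s1; have := s2 x y; have := s2 y x.
  have := ind_ge0 R (unc x); have := ind_ge0 R (unc y).
  case hd: (h d x y) => /=; last by lra.
  case: (boolP (unc x)) => [_|/negPn/existsP[i Gx]] /=; first by lra.
  case: (boolP (unc y)) => [_|/negPn/existsP[j Gy]] /=; first by lra.
  have [E|E|E] := Z3_cases i j.
  - rewrite E in Gy; move=> _ _ s3 s4 _.
    have : 1 <= \sum_i [&& G i x, G i y & h d x y]%:R :> R.
      by rewrite (bigD1 i)//= Gx Gy hd lerDl; apply: sumr_ge0 => ? _; apply: ind_ge0.
    rewrite hd; lra.
  - rewrite E in Gy; move=> _ _ s3 _ s4.
    have : 1 <= \sum_i ((b i x y)%:R + (c i x y)%:R) :> R.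
      rewrite (bigD1 i)//= /b /c Gx Gy hd /= -[1]addr0; apply: lerD.
        by case: rc; rewrite ?addr0 ?add0r.
      by apply: sumr_ge0 => ? _; rewrite addr_ge0// ind_ge0.
    lra.
  - rewrite E in Gx; move=> _ _ _ s3 s4.
    have : 1 <= \sum_i ((b i y x)%:R + (c i y x)%:R) :> R.
      have [hd' _ _ _ _] := h_perms hs hd.
      rewrite (bigD1 j)//= /b /c Gx Gy hd' /= -[1]addr0; apply: lerD.
        by case: rc; rewrite ?addr0 ?add0r.
      by apply: sumr_ge0 => ? _; rewrite addr_ge0// ind_ge0.
    lra.
have : \sum_i Cpart i <= 3 * rho.
  by rewrite (sumZ3 _ 0); have := hC 0; have := hC 1; have := hC (0 + 1); have := hC (0 + 1 + 1); lra.
have := Gcov; rewrite /mu; lra.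
Qed.

(** The reached pair carries the residues i + 1 and i + 2, so its continuation [d] receives i + 3 =
    i. *)
Definition labelled d i := exists x y, tight_reach h x0 y0 r x y (i + 1) /\ h x y d.

Lemma labelled_lab d i : labelled d i -> lab r.+1 d i.
Proof.
by move=> [x [y [rxy hxy]]]; have := lab_second (reach_step rxy hxy); rewrite Z3_add3.
Qed.

Lemma labelled_uniq d i j : labelled d i -> labelled d j -> i = j.
Proof. by move=> /labelled_lab li /labelled_lab; apply: lab_uq li; lia. Qed.

Let Apart_le d i (W : pred V) :
  (forall x y, G i x -> G i y -> h d x y -> W x) -> Apart d i <= mu W ^+ 2 / 2.
Proof.
move=> GW.
have hC : symmetric (h d) by move=> x y; rewrite (h_rev hs) -(h_rot hs).
apply: le_trans (@mantel R V W (h d) hC _).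
  apply: le_avg => x; apply: le_avg => y; apply: le_ind => /and3P[Gx Gy hd].
  by rewrite (GW x y)// (GW y x)// hC.
by move=> x y z _ _ _; apply: link_tf.
Qed.

Let Bpart0 d i j : labelled d i -> j != i + 1 -> Bpart d j = 0.
Proof.
move=> li ji; rewrite /Bpart (@eq_avg _ _ _ (fun=> 0)) ?avg_cst// => x.
rewrite (@eq_avg _ _ _ (fun=> 0)) ?avg_cst// => y.
case: (boolP [&& _, _, _ & _]) => // /and4P[_ _ /asboolP rxy hd].
have [_ _ hd' _ _] := h_perms hs hd.
have lj : labelled d (j + 1 + 1).
  by exists x, y; rewrite Z3_add3.
move: ji; rewrite -(labelled_uniq lj li) eq_sym.
by rewrite Z3_add3 eqxx.
Qed.

(** Otherwise the link of [d] has no reached crossing pair, and [mantel] within the three classes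
    leaves density about 3 (1/9) / 2 = 1/6 < 1/4. *)
Lemma labelled_exists d : exists i, labelled d i.
Proof.
apply: contrapT => no.
have B0 i : Bpart d i = 0.
  rewrite /Bpart (@eq_avg _ _ _ (fun=> 0)) ?avg_cst// => x.
  rewrite (@eq_avg _ _ _ (fun=> 0)) ?avg_cst// => y.
  case: (boolP [&& _, _, _ & _]) => // /and4P[_ _ /asboolP rxy hd].
  have [_ _ hd' _ _] := h_perms hs hd.
  by case: no; exists (i + 1 + 1), x, y; rewrite Z3_add3.
have A i : Apart d i <= (1 / 3 + 2 * rho) ^+ 2 / 2.
  apply: le_trans (@Apart_le d i (G i) _) _; first by [].
  have /andP[_ ?] := gsz i; rewrite ler_pM2r ?invr_gt0//.
  by rewrite ler_sqr ?nnegrE ?mu_ge0//; have := rho_gt0; lra.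
have := deg d; have := link_bound d.
rewrite (sumZ3 _ 0) (sumZ3 _ 0) !B0.
have := A 0; have := A (0 + 1); have := A (0 + 1 + 1).
have : (1 / 3 + 2 * rho) ^+ 2 / 2 <= 1 / 15 by rewrite expr2; have := rho_gt0; have := rhoS; nra.
by have := rhoS; lra.
Qed.

(** The residue of [d] annihilates two of the three crossing contributions, and rotating the triple
    places the third inside [X] times [Y]. A link edge inside class i + 1 avoids [X], and one inside
    class i + 2 avoids [Y], as its other end would otherwise get a second residue. [link_arith]
    concludes. *)
Lemma nonmain_link d i : labelled d i ->
  mu (fun x => G (i + 1) x && ~~ rc r.+2 d x i) +
  mu (fun y => G (i + 1 + 1) y && ~~ rc r.+2 y d (i + 1 + 1)) <= 1 / 20.
Proof.
move=> li.
set a := mu (fun x => _ && _); set b := mu (fun x => _ && _).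
pose X x := G (i + 1) x && rc r.+2 d x i.
pose Y y := G (i + 1 + 1) y && rc r.+2 y d (i + 1 + 1).
have EX : mu X = mu (G (i + 1)) - a.
  apply/eqP; rewrite eq_sym subr_eq -mu_disjointU; last by move=> x /andP[-> ->].
  by apply/eqP; apply: eq_mu => x; rewrite /X; case: G; case: rc.
have EY : mu Y = mu (G (i + 1 + 1)) - b.
  apply/eqP; rewrite eq_sym subr_eq -mu_disjointU; last by move=> x /andP[-> ->].
  by apply/eqP; apply: eq_mu => x; rewrite /Y; case: G; case: rc.
have hB : Bpart d (i + 1) <= mu X * mu Y.
  rewrite -avg2_split; apply: le_avg => x; apply: le_avg => y; apply: le_ind.
  move=> /and4P[Gx Gy /asboolP rxy hd]; have [_ _ hd1 hd2 _] := h_perms hs hd.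
  have ryd := reach_step rxy hd1.
  have rdx := reach_step ryd hd2; rewrite Z3_add3 in rdx.
  rewrite /X /Y Gx Gy /=; apply/andP; split; apply/asboolP => //.
  exact: reach_le ryd.
have hA0 : Apart d i <= mu (G i) ^+ 2 / 2 by apply: Apart_le.
have hA1 : Apart d (i + 1) <= a ^+ 2 / 2.
  apply: Apart_le => x y Gx Gy hd; rewrite Gx /=; apply/negP => /asboolP rdx.
  have := lab_second (reach_step rdx hd).
  have := lab_le (leq_trans (leqnSn _) (leqW (leqnSn _))) (Glab Gy) => l1 l2.
  have E : i + 1 = i + 1 + 1 by apply: lab_uq l1 l2; rewrite -addn3 leq_add2l.
  by move: E => /eqP; elim/Z3_ind: (i).
have hA2 : Apart d (i + 1 + 1) <= b ^+ 2 / 2.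
  apply: Apart_le => x y Gx Gy hd; rewrite Gx /=; apply/negP => /asboolP rxd.
  have [_ hd' _ _ _] := h_perms hs hd.
  have := lab_second (reach_step rxd hd').
  have := lab_le (leq_trans (leqnSn _) (leqW (leqnSn _))) (Glab Gy) => l1 l2.
  have E : i + 1 + 1 = i + 1 + 1 + 1 + 1 by apply: lab_uq l1 l2; rewrite -addn3 leq_add2l.
  by move: E => /eqP; elim/Z3_ind: (i).
have := deg d; have := link_bound d.
rewrite (sumZ3 _ i) (sumZ3 _ i) (Bpart0 li (j := i)); last by elim/Z3_ind: (i).
rewrite (Bpart0 li (j := i + 1 + 1)); last by elim/Z3_ind: (i).
rewrite addr0 add0r.
have a0 : 0 <= a by apply: mu_ge0.
have b0 : 0 <= b by apply: mu_ge0.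
have X0 := mu_ge0 R X; have Y0 := mu_ge0 R Y.
have /andP[_ g0] := gsz i; have /andP[_ g1] := gsz (i + 1); have /andP[_ g2] := gsz (i + 1 + 1).
have gg0 : 0 <= mu (G i) := mu_ge0 R (G i).
move: hB hA0 hA1 hA2 X0 Y0; rewrite EX EY.
move: (mu (G i)) (mu (G (i + 1))) (mu (G (i + 1 + 1))) (Apart d i) (Apart d (i + 1))
  (Apart d (i + 1 + 1)) (Bpart d (i + 1)) a b a0 b0 g0 g1 g2 gg0 (avg _) {EX EY X Y}.
move=> m0 m1 m2 A0 A1 A2 B a b a0 b0 g0 g1 g2 gg0 D hB hA0 hA1 hA2 X0 Y0 D1 D2.
by apply: (@link_arith R rho m0 m1 m2 A0 A1 A2 B a b D).
Qed.

End Exact.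

(** * Violating triples against missing triples *)

Section Partition.
Variables (R : realFieldType) (V : finType) (h : V -> V -> V -> bool) (K r : nat).
Variables (x0 y0 : V) (sg : V -> 'Z_3).
Hypotheses (hs : sym3 h) (hi : irr3 h) (cK : consist h K) (xy0 : x0 != y0).
Hypothesis rK : (3 * (r + 10) <= K)%N.
Local Notation avg := (@avg R V).
Local Notation mu := (@mu R V).
Local Notation avg3 := (@avg3 R V).
Local Notation rc := (rc h x0 y0).
Local Notation lab := (lab h x0 y0).

(** Only pairs in different classes qualify, oriented as their residues prescribe. The radius [s] is
    explicit because transferring reachability across a triple costs steps. *)
Definition nonmain s x y :=
  (sg y == sg x + 1) && ~~ rc s x y (sg x) || (sg x == sg y + 1) && ~~ rc s y x (sg y).

Hypothesis sg_lab : forall x, lab r.+1 x (sg x).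
Hypothesis nonmain_small : forall x, mu (nonmain r.+2 x) <= 3 / 50.
Hypothesis sg_big : forall i, 33 / 100 <= mu (fun x => sg x == i).

Let lab_eq s x i : (s <= r + 10)%N -> (r < s)%N -> lab s x i -> i = sg x.
Proof.
move=> sr rs li; apply: (lab_uniq hs hi cK xy0 _ li (lab_le rs (sg_lab x))).
by apply: leq_trans rK; rewrite leq_mul2l.
Qed.

Lemma nonmainC s x y : nonmain s x y = nonmain s y x.
Proof. by rewrite /nonmain orbC. Qed.

Lemma nonmain_mono s s' x y : (s <= s')%N -> nonmain s' x y -> nonmain s x y.
Proof.
move=> ss /orP[]/andP[E nr]; apply/orP; [left|right]; rewrite E /=;
  apply: contra nr => /asboolP rr; apply/asboolP; exact: reach_le rr.
Qed.

(** If the pair [x], [z] were reached, the next step would give [y] the third residue instead of the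
    one it shares with [x]. *)
Lemma violating_nonmain x y z : h x y z -> sg x = sg y -> sg z != sg x ->
  nonmain (r + 4) x z.
Proof.
move=> hxyz exy nz; have [hxzy _ _ hzxy _] := h_perms hs hxyz.
have r5 : ((r + 4).+1 <= r + 10)%N by rewrite -addnS leq_add2l.
have r5' : (r < (r + 4).+1)%N by rewrite ltnS leq_addr.
rewrite /nonmain; have [E|E|E] := Z3_cases (sg x) (sg z).
- by rewrite E eqxx in nz.
- rewrite E eqxx /=; case: (boolP (rc _ x z _)) => //= /asboolP rr; exfalso.
  have := lab_eq r5 r5' (lab_second (reach_step rr hxzy)).
  by rewrite -exy => /eqP; elim/Z3_ind: (sg x).
rewrite E eqxx /=; case: (boolP (rc _ z x _)) => //=; last by rewrite orbT.
move=> /asboolP rr; exfalso.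
have := lab_eq r5 r5' (lab_second (reach_step rr hzxy)).
by rewrite -exy E => /eqP; elim/Z3_ind: (sg z).
Qed.

(** A reached pair [x], [z] in a crossing triple reaches [x], [y] within two more steps; hence
    [r.+2] against [r + 4]. *)
Lemma nonmain_edge x y z : nonmain (r + 4) x y -> h x y z -> sg z != sg x -> sg z != sg y ->
  nonmain r.+2 x z.
Proof.
move=> nxy hxyz nzx nzy; have [hxzy _ _ hzxy hzyx] := h_perms hs hxyz.
case: (boolP (nonmain _ _ _)) => // /norP[]; rewrite !negb_and !negbK => n1 n2; exfalso.
case/orP: nxy => /andP[/eqP E /negP]; apply; apply/asboolP.
  have Ez : sg x = sg z + 1.
    move: nzx nzy; rewrite E => a b; apply/eqP; move: a b.
    by elim/Z3_ind: (sg x); elim/Z3_ind: (sg z).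
  move: n2; rewrite Ez eqxx /= => /asboolP rr.
  by apply: reach_le (reach_step rr hzxy); rewrite -addn3 leq_add2l.
have Ez : sg z = sg x + 1.
  move: nzx nzy; rewrite E => a b; apply/eqP; move: a b.
  by elim/Z3_ind: (sg y); elim/Z3_ind: (sg z).
move: n1; rewrite Ez eqxx /= => /asboolP rr.
have rr2 := reach_step (reach_step rr hxzy) hzyx.
have -> : sg y = sg x + 1 + 1 by rewrite E Z3_add3.
by apply: reach_le rr2; rewrite -addn4.
Qed.

Definition all_distinct x y z := [&& sg x != sg y, sg y != sg z & sg x != sg z].

Lemma avg3_all_distinct : avg3 all_distinct <=
  6 * (mu (fun x => sg x == 0) * mu (fun x => sg x == 1) * mu (fun x => sg x == 1 + 1)).
Proof.
pose p i j k x y z := [&& sg x == i, sg y == j & sg z == k].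
have pE i j k : avg3 (p i j k) =
    mu (fun x => sg x == i) * (mu (fun x => sg x == j) * mu (fun x => sg x == k)).
  rewrite /avg3 -avgZr; apply: eq_avg => x; rewrite -avg2_split -avgZ; apply: eq_avg => y.
  by rewrite -avgZ; apply: eq_avg => z; rewrite /p indM.
have : avg3 all_distinct <= \sum_i (avg3 (p i (i + 1) (i + 1 + 1)) + avg3 (p i (i + 1 + 1) (i + 1))).
  have -> : \sum_i (avg3 (p i (i + 1) (i + 1 + 1)) + avg3 (p i (i + 1 + 1) (i + 1))) =
    avg (fun x => avg (fun y => avg (fun z => \sum_i ((p i (i + 1) (i + 1 + 1) x y z)%:R
      + (p i (i + 1 + 1) (i + 1) x y z)%:R)))).
    rewrite (eq_bigr (fun i => avg (fun x => avg (fun y => avg (fun z =>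
       (p i (i + 1) (i + 1 + 1) x y z)%:R + (p i (i + 1 + 1) (i + 1) x y z)%:R))))).
      rewrite -avg_sum; apply: eq_avg => x; rewrite -avg_sum; apply: eq_avg => y.
      by rewrite -avg_sum.
    move=> i _; rewrite /avg3 -avgD; apply: eq_avg => x; rewrite -avgD; apply: eq_avg => y.
    by rewrite -avgD.
  apply: le_avg => x; apply: le_avg => y; apply: le_avg => z.
  case: (boolP (all_distinct _ _ _)) => [/and3P[]|_]; last first.
    by apply: sumr_ge0 => i _; rewrite addr_ge0// ind_ge0.
  rewrite (bigD1 (sg x))//= /p eqxx /= => h1 h2 h3; rewrite -[leLHS]addr0; apply: lerD.
    by move: h1 h2 h3; elim/Z3_ind: (sg x); elim/Z3_ind: (sg y); elim/Z3_ind: (sg z) => //= *;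
      rewrite ?addr0 ?add0r.
  by apply: sumr_ge0 => i _; rewrite addr_ge0// ind_ge0.
rewrite (sumZ3 _ 0) !pE !add0r.
rewrite (_ : 1 + 1 + 1 = 0 :> 'Z_3) ?add0r; last by apply/eqP.
by move=> H; apply: le_trans H _; rewrite le_eqVlt; apply/orP; left; apply/eqP; ring.
Qed.

Definition missing x y z := all_distinct x y z && ~~ h x y z.
Definition apex z x y := [&& h z x y, sg x == sg y & sg z != sg x].

(** For a nonmain pair [x], [y], a hyperedge to [z] in the third class makes [x], [z] nonmain. That
    class has density at least 33/100, at most 6/100 are used up in this way, and the other 27/100
    are missing. *)
Lemma missing_ge : avg (fun x => mu (nonmain (r + 4) x)) * (27 / 100) <= avg3 missing.
Proof.
rewrite -avgZr; apply: le_avg => x; rewrite -avgZr; apply: le_avg => y.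
case: (boolP (nonmain _ _ _)) => nxy; last first.
  by rewrite mul0r; apply: avg_ge0 => ?; apply: ind_ge0.
rewrite mul1r.
have [k kx ky] : exists2 k : 'Z_3, k != sg x & k != sg y.
  case/orP: nxy => /andP[/eqP-> _]; [exists (sg x + 1 + 1) | exists (sg y + 1 + 1)];
  by elim/Z3_ind: (sg _).
have nexy : sg x != sg y.
  by case/orP: nxy => /andP[/eqP-> _]; elim/Z3_ind: (sg _).
have : mu (fun z => sg z == k) <= mu (missing x y) + mu (nonmain r.+2 x).
  apply: le_mu2 => z /eqP zk; rewrite /missing /all_distinct nexy zk (eq_sym _ k) ky.
  rewrite (eq_sym _ k) kx /=; case: (boolP (h x y z)) => //= hxyz.
  by apply: nonmain_edge hxyz _ _; rewrite // zk.
have := sg_big k; have := nonmain_small x.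
change (mu (nonmain r.+2 x) <= 3 / 50 -> 33 / 100 <= mu (fun z => sg z == k) ->
  mu (fun z => sg z == k) <= mu (missing x y) + mu (nonmain r.+2 x) ->
  27 / 100 <= mu (missing x y)); lra.
Qed.

(** Both pairs at the apex are nonmain; of the resulting product of two degrees, one factor is at
    most 3/50. *)
Lemma apex_le : avg3 apex <= avg (fun x => mu (nonmain (r + 4) x)) * (3 / 50).
Proof.
rewrite -avgZr; apply: le_avg => z.
apply: le_trans (_ : mu (nonmain (r + 4) z) * mu (nonmain (r + 4) z) <= _); last first.
  rewrite ler_wpM2l ?mu_ge0//; apply: le_trans (nonmain_small z).
  by apply: le_mu => y; apply: nonmain_mono; rewrite -addn2 leq_add2l.
rewrite -avg2_split; apply: le_avg => x; apply: le_avg => y; apply: le_ind.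
move=> /and3P[hz /eqP exy nzx]; have [_ _ hxyz _ _] := h_perms hs hz.
have [_ hyxz _ _ _] := h_perms hs hxyz.
rewrite nonmainC (violating_nonmain hxyz)//= nonmainC.
by rewrite (violating_nonmain hyxz)// -exy.
Qed.

(** With three positions for the apex, violating triples cost at most 18/100 of the nonmain density,
    less than the 27/100 gained from missing triples. *)
Theorem partition_bound : avg3 h <=
  6 * (mu (fun x => sg x == 0) * mu (fun x => sg x == 1) * mu (fun x => sg x == 1 + 1)) +
  \sum_i avg3 (fun x y z => [&& sg x == i, sg y == i, sg z == i & h x y z]).
Proof.
apply: le_trans (lerD avg3_all_distinct (lexx _)).
have : avg3 h + avg3 missing <= avg3 all_distinct +
   \sum_i avg3 (fun x y z => [&& sg x == i, sg y == i, sg z == i & h x y z]) +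
   (avg3 apex + avg3 (fun x y z => apex y x z) + avg3 (fun x y z => apex z x y)).
  have -> : \sum_i avg3 (fun x y z => [&& sg x == i, sg y == i, sg z == i & h x y z]) =
    avg (fun x => avg (fun y => avg (fun z =>
      \sum_i [&& sg x == i, sg y == i, sg z == i & h x y z]%:R))).
    rewrite -avg_sum; apply: eq_avg => x; rewrite -avg_sum; apply: eq_avg => y.
    by rewrite -avg_sum.
  rewrite /avg3 -!avgD; apply: le_avg => x; rewrite -!avgD; apply: le_avg => y.
  rewrite -!avgD; apply: le_avg => z.
  have s0 : 0 <= \sum_i [&& sg x == i, sg y == i, sg z == i & h x y z]%:R :> R.
    by apply: sumr_ge0 => ? _; apply: ind_ge0.
  have a1 := ind_ge0 R (apex x y z); have a2 := ind_ge0 R (apex y x z).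
  have a3 := ind_ge0 R (apex z x y).
  rewrite /missing; case: (boolP (all_distinct x y z)) => [_|nd] /=.
    by move: s0 a1 a2 a3; case: (h x y z) => /=; lra.
  move: s0; case: (boolP (h x y z)) => hxyz /= s0; last by lra.
  have [_ hyxz _ hzxy _] := h_perms hs hxyz.
  have [E|E] := eqVneq (sg x) (sg y).
    have [E'|E'] := eqVneq (sg z) (sg x).
      have : 1 <= \sum_i [&& sg x == i, sg y == i, sg z == i & h x y z]%:R :> R.
        rewrite (bigD1 (sg x))//= -E E' eqxx hxyz lerDl.
        by apply: sumr_ge0 => ? _; apply: ind_ge0.
      by rewrite hxyz /=; lra.
    have -> : apex z x y by rewrite /apex hzxy E eqxx -E E'.
    by rewrite /=; lra.
  have [E2|E2] := eqVneq (sg y) (sg z).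
    have -> : apex x y z by rewrite /apex hxyz E2 eqxx -E2 E.
    by rewrite /=; lra.
  have E3 : sg x == sg z by move: nd; rewrite /all_distinct E E2 /= negbK.
  have -> : apex y x z by rewrite /apex hyxz E3 eq_sym E.
  by rewrite /=; lra.
rewrite (avg3C R apex) (avg3C2 R apex).
have n0 : 0 <= avg (fun x => mu (nonmain (r + 4) x)) by apply: avg_ge0 => x; apply: mu_ge0.
have := missing_ge; have := apex_le; lra.
Qed.

End Partition.

Theorem exact_partition (R : realFieldType) (rho : R) (D K : nat) (V : finType)
    (h : V -> V -> V -> bool) :
  0 < rho -> rho <= (1 / 100) ^+ 2 ->
  1 < D%:R * (rho ^+ 4 / 36) ^+ 2 -> (3 * (7 * D + 10) <= K)%N ->
  sym3 h -> irr3 h -> consist h K -> (0 < #|V|)%N ->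
  (forall d, 1 / 4 <= avg (fun x => avg (fun y => (h d x y)%:R)) :> R) ->
  exists sg : V -> 'Z_3, (forall i, 0 < mu R (fun x => sg x == i)) /\
  avg3 R h <=
    6 * (mu R (fun x => sg x == 0) * mu R (fun x => sg x == 1) * mu R (fun x => sg x == 1 + 1)) +
    \sum_i avg3 R (fun x y z => [&& sg x == i, sg y == i, sg z == i & h x y z]).
Proof.
move=> r0 r1 D1 DK hs hi cK V0 deg.
have rhoS : rho <= 1 / 10000 by move: r1; rewrite expr2; lra.
have DK' : (3 * (7 * D).+1 <= K)%N.
  by apply: leq_trans DK; rewrite leq_mul2l -[(7 * D).+1]addn1 leq_add2l.
have h4 : 1 / 4 <= avg3 R h by rewrite -(@avg_cst R V (1 / 4) V0); apply: le_avg.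
have [x0 [y0 [G [xy0 [Gd Gc] Gs Ga]]]] := structure r0 r1 D1 DK' hs hi cK V0 h4.
have Gup i x : G i x -> mu R (fun y => G (i + 1) y && ~~ rc h x0 y0 (7 * D) x y i) <= rho.
  by move=> /Ga[].
have /choice[sg sgP] := labelled_exists hs hi cK DK r0 rhoS V0 Gc Gs Gup deg.
have sg_lab x : lab h x0 y0 (7 * D).+1 x (sg x) by apply: labelled_lab.
have Gsg i x : G i x -> sg x = i.
  move=> Gx; have l1 := lab_le (leqnSn _) (Glab rhoS Gs Gup Gx).
  apply: (lab_uniq hs hi cK xy0 _ (sg_lab x) l1).
  exact: DK'.
have sg_big i : 33 / 100 <= mu R (fun x => sg x == i).
  have : mu R (G i) <= mu R (fun x => sg x == i) by apply: le_mu => x /Gsg/eqP.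
  have := Gs i; rewrite ler_norml => /andP[]; lra.
(* 1/20 from the link estimate plus [rho] for unclassified vertices. *)
have nms x : mu R (nonmain h x0 y0 sg (7 * D).+2 x) <= 3 / 50.
  have := nonmain_link hs hi cK xy0 DK r0 rhoS V0 Gc Gs Gup deg (sgP x).
  have : mu R (nonmain h x0 y0 sg (7 * D).+2 x) <=
    mu R (fun y => G (sg x + 1) y && ~~ rc h x0 y0 (7 * D).+2 x y (sg x)) +
    mu R (fun y => G (sg x + 1 + 1) y && ~~ rc h x0 y0 (7 * D).+2 y x (sg x + 1 + 1)) + mu R (unc G).
    rewrite -!avgD; apply: le_avg => y.
    apply: le_trans (@le_ind2 _ _ ((G (sg x + 1) y && ~~ rc h x0 y0 (7 * D).+2 x y (sg x)) ||
      (G (sg x + 1 + 1) y && ~~ rc h x0 y0 (7 * D).+2 y x (sg x + 1 + 1))) (unc G y) _) _; last first.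
      by rewrite lerD2r; apply: le_ind2.
    rewrite /nonmain; case: (boolP (unc G y)) => [|/negPn/existsP[j Gy]]; first by rewrite orbT.
    rewrite orbF (Gsg _ _ Gy) => /orP[/andP[/eqP Ej rr]|/andP[/eqP Ej rr]].
      by rewrite -Ej Gy rr.
    by rewrite Ej Z3_add3 Gy rr orbT.
  lra.
exists sg; split; first by move=> i; apply: lt_le_trans (sg_big i); lra.
exact: (partition_bound hs hi cK xy0 DK sg_lab nms sg_big).
Qed.

(** * Induction on the number of vertices *)

(** Triples are ordered, so a hyperedge counts six times. *)
Definition tot (V : finType) (h : V -> V -> V -> bool) : nat :=
  (\sum_x \sum_y \sum_z h x y z)%N.

Section Restrict.
Variable V : finType.
Implicit Types (h : V -> V -> V -> bool) (P : {pred V}).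

Definition restr P h (x y z : {x in P}) := h (val x) (val y) (val z).

Lemma tot_restr P h :
  tot (@restr P h) = (\sum_(x in P) \sum_(y in P) \sum_(z in P) h x y z)%N.
Proof.
rewrite [RHS]big_sub; apply: eq_bigr => x _; rewrite [RHS]big_sub; apply: eq_bigr => y _.
by rewrite [RHS]big_sub.
Qed.

Lemma sym3_restr P h : sym3 h -> sym3 (@restr P h).
Proof. by move=> [h1 h2]; split=> x y z; [apply: h1 | apply: h2]. Qed.

Lemma irr3_restr P h : irr3 h -> irr3 (@restr P h).
Proof. by move=> hi x z; apply: hi. Qed.

Lemma consist_restr P h K : consist h K -> consist (@restr P h) K.
Proof.
move=> c k x y z kK xy w; apply: (c k (val x) (val y) (val z) kK).
  by rewrite (inj_eq val_inj).
exact: (walk_map (g := val) _ w).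
Qed.

Lemma avg3_tot (R : realFieldType) (h : V -> V -> V -> bool) :
  avg3 R h = (tot h)%:R / #|V|%:R ^+ 3.
Proof.
rewrite /avg3 /avg /tot natr_sum !exprS expr0 mulr1 !invfM.
rewrite !mulr_suml; apply: eq_bigr => x _; rewrite natr_sum !mulr_suml; apply: eq_bigr => y _.
by rewrite natr_sum !mulrA.
Qed.

Lemma mu_card (R : realFieldType) P : mu R P = #|P|%:R / #|V|%:R.
Proof.
rewrite /mu /avg -natr_sum; congr (_%:R / _).
by rewrite -sum1_card [RHS]big_mkcond; apply: eq_bigr => x _; rewrite unfold_in; case: (P x).
Qed.

End Restrict.

(** The cube of the sum exceeds the sum of the cubes plus 24abc by weighted squares, so n^3 + 24 n^2
    survives a tripartition with all crossing triples present. *)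
Lemma tripartition_arith (R : realFieldType) (a b c T0 T1 T2 T : R) :
  0 <= a -> 0 <= b -> 0 <= c ->
  4 * T0 <= a ^+ 3 + 24 * a ^+ 2 -> 4 * T1 <= b ^+ 3 + 24 * b ^+ 2 ->
  4 * T2 <= c ^+ 3 + 24 * c ^+ 2 -> T <= 6 * (a * b * c) + (T0 + T1 + T2) ->
  4 * T <= (a + b + c) ^+ 3 + 24 * (a + b + c) ^+ 2.
Proof.
move=> a0 b0 c0 h0 h1 h2 hT.
have : 0 <= a * (b - c) ^+ 2 + b * (c - a) ^+ 2 + c * (a - b) ^+ 2.
  have mg (u v : R) : 0 <= u -> 0 <= u * v ^+ 2 by move=> u0; apply: mulr_ge0 u0 (sqr_ge0 v).
  by apply: addr_ge0 (addr_ge0 _ _) _; apply: mg.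
have : 0 <= a * b + b * c + c * a by apply: addr_ge0 (addr_ge0 _ _) _; apply: mulr_ge0.
have -> : (a + b + c) ^+ 3 + 24 * (a + b + c) ^+ 2 =
  (a ^+ 3 + 24 * a ^+ 2) + (b ^+ 3 + 24 * b ^+ 2) + (c ^+ 3 + 24 * c ^+ 2) + 24 * (a * b * c)
  + 3 * (a * (b - c) ^+ 2 + b * (c - a) ^+ 2 + c * (a - b) ^+ 2) + 48 * (a * b + b * c + c * a) by ring.
lra.
Qed.

Theorem density_bound (R : realFieldType) (rho : R) (D K : nat) :
  0 < rho -> rho <= (1 / 100) ^+ 2 ->
  1 < D%:R * (rho ^+ 4 / 36) ^+ 2 -> (3 * (7 * D + 10) <= K)%N ->
  forall (V : finType) (h : V -> V -> V -> bool),
  sym3 h -> irr3 h -> consist h K -> (4 * tot h <= #|V| ^ 3 + 24 * #|V| ^ 2)%N.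
Proof.
move=> r0 r1 D1 DK V.
have [m] := ubnP #|V|; elim: m V => // m IH V Vm h hs hi cK.
rewrite leqNgt; apply/negP => big.
have V0 : (0 < #|V|)%N.
  rewrite lt0n; apply/negP => /eqP V0; move: big.
  by rewrite /tot big1 ?muln0 ?ltn0// => x _; case: (fintype0 x V0).
have n0 : 0 < #|V|%:R :> R by rewrite ltr0n.
have IHP (P : {pred V}) : (#|P| < #|V|)%N ->
    (4 * \sum_(x in P) \sum_(y in P) \sum_(z in P) h x y z <= #|P| ^ 3 + 24 * #|P| ^ 2)%N.
  move=> PV; have := IH {x in P}; rewrite card_sig => /(_ _ (@restr V P h)).
  rewrite tot_restr; apply; first exact: leq_trans PV _.
  - exact: sym3_restr.
  - exact: irr3_restr.
  exact: consist_restr.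
(* Deleting a vertex of smaller degree would contradict the induction hypothesis: n^3 - (n - 1)^3
   falls short of 3 n^2 by 3 n - 1, and the increment of 24 n^2 covers this. *)
have deg d : (#|V| ^ 2 <= 4 * \sum_x \sum_y h d x y)%N.
  have cP : #|predC1 d| = #|V|.-1 by rewrite cardC1.
  have := IHP (predC1 d); rewrite cP prednK// leqnn => /(_ isT).
  set S := (X in (4 * X <= _)%N) => hS.
  have : (tot h <= S + 3 * \sum_x \sum_y h d x y)%N.
    have E1 (F : V -> nat) : (\sum_x F x = F d + \sum_(x in predC1 d) F x)%N.
      by rewrite (bigD1 d).
    have C1 x y : h x d y = h d x y by rewrite (h_swap hs).
    have C2 x y : h x y d = h d x y by rewrite (h_rot hs) (h_rot hs).
    have Sx : (\sum_x \sum_(y in predC1 d) \sum_(z in predC1 d) h x y z <=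
               \sum_x \sum_y h d x y + S)%N.
      rewrite E1 leq_add2r.
      rewrite [leqRHS]E1 (@leq_trans (\sum_(x in predC1 d) \sum_y h d x y))//; last by rewrite leq_addl.
      by apply: leq_sum => x _; rewrite [leqRHS]E1 leq_addl.
    rewrite /tot.
    have -> : (\sum_x \sum_y \sum_z h x y z =
      \sum_x \sum_z h x d z + \sum_x \sum_(y in predC1 d) \sum_z h x y z)%N.
      by rewrite -big_split; apply: eq_bigr => x _; rewrite E1.
    have -> : (\sum_x \sum_(y in predC1 d) \sum_z h x y z =
      \sum_x \sum_(y in predC1 d) h x y d + \sum_x \sum_(y in predC1 d) \sum_(z in predC1 d) h x y z)%N.
      rewrite -big_split; apply: eq_bigr => x _; rewrite -big_split; apply: eq_bigr => y _.
      by rewrite E1.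
    have : (\sum_x \sum_(y in predC1 d) h x y d <= \sum_x \sum_y h d x y)%N.
      apply: leq_sum => x _; rewrite [leqRHS]E1; apply: leq_trans (leq_addl _ _).
      by apply: leq_sum => y _; rewrite C2.
    have : (\sum_x \sum_z h x d z = \sum_x \sum_y h d x y)%N.
      by apply: eq_bigr => x _; apply: eq_bigr => y _; rewrite C1.
    by move: Sx; lia.
  move: hS big V0; case: #|V| => // n /=; rewrite !expnS !expn0; nia.
have degR d : 1 / 4 <= avg (fun x => avg (fun y => (h d x y)%:R)) :> R.
  have -> : avg (fun x => avg (fun y => (h d x y)%:R)) =
     (\sum_x \sum_y h d x y)%N%:R / #|V|%:R ^+ 2 :> R.
    rewrite /avg natr_sum expr2 invfM !mulr_suml; apply: eq_bigr => x _.
    by rewrite natr_sum mulrA.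
  rewrite ler_pdivlMr ?exprn_gt0//.
  by have := deg d; rewrite -(ler_nat R) natrM natrX; lra.
have [sg [sg0 bound]] := exact_partition r0 r1 D1 DK hs hi cK V0 degR.
pose P i : {pred V} := fun x => sg x == i.
have muP i : mu R (fun x => sg x == i) = #|P i|%:R / #|V|%:R by apply: (mu_card R (P i)).
pose T i : nat := (\sum_(x in P i) \sum_(y in P i) \sum_(z in P i) h x y z)%N.
have TE i : avg3 R (fun x y z => [&& sg x == i, sg y == i, sg z == i & h x y z]) =
    (T i)%:R / #|V|%:R ^+ 3.
  rewrite avg3_tot; congr (_%:R / _); rewrite /T /tot [RHS]big_mkcond.
  apply: eq_bigr => x _; rewrite unfold_in /P; case: ifP => sx; last first.
    by rewrite big1// => y _; rewrite big1// => z _.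
  rewrite [RHS]big_mkcond; apply: eq_bigr => y _; rewrite unfold_in; case: ifP => sy; last first.
    by rewrite big1// => z _.
  by rewrite [RHS]big_mkcond; apply: eq_bigr => z _; rewrite unfold_in; case: ifP.
have cards : (#|P 0%R| + #|P 1%R| + #|P (1 + 1)%R| = #|V|)%N.
  have -> : (#|V| = \sum_(i : 'Z_3) #|P i|)%N.
    rewrite -sum1_card (partition_big sg xpredT) //=.
    by apply: eq_bigr => i _; rewrite -sum1_card.
  rewrite 3!big_ord_recl big_ord0 addn0 addnA.
  have -> : ord0 = 0 :> 'Z_3 by apply/eqP.
  have -> : lift ord0 ord0 = 1 :> 'Z_3 by apply/eqP.
  by have -> : lift ord0 (lift ord0 ord0) = 1 + 1 :> 'Z_3 by apply/eqP.
have Ppos i : (0 < #|P i|)%N.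
  have := sg0 i; rewrite muP; case: #|P i| => //; by rewrite mul0r ltxx.
have hT i : (4 * T i <= #|P i| ^ 3 + 24 * #|P i| ^ 2)%N.
  apply: IHP; move: (Ppos 0) (Ppos 1) (Ppos (1 + 1)); rewrite -cards.
  by elim/Z3_ind: i; lia.
have main : (tot h)%:R <= 6 * (#|P 0|%:R * #|P 1|%:R * #|P (1 + 1)%R|%:R) +
    ((T 0)%:R + (T 1)%:R + (T (1 + 1)%R)%:R) :> R.
  move: bound; rewrite (sumZ3 _ 0) !add0r !TE avg3_tot !muP.
  have n3 : 0 < #|V|%:R ^+ 3 :> R by rewrite exprn_gt0.
  rewrite -(ler_pM2r n3) mulfVK ?gt_eqF// => H; apply: le_trans H _.
  rewrite le_eqVlt; apply/orP; left; apply/eqP; field; exact: lt0r_neq0.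
have hTR i : 4 * (T i)%:R <= #|P i|%:R ^+ 3 + 24 * #|P i|%:R ^+ 2 :> R.
  by have := hT i; rewrite -(ler_nat R) natrD natrX (natrM R 4) (natrM R 24) natrX.
have := tripartition_arith (ler0n R _) (ler0n R _) (ler0n R _) (hTR 0) (hTR 1) (hTR (1 + 1)) main.
rewrite -!natrD cards -!natrX -!natrM -natrD ler_nat leqNgt.
by rewrite big.
Qed.

(** * Sums over sequences and the box theorem *)

Local Open Scope nat_scope.

Section IteratedSum.
Variable V : finType.
Local Notation n := #|V|.

(** The sum runs over all sequences of length [m], repetitions included. *)
Fixpoint isum m (F : seq V -> nat) : nat :=
  if m is m'.+1 then \sum_x isum m' (fun s => F (x :: s)) else F [::].

Lemma leq_isum m (F G : seq V -> nat) :
  (forall s, size s = m -> F s <= G s) -> isum m F <= isum m G.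
Proof.
elim: m F G => [|m IH] F G FG /=; first exact: FG.
by apply: leq_sum => x _; apply: IH => s sm; apply: FG; rewrite /= sm.
Qed.

Lemma isumD m F G : isum m (fun s => F s + G s) = isum m F + isum m G.
Proof.
elim: m F G => [//|m IH] F G /=; rewrite -big_split; apply: eq_bigr => x _.
exact: IH.
Qed.

Lemma isumM m c F : isum m (fun s => c * F s) = c * isum m F.
Proof.
elim: m F => [//|m IH] F /=; rewrite big_distrr; apply: eq_bigr => x _; exact: IH.
Qed.

Lemma sum_cst c : \sum_(x : V) c = n * c.
Proof. by rewrite sum_nat_const; congr (_ * _); apply: eq_card. Qed.

Lemma isum_cst m c : isum m (fun=> c) = n ^ m * c.
Proof.
elim: m => [|m IH] /=; first by rewrite mul1n.
by rewrite sum_cst IH expnS mulnA.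
Qed.

Lemma isum_sum (I : finType) (P : pred I) m (F : I -> seq V -> nat) :
  isum m (fun s => \sum_(i | P i) F i s) = \sum_(i | P i) isum m (F i).
Proof.
elim: m F => [//|m IH] F /=; rewrite exchange_big /=; apply: eq_bigr => x _.
exact: IH.
Qed.

Variable v0 : V.
Local Notation nth := (nth v0).

Lemma isum1 m i (f : V -> nat) : i < m ->
  isum m (fun s => f (nth s i)) = n ^ m.-1 * \sum_x f x.
Proof.
elim: m i => // m IH [|i] /= im.
  by rewrite big_distrr; apply: eq_bigr => x _; rewrite isum_cst.
under eq_bigr do rewrite IH//.
by rewrite sum_cst mulnA -expnS prednK//; move: im; rewrite ltnS; apply: leq_ltn_trans.
Qed.

Lemma isum2 m i j (f : V -> V -> nat) : i < m -> j < m -> i != j ->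
  isum m (fun s => f (nth s i) (nth s j)) = n ^ (m - 2) * \sum_x \sum_y f x y.
Proof.
elim: m i j => // m IH [|i] [|j] //= im jm ij.
- rewrite big_distrr; apply: eq_bigr => x _; rewrite isum1// subSS.
  by rewrite subn1.
- rewrite exchange_big big_distrr; apply: eq_bigr => x _.
  by rewrite (isum1 (fun y => f y x))// subSS subn1.
under eq_bigr do rewrite IH//.
rewrite sum_cst mulnA -expnS.
by have -> : m.+1 - 2 = (m - 2).+1 by clear -im jm ij; lia.
Qed.

Lemma isum3 m i j k (f : V -> V -> V -> nat) :
  i < m -> j < m -> k < m -> i != j -> j != k -> i != k ->
  isum m (fun s => f (nth s i) (nth s j) (nth s k)) =
  n ^ (m - 3) * \sum_x \sum_y \sum_z f x y z.
Proof.
elim: m i j k => // m IH [|i] [|j] [|k] //= im jm km ij jk ik.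
- by rewrite big_distrr; apply: eq_bigr => x _; rewrite (isum2 (f x))// subSS.
- rewrite exchange_big big_distrr; apply: eq_bigr => y _.
  by rewrite (isum2 (fun x z => f x y z))// subSS.
- rewrite (eq_bigr (fun z => n ^ (m - 2) * \sum_x \sum_y f x y z)); last first.
    by move=> z _; rewrite (isum2 (fun x y => f x y z)).
  rewrite -big_distrr /= subSS; congr (_ * _); rewrite exchange_big; apply: eq_bigr => x _.
  exact: exchange_big.
under eq_bigr do rewrite IH//.
rewrite sum_cst mulnA -expnS.
by have -> : m.+1 - 3 = (m - 3).+1 by clear -im jm km ij jk ik; lia.
Qed.

End IteratedSum.

Local Open Scope ring_scope.

Lemma ex_nat_gt (R : realType) (x : R) : exists n : nat, x < n%:R.
Proof.
by exists (Num.bound `|x|); apply: le_lt_trans (ler_norm x) (archi_boundP (normr_ge0 x)).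
Qed.

Lemma mkseqS (T : Type) (f : nat -> T) m : mkseq f m.+1 = f 0%N :: mkseq (f \o S) m.
Proof. by rewrite /mkseq /= -[1%N]addn0 iotaDl -map_comp. Qed.

(* Erdős' box theorem, in the form of large sets all of whose transversals lie in [S]. *)
Lemma box (R : realType) (t m : nat) (c : R) : 0 < c ->
  exists n0 : nat, forall V : finType, (n0 <= #|V|)%N -> forall S : pred (seq V),
  c * #|V|%:R ^+ m <= (isum m (fun s => S s : nat))%:R ->
  exists A : nat -> {set V}, (forall i, (i < m)%N -> (t <= #|A i|)%N) /\
    forall f : nat -> V, (forall i, (i < m)%N -> f i \in A i) -> S (mkseq f m).
Proof.
elim: m c => [|m IH] c c0.
  exists 0%N => V _ S; rewrite expr0 mulr1 /= => hS.
  exists (fun=> finset.set0); split => // f _.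
  by move: hS; rewrite /mkseq /=; case: (S [::]) => //; rewrite leNgt c0.
have [q qt] := ex_nat_gt (4 * t%:R / c).
have q0 : 0 < q%:R :> R.
  by apply: le_lt_trans qt; rewrite divr_ge0 ?mulr_ge0 ?ler0n// ltW.
have {}qt : t%:R <= c * q%:R / 4 by move: qt; rewrite ltr_pdivrMr//; lra.
(* The factor 2^q pays for a pigeonhole over the subsets of a [q]-element set, the factor 8 for the
   averaging steps. *)
pose c' := c / 8 / 2 ^+ q.
have p2 : 0 < 2 ^+ q :> R by rewrite exprn_gt0.
have c'0 : 0 < c' by rewrite !divr_gt0.
have [n1 IH1] := IH c' c'0; have [n2 hn2] := ex_nat_gt (2 * q%:R / c).
exists (maxn n1 n2) => V; rewrite geq_max => /andP[Vn1 Vn2] S hS.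
have V0 : 0 < #|V|%:R :> R.
  apply: lt_le_trans (_ : n2%:R <= _); last by rewrite ler_nat.
  by apply: le_lt_trans hn2; rewrite divr_ge0 ?mulr_ge0 ?ler0n// ltW.
have Vq : 2 * q%:R <= c * #|V|%:R.
  have : 2 * q%:R / c <= #|V|%:R by apply: le_trans (ltW hn2) _; rewrite ler_nat.
  by rewrite ler_pdivrMr// [_ * c]mulrC.
set N : R := #|V|%:R ^+ m; have N0 : 0 < N by rewrite exprn_gt0.
pose a x := isum m (fun s => S (x :: s) : nat).
have aN x : (a x)%:R <= N.
  rewrite /N -natrX ler_nat -[leqRHS]muln1 -(isum_cst V m 1).
  by apply: leq_isum => s _; apply: leq_b1.
(* First coordinates with many continuations; there are at least [q] of them, and [Q] below is a
   choice of [q]. *)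
pose X := [set x | c / 2 * N <= (a x)%:R].
have qX : (q <= #|X|)%N.
  rewrite leqNgt; apply/negP => Xq.
  have h1 : (isum m.+1 (fun s => S s : nat))%:R <= #|X|%:R * N + #|V|%:R * (c / 2 * N).
    rewrite [isum _ _]/= natr_sum.
    have -> : #|X|%:R * N + #|V|%:R * (c / 2 * N) = \sum_x ((x \in X)%:R * N + c / 2 * N).
      rewrite big_split /= -mulr_suml -natr_sum.
      have -> : \sum_(x : V) c / 2 * N = #|V|%:R * (c / 2 * N) by rewrite sumr_const mulr_natl.
      have -> // : (\sum_x (x \in X) = #|X|)%N.
      by rewrite -sum1_card [RHS]big_mkcond; apply: eq_bigr => x _; case: (x \in X).
    apply: ler_sum => x _; change ((a x)%:R <= (x \in X)%:R * N + c / 2 * N).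
    rewrite inE; have cN : 0 < c / 2 * N by rewrite mulr_gt0 ?divr_gt0.
    have ax := aN x; case: (lerP (c / 2 * N) (a x)%:R) => h /=; rewrite ?mul1r ?mul0r; lra.
  have h2 : #|X|%:R + 1 <= q%:R :> R by rewrite natr1 ler_nat.
  have : c * (#|V|%:R * N) <= #|X|%:R * N + #|V|%:R * (c / 2 * N) by rewrite -exprS; apply: le_trans hS h1.
  have -> : #|X|%:R * N + #|V|%:R * (c / 2 * N) = (#|X|%:R + #|V|%:R * c / 2) * N by field.
  rewrite mulrA ler_pM2r//; lra.
have /card_geqP[sQ [uQ szQ subQ]] := qX.
pose Q := [set x in sQ].
have cQ : #|Q| = q by rewrite cardsE (card_uniqP uQ).
pose d s := (\sum_(x in Q) S (x :: s))%N.
have isd : q%:R * (c / 2 * N) <= (isum m d)%:R.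
  rewrite isum_sum natr_sum -cQ -sum1_card natr_sum mulr_suml; apply: ler_sum => x.
  by rewrite mul1r inE => /subQ; rewrite inE.
pose g := isum m (fun s => (t <= d s)%N : nat).
have dg : (isum m d <= #|V| ^ m * t + q * g)%N.
  rewrite -isumM -isum_cst -isumD; apply: leq_isum => s _.
  case: (leqP t (d s)) => [_|/ltnW]; last by rewrite muln0 addn0.
  rewrite muln1 -cQ -sum1_card; apply: leq_trans (leq_addl _ _).
  by apply: leq_sum => x _; apply: leq_b1.
have gN : c / 4 * N <= g%:R.
  have : q%:R * (c / 2 * N) <= N * t%:R + q%:R * g%:R.
    by apply: le_trans isd _; rewrite /N -natrX -!natrM -natrD ler_nat.
  have : N * t%:R <= N * (c * q%:R / 4) by rewrite ler_pM2l.
  move=> h1 h2; rewrite -(ler_pM2l q0); lra.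
pose SB (B : {set V}) s := [forall x in B, S (x :: s)].
pose PB := [pred B : {set V} | (B \subset Q) && (t <= #|B|)%N].
have gB : (g <= \sum_(B | PB B) isum m (fun s => SB B s : nat))%N.
  rewrite -isum_sum; apply: leq_isum => s _; case: (leqP t (d s)) => // td.
  pose B := [set x in Q | S (x :: s)].
  have dB : d s = #|B|.
    rewrite /d -sum1_card [RHS](eq_bigl (fun x => (x \in Q) && S (x :: s))).
      by rewrite [RHS]big_mkcondr; apply: eq_bigr => x _; case: (S _).
    by move=> x; rewrite !inE.
  rewrite (bigD1 B)/=; last first.
    apply/andP; split; last by rewrite -dB.
    by apply/fintype.subsetP => x; rewrite inE => /andP[].
  apply: leq_trans (leq_addr _ _); rewrite lt0b; apply/forall_inP => x.
  by rewrite inE => /andP[].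
(* Each continuation counted by [g] is compatible with at least [t] elements of [Q]; by pigeonhole
   one set [B] of at least [t] elements works for a share [c'] of all continuations. *)
have [B [BQ tB hB]] : exists B : {set V}, [/\ B \subset Q, (t <= #|B|)%N &
    c' * N <= (isum m (fun s => SB B s : nat))%:R].
  apply: contrapT => no.
  have : g%:R <= \sum_(B | B \in powerset Q) (c' * N).
    apply: le_trans (_ : (\sum_(B | PB B) isum m (fun s => SB B s : nat))%:R <= _).
      by rewrite ler_nat.
    rewrite natr_sum [leRHS](bigID (fun B : {set V} => (t <= #|B|)%N)) /=.
    rewrite (eq_bigl (fun B : {set V} => (B \in powerset Q) && (t <= #|B|)%N)); last first.
      by move=> B; rewrite powersetE.
    rewrite -[leLHS]addr0; apply: lerD; last by apply: sumr_ge0 => B _; rewrite mulr_ge0 ?ltW.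
    apply: ler_sum => B /andP[]; rewrite powersetE => BQ tB.
    by rewrite leNgt; apply/negP => /ltW lt; apply: no; exists B.
  rewrite sumr_const card_powerset cQ -[c' * N *+ _]mulr_natl natrX mulrA.
  have -> : 2 ^+ q * c' = c / 8 by rewrite /c' mulrC divfK ?gt_eqF.
  have cN : 0 < c * N by rewrite mulr_gt0.
  lra.
have [A [tA hA]] := IH1 V Vn1 (SB B) hB.
exists (fun i => if i is i'.+1 then A i' else B); split => [[|i] im|f fA]; [exact: tB|exact: tA|].
rewrite mkseqS; have /forall_inP := hA (f \o succn) (fun i im => fA i.+1 im); apply.
exact: (fA 0%N).
Qed.

(** * Blow-ups and sampling: from homomorphism-free to free 3-graphs *)

Local Open Scope nat_scope.

(** The excluded index [l.-1] is the hyperedge removed from the tight cycle. *)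
Definition cycle_hom l (W : Type) (h : W -> W -> W -> bool) (u : 'I_l -> W) :=
  [forall i : 'I_l, (i < l.-1) ==> h (u i) (u (ordS i)) (u (ordS (ordS i)))].

Lemma walk_fun (V : finType) (h : V -> V -> V -> bool) k x y a b : walk h k x y a b ->
  exists g : nat -> V, [/\ g 0 = x, g 1 = y, g k = a, g k.+1 = b &
    forall i, i < k -> h (g i) (g i.+1) (g i.+2)].
Proof.
elim => [u v|{}k u v z c d huvz _ [g [g0 g1 gk gk1 gh]]].
  by exists (fun i => if i is 0 then u else v).
exists (fun i => if i is i'.+1 then g i' else u); split => //.
by case=> [_|i ik]; [rewrite g0 g1 | apply: gh].
Qed.

Lemma closed_walk_hom (V : finType) (h : V -> V -> V -> bool) l : 1 < l ->
  closed_walk h l -> exists u : 'I_l -> V, cycle_hom h u.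
Proof.
move=> l1 [x [y [z /walk_fun[g [g0 g1 gk gl gh]]]]]; exists (fun i => g i).
apply/forallP => i; apply/implyP => il; have := gh i il => /=.
have E1 : i.+1 %% l = i.+1 by rewrite modn_small//; lia.
rewrite E1; have [E|E] := eqVneq i.+2 l.
  by rewrite E modnn g0 -gl prednK// ltnW.
by rewrite modn_small//; lia.
Qed.

Section Blowup.
Variables (V : finType) (h : V -> V -> V -> bool) (l m : nat) (v0 : V).
Hypotheses (hs : sym3 h) (hi : irr3 h) (l0 : 0 < l).
Variable g : 'I_l -> 'I_m.
Definition pull (s : seq V) (i j k : 'I_m) := h (nth v0 s i) (nth v0 s j) (nth v0 s k).
Definition pattern s := uniq s && cycle_hom (pull s) g.

(** Vertex [a] goes to the element of index [a] in the part [A (g a)]. Vertices in one part are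
    distinct by their indices, those in different parts because transversals have no repetition,
    although disjointness of the parts is not assumed. Each hyperedge is read off a transversal
    through its three vertices. *)
Lemma blowup_hom (A : nat -> {set V}) : (forall i, i < m -> l <= #|A i|) ->
  (forall f : nat -> V, (forall i, i < m -> f i \in A i) -> pattern (mkseq f m)) ->
  exists u : 'I_l -> V, injective u /\ cycle_hom h u.
Proof.
move=> tA hA.
pose u (a : 'I_l) := nth v0 (enum (A (g a))) a.
have szA i : i < m -> l <= size (enum (A i)) by move=> im; rewrite -cardE; apply: tA.
have uA a : u a \in A (g a).
  by rewrite -mem_enum mem_nth// (leq_trans (ltn_ord a))// szA.
pose f a b c i := if i == g a :> nat then u a else if i == g b :> nat then u b
  else if i == g c :> nat then u c else nth v0 (enum (A i)) 0.
have fA a b c i : i < m -> f a b c i \in A i.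
  move=> im; rewrite /f; do 3!case: eqP => [->//|_].
  by rewrite -mem_enum mem_nth// (leq_trans l0)// szA.
have fg a b c d : nth v0 (mkseq (f a b c) m) (g d) = f a b c (g d) by rewrite nth_mkseq.
have fga a b c : f a b c (g a) = u a by rewrite /f eqxx.
have fgb a b c : g b != g a -> f a b c (g b) = u b.
  by rewrite /f val_eqE => /negbTE->; rewrite eqxx.
have fgc a b c : g c != g a -> g c != g b -> f a b c (g c) = u c.
  by rewrite /f !val_eqE => /negbTE-> /negbTE->; rewrite eqxx.
exists u; split.
  move=> a b uab; have [gab|gab] := eqVneq (g b) (g a).
    move: uab; rewrite /u gab => /eqP; rewrite nth_uniq ?enum_uniq//.
    - by move=> /eqP/val_inj.
    - by rewrite (leq_trans (ltn_ord a))// szA.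
    - by rewrite (leq_trans (ltn_ord b))// szA.
  have /andP[un _] := hA (f a b a) (fA a b a).
  move: uab; rewrite -(fga a b a) -(fgb a b a)// -!fg => /eqP.
  rewrite nth_uniq ?size_mkseq// => /eqP/val_inj E.
  by rewrite E eqxx in gab.
apply/forallP => i; apply/implyP => il.
have /andP[_ /forallP/(_ i)] := hA (f i (ordS i) (ordS (ordS i))) (fA _ _ _).
rewrite il /= /pull !fg => hf.
have n1 : g (ordS i) != g i by apply: contraTneq hf => ->; rewrite hi.
have n2 : g (ordS (ordS i)) != g (ordS i).
  by apply: contraTneq hf => ->; rewrite (h_rot hs) hi.
have n3 : g (ordS (ordS i)) != g i.
  by apply: contraTneq hf => ->; rewrite -(h_rot hs) hi.
by move: hf; rewrite fga fgb// fgc.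
Qed.

End Blowup.

Section Sampling.
Variables (V : finType) (h : V -> V -> V -> bool) (m : nat) (v0 : V).
Hypotheses (hs : sym3 h) (hi : irr3 h).
Local Notation n := #|V|.

(** Each ordered triple of distinct positions leaves m - 3 free coordinates; triples with a repeated
    position are discarded. *)
Lemma sample_tot : m * (m - 1) * (m - 2) * (n ^ (m - 3) * tot h) <=
  isum m (fun s => tot (@pull V h m v0 s)).
Proof.
rewrite /tot isum_sum.
rewrite (_ : m * (m - 1) * (m - 2) * _ = \sum_(i < m) ((m - 1) * ((m - 2) * (n ^ (m - 3) * tot h)))); last first.
  by rewrite sum_nat_const card_ord !mulnA.
apply: leq_sum => i _; rewrite isum_sum (bigD1 i)//=; apply: leq_trans (leq_addl _ _).
rewrite (_ : (m - 1) * _ = \sum_(j < m | j != i) ((m - 2) * (n ^ (m - 3) * tot h))); last first.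
  by rewrite sum_nat_const; congr (_ * _); have := cardC1 i; rewrite card_ord subn1 => <-.
apply: leq_sum => j ji; rewrite isum_sum (bigD1 i)//= (bigD1 j)//=.
apply: leq_trans (leq_addl _ _); apply: leq_trans (leq_addl _ _).
rewrite (_ : (m - 2) * _ = \sum_(k < m | (k != i) && (k != j)) (n ^ (m - 3) * tot h)); last first.
  rewrite sum_nat_const; congr (_ * _).
  have := cardsC [set i; j]; rewrite cards2 eq_sym ji card_ord => E.
  rewrite -[m in m - 2]E addKn; apply: eq_card => k; rewrite !inE negb_or //.
apply: leq_sum => k /andP[ki kj]; rewrite /pull (isum3 v0 (fun x y z => h x y z : nat))//.
- by rewrite eq_sym.
- by rewrite eq_sym.
by rewrite eq_sym.
Qed.

Lemma sample_nonuniq : 1 < m -> isum m (fun s : seq V => ~~ uniq s : nat) <= m * m * n ^ m.-1.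
Proof.
move=> m1.
apply: (@leq_trans (isum m (fun s : seq V =>
    \sum_(i < m) \sum_(j < m | j != i) (nth v0 s i == nth v0 s j)))).
  apply: leq_isum => s sm; case: (boolP (uniq s)) => //= /(uniqPn v0)[i [j [ij js E]]].
  rewrite sm in js; have im := ltn_trans ij js.
  rewrite (bigD1 (Ordinal im))//= (bigD1 (Ordinal js))/=; first by rewrite E eqxx.
  by rewrite -val_eqE /= gtn_eqF.
rewrite isum_sum (_ : m * m * n ^ m.-1 = \sum_(i < m) (m * n ^ m.-1)); last first.
  by rewrite sum_nat_const card_ord mulnA.
apply: leq_sum => i _; rewrite isum_sum.
apply: (@leq_trans (\sum_(j < m) n ^ m.-1)); last by rewrite sum_nat_const card_ord.
rewrite big_mkcond; apply: leq_sum => j _; case: ifP => // ji.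
rewrite (isum2 v0 (fun x y => (x == y) : nat))//; last by rewrite eq_sym.
rewrite (eq_bigr (fun=> 1)); last first.
  by move=> x _; rewrite (bigD1 x)//= eqxx big1 ?addn0// => y; rewrite eq_sym => /negbTE->.
rewrite sum_cst muln1 mulnC -expnS leq_eqVlt; apply/orP; left; apply/eqP; congr (_ ^ _); lia.
Qed.

End Sampling.

Local Open Scope ring_scope.

Lemma tot_le (V : finType) (h : V -> V -> V -> bool) : (tot h <= #|V| ^ 3)%N.
Proof.
rewrite !expnS expn0 muln1 /tot -sum_cst; apply: leq_sum => x _.
rewrite -sum_cst; apply: leq_sum => y _; rewrite -[leqRHS]muln1 -sum_cst.
by apply: leq_sum => z _; apply: leq_b1.
Qed.

Section FreeBound.
Variables (R : realType) (K l : nat).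
Hypothesis bound : forall (V : finType) (h : V -> V -> V -> bool),
  sym3 h -> irr3 h -> consist h K -> (4 * tot h <= #|V| ^ 3 + 24 * #|V| ^ 2)%N.
Hypotheses (l3 : ~~ (3 %| l)%N) (lK : (2 * K + 4 <= l)%N).

(** A repetition-free sample without a pattern has no closed walk of length [l], so it is consistent
    and [bound] applies on [m] points. Otherwise the defect in parentheses is at least 1 and the
    trivial bound m^3 suffices. *)
Lemma sample_bound (V : finType) (h : V -> V -> V -> bool) m (v0 : V) s :
  sym3 h -> irr3 h ->
  (4 * tot (@pull V h m v0 s) <= (m ^ 3 + 24 * m ^ 2) +
    4 * m ^ 3 * (~~ uniq s + \sum_(g : {ffun 'I_l -> 'I_m}) pattern h v0 g s))%N.
Proof.
move=> hs hi.
case: (posnP (~~ uniq s + \sum_(g : {ffun 'I_l -> 'I_m}) pattern h v0 g s)) => [E|pos].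
  rewrite E muln0 addn0; move/eqP: E; rewrite addn_eq0 => /andP[us /eqP E].
  have {}us : uniq s by case: (uniq s) us.
  rewrite -[m in leqRHS]card_ord; apply: bound.
  - by split=> i j k; [apply: hs.1 | apply: hs.2].
  - by move=> i k; apply: hi.
  apply: (@consist_of_no_closed_walk _ _ _ _ l) => //.
  - by split=> i j k; [apply: hs.1 | apply: hs.2].
  - by move=> i k; apply: hi.
  have l1 : (1 < l)%N by clear -lK; lia.
  move=> /(closed_walk_hom l1)[u hu].
  have /eqP := E; rewrite sum_nat_eq0 => /forallP/(_ (finfun u)).
  rewrite /pattern us /= (_ : cycle_hom _ _) //.
  by apply/forallP => i; rewrite !ffunE; apply: (forallP hu).
apply: leq_trans (leq_addl _ _).
rewrite -mulnA leq_mul2l /= -[leqLHS]muln1; apply: leq_mul => //.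
by apply: leq_trans (tot_le _) _; rewrite card_ord.
Qed.

(** A positive share of patterns would, by [box], contain all transversals of parts of size [l], and
    [blowup_hom] would embed the cycle. *)
Lemma patterns_rare (c : R) m : 0 < c -> exists n0 : nat, forall (V : finType)
    (h : V -> V -> V -> bool) (v0 : V), (n0 <= #|V|)%N -> sym3 h -> irr3 h ->
  ~ (exists u : 'I_l -> V, injective u /\ cycle_hom h u) ->
  forall g : 'I_l -> 'I_m,
  (isum m (fun s => pattern h v0 g s : nat))%:R <= c * #|V|%:R ^+ m.
Proof.
move=> c0; have [n0 hn0] := @box R l m c c0.
exists n0 => V h v0 Vn hs hi no g; rewrite leNgt; apply/negP => /ltW lt.
have l0 : (0 < l)%N by clear -lK; lia.
have [A [tA hA]] := hn0 V Vn (pattern h v0 g) lt.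
by apply: no; apply: (blowup_hom hs hi l0 tA hA).
Qed.

Lemma sample_size (eps : R) : 0 < eps -> exists m : nat, (2 < m)%N /\
  m%:R ^+ 3 + 24 * m%:R ^+ 2 <= (1 + 2 * eps) * (m%:R * (m%:R - 1) * (m%:R - 2)).
Proof.
(* The linear term to beat is 27m, and m >= 4 gives m - 3 >= m / 4; hence 108 = 4 times 27. *)
move=> e0; have [m hm] := ex_nat_gt (Num.max 3 (108 / (2 * eps))).
exists m; move: hm; rewrite gt_max => /andP[m3 me]; split.
  by move: m3; rewrite ltr_nat => /ltnW.
move: me; rewrite ltr_pdivrMr ?mulr_gt0// => me.
have m4 : 4 <= m%:R :> R by move: m3; rewrite ltr_nat ler_nat.
have m0 : 0 < m%:R :> R by lra.
have -> : m%:R ^+ 3 + 24 * m%:R ^+ 2 = m%:R * (m%:R * (m%:R + 24)) :> R by ring.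
have -> : (1 + 2 * eps) * (m%:R * (m%:R - 1) * (m%:R - 2)) =
  m%:R * (m%:R * (m%:R - 3) + 2 + (m%:R * (2 * eps)) * (m%:R - 3) + 4 * eps) by ring.
rewrite ler_pM2l//.
have : 108 * (m%:R - 3) <= m%:R * (2 * eps) * (m%:R - 3).
  by apply: ler_wpM2r; [lra | exact: ltW].
lra.
Qed.

(** Averaging [sample_bound] over all samples, the budget 4 eps is spent as 2 eps on the finite
    sample size, eps on repetitions and eps on patterns. *)
Theorem free_bound (eps : R) : 0 < eps -> exists n0 : nat, forall (V : finType)
    (h : V -> V -> V -> bool), (n0 <= #|V|)%N -> sym3 h -> irr3 h ->
  ~ (exists u : 'I_l -> V, injective u /\ cycle_hom h u) ->
  (tot h)%:R <= (1 / 4 + eps) * #|V|%:R ^+ 3.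
Proof.
move=> e0; have [m [m2 hm]] := sample_size e0.
pose a : R := m%:R.
have a3 : 3 <= a by rewrite /a ler_nat.
pose D := a * (a - 1) * (a - 2).
have D0 : 0 < D by rewrite /D !mulr_gt0//; lra.
pose Gc : R := #|{ffun 'I_l -> 'I_m}|%:R.
have Gc0 : 0 <= Gc by rewrite ler0n.
have a30 : 0 < 4 * a ^+ 3 by rewrite mulr_gt0// exprn_gt0//; lra.
pose c := eps * D / (4 * a ^+ 3 * (Gc + 1)).
have c0 : 0 < c by rewrite divr_gt0 ?mulr_gt0//; lra.
have [n1 rare] := patterns_rare m c0.
have [n2 hn2] := ex_nat_gt (4 * a ^+ 5 / (eps * D)).
exists (maxn (maxn n1 n2) 1) => V h; rewrite !geq_max => /andP[/andP[Vn1 Vn2] V0] hs hi no.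
have [v0 _] : exists v0 : V, v0 \in V by apply/card_gt0P.
set n : R := #|V|%:R; have n0 : 0 < n by rewrite ltr0n.
set T : R := (tot h)%:R.
have h1 : 4 * (D * (n ^+ (m - 3) * T)) <=
    n ^+ m * (a ^+ 3 + 24 * a ^+ 2) + 4 * a ^+ 3 * (a * a * n ^+ m.-1 + Gc * (c * n ^+ m)).
  have L := sample_tot h m v0.
  have U : (4 * isum m (fun s => tot (@pull V h m v0 s)) <=
      #|V| ^ m * (m ^ 3 + 24 * m ^ 2) + 4 * m ^ 3 * (isum m (fun s : seq V => ~~ uniq s : nat) +
        \sum_(g : {ffun 'I_l -> 'I_m}) isum m (fun s => pattern h v0 g s : nat)))%N.
    rewrite -isumM -isum_sum -isumD -isumM -isum_cst -isumD.
    by apply: leq_isum => s _; apply: sample_bound.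
  have W := sample_nonuniq v0 (ltnW m2).
  have S : (\sum_(g : {ffun 'I_l -> 'I_m}) isum m (fun s => pattern h v0 g s : nat))%:R <=
      Gc * (c * n ^+ m).
    rewrite natr_sum /Gc mulr_natl -sumr_const; apply: ler_sum => g _; exact: rare.
  have LR : D * (n ^+ (m - 3) * T) <= (isum m (fun s => tot (@pull V h m v0 s)))%:R.
    move: L; rewrite -(ler_nat R) (natrM R (m * _ * _)) !(natrM R (m * _)) (natrM R m).
    by rewrite (natrM R (_ ^ _)) natrX !natrB//; apply: leq_trans m2.
  have WR : (isum m (fun s : seq V => ~~ uniq s : nat))%:R <= a * a * n ^+ m.-1.
    by move: W; rewrite -(ler_nat R) (natrM R (m * _)) (natrM R m) natrX.
  apply: le_trans (_ : 4 * (isum m (fun s => tot (@pull V h m v0 s)))%:R <= _).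
    by rewrite ler_pM2l.
  move: U; rewrite -(ler_nat R) (natrM R 4) natrD (natrM R (_ ^ _)) natrX natrD natrX (natrM R 24) natrX.
  rewrite (natrM R (4 * _)) (natrM R 4) natrX natrD => U; apply: le_trans U _.
  by rewrite lerD2l ler_pM2l// lerD.
have E1 : n ^+ m = n ^+ (m - 3) * n ^+ 3 by rewrite -exprD subnK.
have E2 : n ^+ m.-1 = n ^+ (m - 3) * n ^+ 2 by rewrite -exprD; congr (_ ^+ _); clear -m2; lia.
have p3 : 0 < n ^+ (m - 3) by rewrite exprn_gt0.
have n3 : 0 < n ^+ 3 by rewrite exprn_gt0.
have h2 : 4 * (D * T) <= n ^+ 3 * (a ^+ 3 + 24 * a ^+ 2) + 4 * a ^+ 5 * n ^+ 2
    + (4 * a ^+ 3 * Gc * c) * n ^+ 3.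
  rewrite -(ler_pM2l p3); move: h1; rewrite E1 E2 => h1.
  apply: le_trans (le_trans _ h1) _; rewrite le_eqVlt; apply/orP; left; apply/eqP; ring.
have h3 : 4 * a ^+ 3 * Gc * c <= eps * D.
  have -> : 4 * a ^+ 3 * Gc * c = eps * D * (Gc / (Gc + 1)).
    by rewrite /c; field; apply/andP; split; apply: lt0r_neq0; lra.
  have q1 : Gc / (Gc + 1) <= 1 by rewrite ler_pdivrMr; lra.
  have eD : 0 <= eps * D by rewrite ltW// mulr_gt0.
  by have := ler_wpM2l eD q1; rewrite mulr1.
have h4 : 4 * a ^+ 5 * n ^+ 2 <= eps * D * n ^+ 3.
  have : 4 * a ^+ 5 / (eps * D) <= n by apply: le_trans (ltW hn2) _; rewrite ler_nat.
  rewrite (ler_pdivrMr _ _ (mulr_gt0 e0 D0)) => le1.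
  have -> : eps * D * n ^+ 3 = n * (eps * D) * n ^+ 2 by ring.
  by rewrite ler_pM2r// exprn_gt0.
have h5 : n ^+ 3 * (a ^+ 3 + 24 * a ^+ 2) <= n ^+ 3 * ((1 + 2 * eps) * D) by rewrite ler_pM2l.
have h6 : (4 * a ^+ 3 * Gc * c) * n ^+ 3 <= eps * D * n ^+ 3 by rewrite ler_pM2r.
rewrite -(ler_pM2l D0).
have -> : D * ((1 / 4 + eps) * n ^+ 3) = (n ^+ 3 * ((1 + 2 * eps) * D) + 2 * (eps * D * n ^+ 3)) / 4.
  by field.
lra.
Qed.

End FreeBound.

(** * From ordered relations back to 3-graphs and embedded cycles *)

Section EdgeRelation.
Variable V : finType.
Implicit Type E : {set {set V}}.

Definition edge_rel E x y z := [set x; y; z] \in E.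

Lemma edge_rel_sym E : sym3 (edge_rel E).
Proof.
split=> x y z; rewrite /edge_rel.
  by rewrite (_ : [set x; y; z] = [set y; x; z])//; apply/setP => w; rewrite !inE; do 3!case: eqP.
by rewrite (_ : [set x; y; z] = [set y; z; x])//; apply/setP => w; rewrite !inE; do 3!case: eqP.
Qed.

Lemma edge_rel_irr E : uniform3 E -> irr3 (edge_rel E).
Proof.
move=> /forall_inP u x z; apply/negP => /u; rewrite finset.setUid cards2.
by case: (x == z).
Qed.

Lemma edges_tot E : uniform3 E -> (6 * #|E| <= tot (edge_rel E))%N.
Proof.
move=> /forall_inP u.
have -> : tot (edge_rel E) =
    (\sum_(e in E) \sum_x \sum_y \sum_z ([set x; y; z] == e))%N.
  rewrite [RHS]exchange_big /=; apply: eq_bigr => x _.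
  rewrite [RHS]exchange_big /=; apply: eq_bigr => y _.
  rewrite [RHS]exchange_big /=; apply: eq_bigr => z _; rewrite /edge_rel.
  case: (boolP (_ \in E)) => [h|h]; last first.
    by rewrite big1// => e eE; case: eqP => // E'; rewrite E' eE in h.
  by rewrite (bigD1 [set x; y; z])//= eqxx big1// => e /andP[_]; rewrite eq_sym => /negbTE->.
rewrite mulnC -sum_nat_const; apply: leq_sum => e /u/eqP e3.
have sub x y z : x \in e -> y \in e :\ x -> z \in e :\ x :\ y -> [set x; y; z] == e.
  move=> xe; rewrite !inE => /andP[yx ye] /andP[zy /andP[zx ze]].
  rewrite eqEcard e3; apply/andP; split.
    by apply/fintype.subsetP => w; rewrite !inE => /orP[/orP[]|]/eqP->.
  rewrite -finset.setUA !cardsU1 cards1 !inE negb_or.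
  by rewrite (eq_sym x y) yx (eq_sym x z) zx (eq_sym y z) zy.
apply: (@leq_trans (\sum_(x in e) \sum_(y in e :\ x) \sum_(z in e :\ x :\ y) 1)%N).
  rewrite (eq_bigr (fun=> 2%N)); first by rewrite sum_nat_const e3.
  move=> x xe; have c1 : #|e :\ x| = 2 by move: e3; rewrite (cardsD1 x) xe => -[].
  rewrite (eq_bigr (fun=> 1%N)); first by rewrite sum_nat_const c1.
  by move=> y ye; rewrite sum1_card; move: c1; rewrite (cardsD1 y) ye => -[].
rewrite big_mkcond; apply: leq_sum => x _; case: ifP => // xe.
rewrite big_mkcond; apply: leq_sum => y _; case: ifP => // ye.
rewrite big_mkcond; apply: leq_sum => z _; case: ifP => // ze.
by rewrite sub.
Qed.

End EdgeRelation.

Lemma imset3 (V W : finType) (f : V -> W) a b c :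
  f @: [set a; b; c] = [set f a; f b; f c].
Proof. by rewrite !imsetU !imset_set1. Qed.

Section Cycle.
Variables (l : nat) (hl : (4 <= l)%N).

Lemma cycle_minus_edge (i : 'I_l) : (i < l.-1)%N ->
  [set i; ordS i; ordS (ordS i)] \in tight_cycle_minus_edges l.
Proof.
move=> il; rewrite !inE; apply/andP; split; last by apply/imsetP; exists i.
have l2 : (2 < l)%N by clear -hl; lia.
have l1 : (1 < l)%N by clear -hl; lia.
apply/negP => /eqP/setP E.
have [i0|[i1|i2]] : i = 0 :> nat \/ (i = 1 :> nat \/ (1 < i)%N) by clear; lia.
- have := E (Ordinal l2); rewrite !inE -!val_eqE /= i0 (modn_small l1) (modn_small l2) /=.
  by clear -hl; lia.
- have := E (Ordinal l2); rewrite !inE -!val_eqE /= i1 (modn_small l2) /=.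
  by clear -hl; lia.
have := E i; rewrite !inE eqxx /=; by clear -hl il i2; lia.
Qed.

Lemma contains_cycle (V : finType) (H : graph3 V) :
  contains H (tight_cycle_minus hl) <->
  exists u : 'I_l -> V, injective u /\ cycle_hom (edge_rel (edges H)) u.
Proof.
split=> [[f [fi fe]]|[u [ui /forallP uh]]].
  exists f; split => //; apply/forallP => i; apply/implyP => il.
  by rewrite /edge_rel -imset3; apply: fe; apply: cycle_minus_edge.
exists u; split => // e; rewrite !inE => /andP[ne /imsetP[i _ ei]].
have [il|il] := ltnP i l.-1.
  by have := uh i; rewrite il ei imset3.
case/negP: ne; rewrite ei; apply/eqP/setP => x; rewrite !inE -!val_eqE /=.
have -> : i = l.-1 :> nat by have := ltn_ord i; clear -il hl; lia.
rewrite prednK ?modnn; last by clear -hl; lia.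
by rewrite modn_small ?orbA//; clear -hl; lia.
Qed.

Definition cycle_family : family3 := fun G => G = existT graph3 _ (tight_cycle_minus hl).

Lemma family_freeP (V : finType) (H : graph3 V) :
  family_free cycle_family H <-> ~ contains H (tight_cycle_minus hl).
Proof.
by split=> [h|h F ->]; [apply: (h _ erefl) | ].
Qed.

(** Transport to ordinals, so that constructions may live on arbitrary finite types. *)
Lemma ex_ge (V : finType) (H : graph3 V) :
  ~ contains H (tight_cycle_minus hl) -> (#|edges H| <= ex #|V| cycle_family)%N.
Proof.
case: H => E uE nc; rewrite /edges /=.
pose E' : {set {set 'I_#|V|}} := [set enum_rank @: (e : {set V}) | e in E].
have uE' : uniform3 E'.
  apply/forall_inP => e /imsetP[e0 e0E ->]; rewrite card_imset; last exact: enum_rank_inj.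
  by have /forall_inP := uE; apply.
have <- : #|E'| = #|E| by rewrite card_imset//; apply: imset_inj; apply: enum_rank_inj.
apply: (@leq_bigmax_cond _ _ (fun K : graph3 'I_#|V| => #|edges K|) (exist _ E' uE')).
apply/asboolP/family_freeP => -[f [fi fe]]; apply: nc.
exists (enum_val \o f); split; first by move=> x y /= /enum_val_inj /fi.
move=> e /fe /imsetP[e0 e0E Ee]; rewrite (imset_comp enum_val f) Ee -imset_comp.
rewrite (_ : _ @: _ = e0)//; apply/setP => x; apply/imsetP/idP => [[y ye ->]|xe].
  by rewrite /= enum_rankK.
by exists x; rewrite //= enum_rankK.
Qed.

(** * The lower bound: three copies of a 3-graph and all triples crossing them *)

Section TriplePower.
Hypothesis l3 : ~~ (3 %| l)%N.
Variables (V : finType) (H : graph3 V).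
Local Notation E := (edges H).
Local Notation W := ('Z_3 * V)%type.

Let cross (t : V * V * V) : {set W} := [set (0, t.1.1); (1, t.1.2); (1 + 1, t.2)].
Let copy (p : 'Z_3 * {set V}) : {set W} := pair p.1 @: p.2.
Let E1 : {set {set W}} := [set cross t | t : V * V * V].
Let E2 : {set {set W}} := [set copy p | p in finset.setX [set: 'Z_3] E].

Let uE (e : {set V}) : e \in E -> #|e| = 3.
Proof. by move=> eE; apply/eqP; have /forall_inP := svalP H; apply. Qed.

Let pair_inj (i : 'Z_3) : injective (pair i : V -> W). Proof. by move=> x y []. Qed.

Let card_cross t : #|cross t| = 3.
Proof. by rewrite /cross -finset.setUA !cardsU1 cards1 !inE !xpair_eqE. Qed.

Let unif : uniform3 (E1 :|: E2).
Proof.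
apply/forall_inP => e /setUP[/imsetP[t _ ->]|/imsetP[[i f]]]; first by rewrite card_cross.
by rewrite inE /= => /andP[_ /uE f3] ->; rewrite card_imset ?f3.
Qed.

Definition triple_power : graph3 W := exist _ (E1 :|: E2) unif.

Lemma card_triple_power : (#|V| ^ 3 + 3 * #|E| <= #|edges triple_power|)%N.
Proof.
rewrite /edges /= cardsU.
have -> : E1 :&: E2 = finset.set0.
  apply/setP => e; rewrite !inE; apply/negP => /andP[/imsetP[t _ ->] /imsetP[[i f] _ Ef]].
  have m0 : (0, t.1.1) \in cross t by rewrite !inE eqxx.
  have m1 : (1, t.1.2) \in cross t by rewrite !inE eqxx orbT.
  rewrite Ef in m0 m1; case/imsetP: m0 => x _ [i0 _]; case/imsetP: m1 => y _ [i1 _].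
  by have := etrans i0 (esym i1).
rewrite cards0 subn0; apply: leq_add.
  rewrite card_imset; first by rewrite !card_prod !expnS expn0 muln1 mulnA.
  move=> [[x y] z] [[x' y'] z'] /setP eq.
  have := eq (0, x); have := eq (1, y); have := eq (1 + 1, z).
  rewrite !inE !xpair_eqE /= !eqxx /= ?orbF ?orbT /=.
  by move=> /esym/eqP-> /esym/eqP-> /esym/eqP->.
rewrite card_in_imset; first by rewrite cardsX cardsT card_ord.
move=> [i f] [j g]; rewrite !inE /= => /uE f3 /uE g3 eq.
have [x xf] : exists x, x \in f by apply/card_gt0P; rewrite f3.
have : (i, x) \in copy (j, g) by rewrite -eq; apply/imsetP; exists x.
case/imsetP => y _ /= [ij _]; move: eq; rewrite /copy /= ij => /imset_inj ->//.
Qed.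

Lemma triple_power_edge (p q r : W) : edge_rel (edges triple_power) p q r ->
  [&& p.1 != q.1, q.1 != r.1 & p.1 != r.1] \/
  [/\ p.1 = q.1, q.1 = r.1 & edge_rel E p.2 q.2 r.2].
Proof.
move=> e; have irr := edge_rel_irr (svalP triple_power).
have sym := edge_rel_sym (edges triple_power).
have pq : p != q := h_neq irr e.
have [prq _ qrp _ _] := h_perms sym e.
have qr : q != r := h_neq irr qrp.
have pr : p != r := h_neq irr prq.
clear prq qrp.
move: e; rewrite /edge_rel /edges /= => /setUP[/imsetP[t _ eq]|/imsetP[[i f]]].
  left; have inj (a b : W) : a \in cross t -> b \in cross t -> a != b -> a.1 != b.1.
    by rewrite !inE => /orP[/orP[]|]/eqP-> /orP[/orP[]|]/eqP->; rewrite ?eqxx.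
  have mp : p \in cross t by rewrite -eq !inE eqxx.
  have mq : q \in cross t by rewrite -eq !inE eqxx orbT.
  have mr : r \in cross t by rewrite -eq !inE eqxx !orbT.
  by rewrite !inj.
rewrite inE /= => /andP[_ fE] eq; right.
have mem a : a \in [set p; q; r] -> a.1 = i by rewrite eq => /imsetP[x _ ->].
rewrite (mem p) ?inE ?eqxx// (mem q) ?inE ?eqxx ?orbT// (mem r) ?inE ?eqxx ?orbT//.
split => //; rewrite /edge_rel -(imset3 snd) eq /copy -imset_comp.
by rewrite (eq_imset (g := id)) // imset_id.
Qed.

(** Consecutive hyperedges share two vertices, so all of them cross or all lie in one copy. In the
    crossing case the copies recur with period 3, and returning to the start after [l] steps forces
    3 to divide [l]; in the other case the cycle embeds in [H]. *)
Lemma triple_power_free : ~ contains H (tight_cycle_minus hl) ->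
  ~ contains triple_power (tight_cycle_minus hl).
Proof.
move=> nc /contains_cycle[u [ui /forallP uh]]; apply: nc; apply/contains_cycle.
have l0 : (0 < l)%N by clear -hl; lia.
pose w i := u (Ordinal (ltn_pmod i l0)).
have wE (i : 'I_l) : w i = u i.
  by congr u; apply: val_inj; rewrite /= modn_small.
have wh i : (i < l.-1)%N -> edge_rel (edges triple_power) (w i) (w i.+1) (w i.+2).
  move=> il; have il' : (i < l)%N by clear -il; lia.
  have := uh (Ordinal il'); rewrite il /=.
  have -> : u (Ordinal il') = w i by rewrite -wE.
  have E1' : ordS (Ordinal il') = Ordinal (ltn_pmod i.+1 l0) by apply: val_inj.
  have E2' : ordS (ordS (Ordinal il')) = Ordinal (ltn_pmod i.+2 l0).
    by apply: val_inj; rewrite /= -addn1 modnDml addn1.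
  by rewrite E2' E1'.
have step i : (i < l.-1)%N -> _ := fun il => triple_power_edge (wh i il).
have l1 : (0 < l.-1)%N by clear -hl; lia.
have [d0|e0] := step 0%N l1.
  have dist i : (i < l.-1)%N -> [&& (w i).1 != (w i.+1).1, (w i.+1).1 != (w i.+2).1 & (w i).1 != (w i.+2).1].
    elim: i => // i IH il; have /and3P[_ h2 _] := IH (ltnW il).
    by case: (step _ il) => // -[E _ _]; rewrite E eqxx in h2.
  have per i : (i.+1 < l.-1)%N -> (w i.+3).1 = (w i).1.
    move=> il; have /and3P[a1 a2 a3] := dist i (ltnW il); have /and3P[b1 b2 b3] := dist _ il.
    apply/eqP; move: a1 a2 a3 b1 b2 b3.
    by elim/Z3_ind: (w i).1; elim/Z3_ind: (w i.+1).1; elim/Z3_ind: (w i.+2).1;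
       elim/Z3_ind: (w i.+3).1.
  have per3 k r : (3 * k + r <= l)%N -> (w (3 * k + r)%N).1 = (w r).1.
    elim: k => [//|k IH] le.
    rewrite (_ : (3 * k.+1 + r = (3 * k + r).+3)%N); last by clear; lia.
    by rewrite per; [apply: IH|]; clear -le; lia.
  have wl : w l = w 0%N by congr u; apply: val_inj; rewrite /= modnn mod0n.
  have := per3 (l %/ 3)%N (l %% 3)%N; rewrite mulnC -divn_eq wl => /(_ (leqnn _)).
  have /and3P[n1 n2 n3] := d0.
  have : (l %% 3 = 1 \/ l %% 3 = 2)%N by clear -l3; lia.
  by case=> -> /eqP; [rewrite (negbTE n1) | rewrite (negbTE n3)].
have all i : (i < l.-1)%N -> [/\ (w i).1 = (w 0%N).1, (w i.+1).1 = (w 0%N).1 &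
    edge_rel E (w i).2 (w i.+1).2 (w i.+2).2].
  elim: i => [_|i IH il]; first by case: e0 => -> _.
  have [h1 h2 h3] := IH (ltnW il).
  have e2 : (w i.+1).1 = (w i.+2).1.
    case: (step i (ltnW il)) => [/and3P[+ _ _]|[_ ->]//].
    by rewrite h1 h2 eqxx.
  case: (step _ il) => [/and3P[+ _ _]|[_ _ ?]]; first by rewrite e2 eqxx.
  by split => //; rewrite -e2.
have fst_u (i : 'I_l) : (u i).1 = (w 0%N).1.
  rewrite -wE; have [il|il] := ltnP i l.-1; first by case: (all i il).
  have ie : i = l.-2.+1 :> nat by have := ltn_ord i; clear -il hl; lia.
  by rewrite ie; have [] := all l.-2 _; first by clear -hl; lia.
exists (fun i => (u i).2); split.
  move=> i j /= eq; apply: ui; apply/eqP; rewrite -pair_eqE /pair_eq /=.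
  by rewrite !fst_u eq !eqxx.
apply/forallP => i; apply/implyP => il; have [_ _] := all i il.
have E1' : Ordinal (ltn_pmod i.+1 l0) = ordS i by apply: val_inj.
have E2' : Ordinal (ltn_pmod i.+2 l0) = ordS (ordS i).
  by apply: val_inj; rewrite /= -[in RHS]addn1 modnDml addn1.
by rewrite wE /w E1' E2'.
Qed.

End TriplePower.

(** With n = 3^k the invariant is e >= (n^3 - n) / 24, the solution of e(3n) = n^3 + 3 e(n) with
    e(1) = 0. *)
Lemma iterated_construction (k : nat) : ~~ (3 %| l)%N -> exists (V : finType) (H : graph3 V),
  [/\ #|V| = (3 ^ k)%N, ~ contains H (tight_cycle_minus hl) &
      (27 ^ k <= 24 * #|edges H| + 3 ^ k)%N].
Proof.
move=> l3; elim: k => [|k [V [H [cV nc le]]]].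
  have u0 : uniform3 (finset.set0 : {set {set unit}}) by apply/forall_inP => e; rewrite inE.
  exists unit, (exist _ finset.set0 u0); split; first by rewrite card_unit.
    move=> /contains_cycle[u [_ /forallP]].
    have l0 : (0 < l)%N by clear -hl; lia.
    move=> /(_ (Ordinal l0)); rewrite /edge_rel /edges /= inE.
    by have -> : (0 < l.-1)%N by clear -hl; lia.
  by rewrite expn0 leq_addl.
exists ('Z_3 * V)%type, (triple_power H); split.
- by rewrite card_prod card_ord cV expnS.
- exact: triple_power_free.
have E27 : ((3 ^ k) ^ 3 = 27 ^ k)%N by rewrite -expnM mulnC expnM.
have := card_triple_power H; rewrite cV E27 !expnS.
by move: le; move: (27 ^ k)%N (3 ^ k)%N => x y; clear; lia.
Qed.

End Cycle.

(** * Passage to the Turan density *)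

Lemma bin3 n : ('C(n, 3) * 6 = n * (n - 1) * (n - 2))%N.
Proof.
have := bin_ffact n 3; rewrite (_ : 3`! = 6)%N// => ->.
by rewrite !ffactnSr ffactn0 mul1n subn0.
Qed.

(** Four times (n^3 - n) / 24 is already at least n (n - 1)(n - 2) / 6, with no error term. *)
Lemma turan_ratio_lower (R : realType) l (hl : (4 <= l)%N) k : ~~ (3 %| l)%N ->
  1 / 4 <= turan_ratio R (cycle_family hl) (3 ^ k.+1).
Proof.
move=> l3; have [V [H [cV nc le]]] := iterated_construction hl k.+1 l3.
have := ex_ge nc; rewrite cV => ge; rewrite /turan_ratio.
have n3 : (3 <= 3 ^ k.+1)%N by rewrite expnS leq_pmulr// expn_gt0.
have c0 : (0 < 'C(3 ^ k.+1, 3))%N by rewrite bin_gt0.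
rewrite ler_pdivlMr ?ltr0n//.
suff : ('C(3 ^ k.+1, 3) <= 4 * ex (3 ^ k.+1) (cycle_family hl))%N.
  by rewrite -(ler_nat R) (natrM R 4); lra.
have := bin3 (3 ^ k.+1).
have E27 : (27 ^ k.+1 = 3 ^ k.+1 * 3 ^ k.+1 * 3 ^ k.+1)%N.
  by rewrite -!expnMn.
move: le ge n3; rewrite E27; move: (3 ^ k.+1)%N 'C(_, _) (ex _ _) (#|_|) => n c e f le ge n3 hc.
have : (n * (n - 1) * (n - 2) + n <= n * n * n)%N.
  have [m ->] : exists m, n = m.+2 by exists n.-2; clear -n3; lia.
  by rewrite !subSS !subn0; nia.
by clear -le ge hc; lia.
Qed.

Theorem theorem1p1 (R : realType) :
  exists L : nat, forall (l : nat) (hl : (4 <= l)%N),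
    (L < l)%N -> ~~ (3 %| l)%N ->
    turan_density R (tight_cycle_minus hl) = 1 / 4.
Proof.
pose rho : R := (1 / 100) ^+ 2.
have r0 : 0 < rho by rewrite exprn_gt0// divr_gt0.
have d0 : 0 < (rho ^+ 4 / 36) ^+ 2 by rewrite exprn_gt0// divr_gt0// exprn_gt0.
have [D hD] := ex_nat_gt (((rho ^+ 4 / 36) ^+ 2)^-1).
have {}hD : 1 < D%:R * (rho ^+ 4 / 36) ^+ 2 by rewrite -ltr_pdivrMr// div1r.
pose K := (3 * (7 * D + 10))%N.
have bound := density_bound r0 (lexx _) hD (leqnn K).
exists (2 * K + 4)%N => l hl lL l3.
have cv := @is_cvg_turan_ratio R (cycle_family hl).
rewrite /turan_density -/(cycle_family hl) /family_turan_density.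
set u := turan_ratio R _; set a := lim _.
have ua : (u @ \oo --> a)%classic by exact: cv.
apply/eqP; rewrite eq_le; apply/andP; split; rewrite leNgt; apply/negP => lt; last first.
  (* Since the limit exists, its lower bound can be read off along powers of 3. *)
  have [N _ hN] := cvgr_lt _ ua _ lt.
  have Nle : (N <= 3 ^ N.+1)%N by apply: ltnW; apply: ltnW; apply: ltn_expl.
  have := hN _ Nle; have := turan_ratio_lower R hl N l3.
  by rewrite -/u => h1 h2; have := le_lt_trans h1 h2; rewrite ltxx.
(* Halfway between 1/4 and the supposed larger limit. Then 1/4 + eps = z - eps, and the remaining
   eps absorbs the difference between n^3 and n (n - 1)(n - 2). *)
pose z := (1 / 4 + a) / 2.
have za : z < a by rewrite /z; lra.
pose eps := (z - 1 / 4) / 2.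
have e0 : 0 < eps by rewrite /eps /z; lra.
have [N _ hN] := cvgr_gt _ ua _ za.
have [n0 hn0] := free_bound bound l3 (ltnW lL) e0.
have [n1 hn1] := ex_nat_gt (3 * z / eps).
pose n := maxn (maxn N n0) (maxn n1 3).
have Nn : (N <= n)%N by rewrite !leq_max leqnn.
have n0n : (n0 <= n)%N by rewrite !leq_max leqnn orbT.
have n1n : (n1 <= n)%N by rewrite !leq_max leqnn !orbT.
have n3 : (3 <= n)%N by rewrite !leq_max leqnn !orbT.
have := hN n Nn; apply/negP; rewrite -leNgt /u /turan_ratio.
have c0 : (0 < 'C(n, 3))%N by rewrite bin_gt0.
rewrite ler_pdivrMr ?ltr0n//.
have exn : 6 * (ex n (cycle_family hl))%:R <= (1 / 4 + eps) * n%:R ^+ 3 :> R.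
  have p0 : 0 <= (1 / 4 + eps) * n%:R ^+ 3 :> R.
    by rewrite mulr_ge0 ?exprn_ge0// ltW// addr_gt0// divr_gt0.
  rewrite /ex; apply: (big_ind (fun k : nat => 6 * k%:R <= (1 / 4 + eps) * n%:R ^+ 3 :> R)).
  - by rewrite mulr0.
  - by move=> x y hx hy; case: (leqP x y) => _.
  move=> H /asboolP/family_freeP nc.
  have := hn0 'I_n (edge_rel (edges H)); rewrite card_ord => /(_ n0n (edge_rel_sym _)).
  move=> /(_ (edge_rel_irr (svalP H)) (fun ex => nc ((contains_cycle hl H).2 ex))).
  apply: le_trans; rewrite -(natrM R 6) ler_nat; exact: edges_tot (svalP H).
have C6 : 'C(n, 3)%:R * 6 = n%:R * (n%:R - 1) * (n%:R - 2) :> R.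
  have := congr1 (fun k : nat => k%:R : R) (bin3 n).
  by rewrite !natrM !natrB// (leq_trans _ n3).
have nz : 3 * z <= n%:R * eps.
  rewrite -ler_pdivrMr//; apply: le_trans (ltW hn1) _; by rewrite ler_nat.
have nR : 0 < n%:R :> R by rewrite ltr0n (leq_trans _ n3).
have key : (1 / 4 + eps) * n%:R ^+ 3 <= z * (n%:R * (n%:R - 1) * (n%:R - 2)).
  have -> : (1 / 4 + eps) * n%:R ^+ 3 = n%:R * (n%:R * ((z - eps) * n%:R)).
    by rewrite /eps; field.
  have -> : z * (n%:R * (n%:R - 1) * (n%:R - 2)) = n%:R * (n%:R * (z * n%:R - 3 * z) + 2 * z).
    by ring.
  rewrite ler_pM2l//; apply: le_trans (_ : n%:R * (z * n%:R - 3 * z) <= _).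
    by rewrite ler_pM2l//; lra.
  by rewrite lerDl /z mulr_ge0//; lra.
rewrite -C6 in key; have le6 := le_trans exn key.
move: le6; set e := (ex _ _)%:R; set c := 'C(_, _)%:R.
have -> : z * (c * 6) = 6 * (z * c) by ring.
by rewrite ler_pM2l.
Qed.
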